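(* Let $U$ be an almost-canonically seminormed ring over a commutative ring $\Bbbk$. The following conditions are equivalent. \begin{itemize} \item[(0)] The strong identity condition (SIC) holds for $U$. \item[(i)] $U$ admits a strong identity expansion. \item[(ii)] For every $n\in\mathbb N$, $\mathfrak L^n$ is a projective object of the category $\mathsf{Mod}^{Ex}(U|)$ of exhaustive left $U$-modules and $\mathfrak R^n$ is a projective object of the category $\mathsf{Mod}^{Ex}(|U)$ of exhaustive right $U$-modules. \item[(iii)] For every $n\in\mathbb N$, the thick induction adjunctions $\mathbf\Phi^{\mathsf L}_n:\mathsf{Mod}(\mathscr A^{\mathsf L}_n|)\rightleftarrows\mathsf{Mod}^{Ex}(U|):\Omega^{\mathsf L}_n$ and $\mathbf\Phi^{\mathsf R}_n:\mathsf{Mod}(|\mathscr A^{\mathsf R}_n)\rightleftarrows\mathsf{Mod}^{Ex}(|U):\Omega^{\mathsf R}_n$ are adjoint equivalences. \end{itemize} Furthermore, these conditions are equivalent to a level-zero condition (iii') in each of the following situations: \begin{itemize} \item[(a)] If every $\mathfrak L^0_p$ ($p\in\mathbb N$) is a finitely generated projective right $\mathsf A_0$-module, then (0) is equivalent to: $\Phi^{\mathsf R}_0:\mathsf{Mod}(\mathsf A_0|\mathsf A_0)\rightleftarrows\mathsf{Mod}^{Ex}({}_{\mathsf A_0}|U):\Omega^{\mathsf R}_0$ is an equivalence. Symmetrically, if every $\mathfrak R^0_{-p}$ is a finitely generated projective left $\mathsf A_0$-module, then (0) is equivalent to: $\Phi^{\mathsf L}_0:\mathsf{Mod}(\mathsf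 A_0|\mathsf A_0)\rightleftarrows\mathsf{Mod}^{Ex}(U|{}_{\mathsf A_0}):\Omega^{\mathsf L}_0$ is an equivalence. \item[(b)] Let $R$ be a ring with a ring homomorphism $R\to\mathsf A_0$. If every $\mathfrak L^0_p$ is a finitely generated projective right $R$-module and $\mathrm{Hom}_R({}_R\mathsf A_0,{}_RR)\cong\mathsf A_0$ as $(\mathsf A_0|R)$-bimodules, then (0) is equivalent to: $\Phi^{\mathsf R}_0:\mathsf{Mod}({}_R|\mathsf A_0)\rightleftarrows\mathsf{Mod}^{Ex}({}_R|U):\Omega^{\mathsf R}_0$ is an equivalence. Symmetrically, if every $\mathfrak R^0_{-p}$ is a finitely generated projective left $R$-module and $\mathrm{Hom}_R((\mathsf A_0)_R,R_R)\cong\mathsf A_0$ as $(R|\mathsf A_0)$-bimodules, then (0) is equivalent to: $\Phi^{\mathsf L}_0:\mathsf{Mod}(\mathsf A_0|{}_R)\rightleftarrows\mathsf{Mod}^{Ex}(U|{}_R):\Omega^{\mathsf L}_0$ is an equivalence. \item[(c)] Suppose $\mathsf A_0$ is augmented (there is a $\Bbbk$-algebra homomorphism $\mathsf A_0\to\Bbbk$, making $\Bbbk$ a left and a right $\mathsf A_0$-module). If every graded component of $\Phi^{\mathsf L}_0(\Bbbk)$ is a finitely generated projective $\Bbbk$-module, then (0) is equivalent to: $\Phi^{\mathsf R}_0:\mathsf{Mod}(|\mathsf A_0)\rightleftarrows\mathsf{Mod}^{Ex}(|U):\Omega^{\mathsf R}_0$ is an equivalence. Symmetrically, if every graded component of $\Phi^{\mathsf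 R}_0(\Bbbk)$ is a finitely generated projective $\Bbbk$-module, then (0) is equivalent to: $\Phi^{\mathsf L}_0:\mathsf{Mod}(\mathsf A_0|)\rightleftarrows\mathsf{Mod}^{Ex}(U|):\Omega^{\mathsf L}_0$ is an equivalence. \end{itemize}
   Context: Conventions: $\Bbbk$ is a fixed commutative ring, $\otimes=\otimes_\Bbbk$, rings are unital associative $\Bbbk$-algebras, $\mathbb N=\{0,1,2,\dots\}$. Almost-canonically seminormed ring: a $\mathbb Z$-graded ring $U=\bigoplus_pU_p$ with a decreasing family of graded subspaces $\mathsf N_{\mathsf L}^nU$ ($n\in\mathbb Z$), write $\mathsf N_{\mathsf L}^nU_p=\mathsf N_{\mathsf L}^nU\cap U_p$, such that $U\cdot U_{\le -n}\subset\mathsf N_{\mathsf L}^nU$ (where $U_{\le -n}=\bigoplus_{p\le -n}U_p$) and this is degreewise dense, i.e. $\mathsf N_{\mathsf L}^nU_p=(U\,U_{\le -n})_p+\mathsf N_{\mathsf L}^{m}U_p$ for all $m\ge n$ and all $p$; and $(\mathsf N_{\mathsf L}^nU_p)U_q\subset\mathsf N_{\mathsf L}^{n-q}U_{p+q}$, $U_p(\mathsf N_{\mathsf L}^nU_q)\subset\mathsf N_{\mathsf L}^nU_{p+q}$. Put $\mathsf N_{\mathsf R}^nU_p:=\mathsf N_{\mathsf L}^{n-p}U_p$ and $\mathsf N_{\mathsf R}^nU=\bigoplus_p\mathsf N_{\mathsf R}^nU_p$. Then $\mathsf N_{\mathsf L}^nU$ is a left ideal, $\mathsf N_{\mathsf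 R}^nU$ a right ideal, and they agree in degree $0$: $\mathsf N^nU_0$. For $n\in\mathbb N$: $\mathfrak L^n=U/\mathsf N_{\mathsf L}^{n+1}U$, $\mathfrak R^n=U/\mathsf N_{\mathsf R}^{n+1}U$ (graded), $\mathsf A_n=U_0/\mathsf N^{n+1}U_0$ (the $n$-th Zhu algebra). An $(S|T)$-bimodule has a left $S$- and a right $T$-action. $\mathfrak L^n$ is a $(U|\mathsf A_n)$-bimodule and $\mathfrak R^n$ an $(\mathsf A_n|U)$-bimodule. Mode transition algebra: the pairing $\circledast:\mathfrak R^0\otimes_U\mathfrak L^0\to\mathsf A_0$ sends $[\alpha]\otimes[\beta]$ ($\alpha,\beta$ homogeneous) to $[\alpha\beta]$ if $\deg\alpha+\deg\beta=0$ and to $0$ otherwise. $\mathfrak A=\mathfrak L^0\otimes_{\mathsf A_0}\mathfrak R^0$, bigraded by $\mathfrak A_{p,-q}=\mathfrak L^0_p\otimes_{\mathsf A_0}\mathfrak R^0_{-q}$, with product $(a\otimes b)\star(a'\otimes b')=a\otimes(b\circledast a')b'$. SIC: there exist $\mathfrak 1_n\in\mathfrak A_{n,-n}$ ($n\in\mathbb N$) with $\mathfrak 1_n\star\mathfrak a=\mathfrak a=\mathfrak a\star\mathfrak 1_m$ for all $n,m\in\mathbb N$, $\mathfrak a\in\mathfrak A_{n,-m}$. Strong identity expansion: let $\widehat U_p=\varprojlim_nU_p/\mathsf N_{\mathsf L}^nU_p$, so $\widehat U_0=\varprojlim_n\mathsf A_n$, and $\mathsf N^n\widehat U_0=\ker(\widehat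 U_0\to U_0/\mathsf N^nU_0)$. It is a sequence $(e_n)_{n\in\mathbb N}$ in $\widehat U_0$ with: (si1) $\sum_ne_n$ converges to $1$; (si2) $e_me_n=0$ for $m\ne n$; (si3) for every $n\in\mathbb N$, $\widehat U_{-n}\cdot e_{<N_n}=0$ and $e_{<N_n}\cdot\widehat U_n=0$, where $N_n$ is the smallest integer with $\sum_{k\ge N_n}e_k\in\mathsf N^n\widehat U_0$ and $e_{<N_n}=\sum_{k<N_n}e_k$. Exhaustive modules: for a left $U$-module $W$, $\Omega^{\mathsf L}_n(W)=\{w:\mathsf N_{\mathsf L}^{n+1}U\cdot w=0\}$; for a right $U$-module, $\Omega^{\mathsf R}_n(W)=\{w:w\cdot\mathsf N_{\mathsf R}^{n+1}U=0\}$; $W$ is exhaustive if it is the union of these subspaces over $n\in\mathbb N$. For a ring $R$, $\mathsf{Mod}^{Ex}(U|{}_R)$ (resp. $\mathsf{Mod}^{Ex}({}_R|U)$) is the category of $(U|R)$-bimodules (resp. $(R|U)$-bimodules) exhaustive over $U$; $\mathsf{Mod}(S|{}_R)$ and $\mathsf{Mod}({}_R|S)$ are all $(S|R)$-, resp. $(R|S)$-bimodules; $\mathsf{Mod}^{Ex}(U|)$, $\mathsf{Mod}(S|)$, etc. denote the case $R=\Bbbk$ (one-sided modules). Induction: $\Phi^{\mathsf L}_n(M)=\mathfrak L^n\otimes_{\mathsf A_n}M$ and $\Phi^{\mathsf R}_n(M)=M\otimes_{\mathsf A_n}\mathfrak R^n$ (graded through $\mathfrak L^n,\mathfrak R^n$),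 left adjoint to $\Omega^{\mathsf L}_n$, resp. $\Omega^{\mathsf R}_n$. Thick Zhu algebras: $\mathscr A^{\mathsf L}_n=\Omega^{\mathsf L}_n(\mathfrak L^n)=\{u\in U:\mathsf N_{\mathsf L}^{n+1}U\cdot u\subset\mathsf N_{\mathsf L}^{n+1}U\}/\mathsf N_{\mathsf L}^{n+1}U$, and $\mathscr A^{\mathsf R}_n=\Omega^{\mathsf R}_n(\mathfrak R^n)$ similarly; these are rings under the multiplication of $U$, acting on $\mathfrak L^n$ on the right, resp. on $\mathfrak R^n$ on the left, and on $\Omega_n^{\mathsf L}(W)$ on the left, resp. on $\Omega^{\mathsf R}_n(W)$ on the right. Thick induction: $\mathbf\Phi^{\mathsf L}_n(M)=\mathfrak L^n\otimes_{\mathscr A^{\mathsf L}_n}M$, $\mathbf\Phi^{\mathsf R}_n(M)=M\otimes_{\mathscr A^{\mathsf R}_n}\mathfrak R^n$, left adjoint to $\Omega^{\mathsf L}_n$, $\Omega^{\mathsf R}_n$. *)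

(* Defs.v *)
From HB Require Import structures.
From mathcomp Require Import all_boot all_order all_algebra ring_quotient.
From mathcomp Require Import boolp zify.

Set Implicit Arguments.
Unset Strict Implicit.
Unset Printing Implicit Defensive.

Import GRing.Theory.
Local Open Scope ring_scope.
Local Open Scope quotient_scope.

Record category := Category {
  Ob :> Type;
  Hom : Ob -> Ob -> Type;
  idm : forall X, Hom X X;
  cmp : forall X Y Z, Hom Y Z -> Hom X Y -> Hom X Z;
  cmp1m : forall X Y (f : Hom X Y), cmp (idm Y) f = f;
  cmpm1 : forall X Y (f : Hom X Y), cmp f (idm X) = f;
  cmpA : forall X Y Z T (f : Hom Z T) (g : Hom Y Z) (h : Hom X Y),
    cmp f (cmp g h) = cmp (cmp f g) h
}.
Arguments Hom {c}.
Arguments idm {c} X.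
Arguments cmp {c X Y Z}.

Record functor (C D : category) := Functor {
  fob :> C -> D;
  fmap : forall X Y : C, Hom X Y -> Hom (fob X) (fob Y);
  fmap1 : forall X : C, fmap (idm X) = idm (fob X);
  fmapM : forall (X Y Z : C) (f : Hom Y Z) (g : Hom X Y),
    fmap (cmp f g) = cmp (fmap f) (fmap g)
}.
Arguments fmap {C D} _ {X Y}.

Record adjunction (C D : category) (F : functor C D) (G : functor D C) :=
  Adjunction {
  adj_unit : forall X : C, Hom X (G (F X));
  adj_counit : forall Y : D, Hom (F (G Y)) Y;
  unit_nat : forall (X Y : C) (f : Hom X Y),
    cmp (adj_unit Y) f = cmp (fmap G (fmap F f)) (adj_unit X);
  counit_nat : forall (X Y : D) (f : Hom X Y),
    cmp (adj_counit Y) (fmap F (fmap G f)) = cmp f (adj_counit X);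
  triangleF : forall X : C, cmp (adj_counit (F X)) (fmap F (adj_unit X)) = idm (F X);
  triangleG : forall Y : D, cmp (fmap G (adj_counit Y)) (adj_unit (G Y)) = idm (G Y)
}.

Section CategoryPredicates.
Variable C : category.

Definition is_iso (X Y : C) (f : Hom X Y) :=
  exists g : Hom Y X, cmp g f = idm X /\ cmp f g = idm Y.

Definition isomorphic (X Y : C) := exists f : Hom X Y, is_iso f.

Definition epi (X Y : C) (f : Hom X Y) :=
  forall (Z : C) (g h : Hom Y Z), cmp g f = cmp h f -> g = h.

Definition projective (P : C) :=
  forall (X Y : C) (e : Hom X Y), epi e ->
  forall f : Hom P Y, exists g : Hom P X, cmp e g = f.

Definition full_sub (P : C -> Prop) : category :=
  @Category {X : C | P X} (fun X Y => Hom (sval X) (sval Y))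
    (fun X => idm (sval X)) (fun X Y Z f g => cmp f g)
    (fun X Y f => cmp1m f) (fun X Y f => cmpm1 f)
    (fun X Y Z T f g h => cmpA f g h).
End CategoryPredicates.

Definition adjoint_equivalence (C D : category) (F : functor C D)
    (G : functor D C) (adj : adjunction F G) :=
  (forall X : C, is_iso (adj_unit adj X)) /\ (forall Y : D, is_iso (adj_counit adj Y)).

(* The [algType] structure of ssralg excludes the zero ring, which does occur
   among the Zhu algebras; hence this variant over [pzRingType].  The structure
   map [kstr] plays the role of [a |-> a%:A]. *)
Record kalg (k : comPzRingType) := KAlg {
  kalg_ring :> pzRingType;
  kstr : {rmorphism k -> kalg_ring};
  kstrC : forall a x, kstr a * x = x * kstr a
}.

Record kalg_hom (k : comPzRingType) (A B : kalg k) := KAlgHom {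
  kah_fun :> {rmorphism A -> B};
  kah_kstr : forall a, kah_fun (kstr A a) = kstr B a
}.

Section Algebras.
Variable k : comPzRingType.

Definition base_alg : kalg k := @KAlg k k idfun (@mulrC k).

Definition kstr_hom (A : kalg k) : kalg_hom base_alg A :=
  @KAlgHom k base_alg A (kstr A) (fun=> erefl).

Definition id_hom (A : kalg k) : kalg_hom A A :=
  @KAlgHom k A A idfun (fun=> erefl).
End Algebras.

Record two_ideal (R : pzRingType) := TwoIdeal {
  tid :> zmodClosed R;
  tidMl : forall a x, x \in tid -> a * x \in tid;
  tidMr : forall a x, x \in tid -> x * a \in tid
}.

Definition qring (R : pzRingType) (J : two_ideal R) := {ideal_quot (tid J)}.

Lemma qpiE (V : zmodType) (I : zmodClosed V) (x y : V) :
  (\pi_({ideal_quot I}) x = \pi_({ideal_quot I}) y) <-> (x - y \in I).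
Proof. by rewrite Quotient.idealrBE; split=> [->|/eqP]. Qed.

Section QuotientRing.
Variables (R : pzRingType) (J : two_ideal R).
HB.instance Definition _ := GRing.Zmodule.on (qring J).
HB.instance Definition _ := Quotient.on (qring J).

Definition qone : qring J := \pi_(qring J) 1.
Definition qmul (x y : qring J) : qring J := \pi_(qring J) (repr x * repr y).

Lemma qmulE (x y : R) : qmul (\pi_(qring J) x) (\pi_(qring J) y) = \pi_(qring J) (x * y).
Proof.
apply/qpiE; set x' := repr _; set y' := repr _.
have hx : x' - x \in tid J by apply/qpiE; rewrite reprK.
have hy : y' - y \in tid J by apply/qpiE; rewrite reprK.
have -> : x' * y' - x * y = (x' - x) * y' + x * (y' - y).
  by rewrite mulrBl mulrBr addrA subrK.
by rewrite rpredD ?(tidMr _ hx) ?(tidMl _ hy).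
Qed.

Lemma qaddE (x y : R) : \pi_(qring J) x + \pi_(qring J) y = \pi_(qring J) (x + y) :> qring J.
Proof. by rewrite -(raddfD \pi_({ideal_quot (tid J)})). Qed.

Lemma qmulA : associative qmul.
Proof.
move=> x y z; rewrite -[x]reprK -[y]reprK -[z]reprK.
rewrite (qmulE (repr y) (repr z)) (qmulE (repr x) (repr y)).
by rewrite (qmulE (repr x)) (qmulE _ (repr z)) mulrA.
Qed.
Lemma qmul1x : left_id qone qmul.
Proof. by move=> x; rewrite -[x]reprK (qmulE 1) mul1r. Qed.
Lemma qmulx1 : right_id qone qmul.
Proof. by move=> x; rewrite -[x]reprK (qmulE _ 1) mulr1. Qed.
Lemma qmulDl : left_distributive qmul +%R.
Proof.
move=> x y z; rewrite -[x]reprK -[y]reprK -[z]reprK.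
rewrite (qaddE (repr x) (repr y)) (qmulE (repr x) (repr z)).
rewrite (qmulE (repr y) (repr z)) (qmulE _ (repr z)).
by rewrite (qaddE (repr x * repr z)) mulrDl.
Qed.
Lemma qmulDr : right_distributive qmul +%R.
Proof.
move=> x y z; rewrite -[x]reprK -[y]reprK -[z]reprK.
rewrite (qaddE (repr y) (repr z)) (qmulE (repr x) (repr z)).
rewrite (qmulE (repr x) (repr y)) (qmulE (repr x)).
by rewrite (qaddE (repr x * repr y)) mulrDr.
Qed.

HB.instance Definition _ := GRing.Zmodule_isPzRing.Build (qring J)
  qmulA qmul1x qmulx1 qmulDl qmulDr.
End QuotientRing.

Record subquotient (k : comPzRingType) (A : kalg k) := SubQuotient {
  sq_S : subringClosed A;
  sq_k : forall a, kstr A a \in sq_S;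
  sq_I : zmodClosed A;
  sq_Ml : forall s x, s \in sq_S -> x \in sq_S -> x \in sq_I ->
    s * x \in sq_I;
  sq_Mr : forall s x, s \in sq_S -> x \in sq_S -> x \in sq_I ->
    x * s \in sq_I
}.

Definition sqring (k : comPzRingType) (A : kalg k) (D : subquotient A) :=
  {x : A | x \in sq_S D}.

Section SubRing.
Variables (k : comPzRingType) (A : kalg k) (D : subquotient A).
HB.instance Definition _ := SubChoice.on (sqring D).
HB.instance Definition _ := 
  GRing.SubChoice_isSubPzRing.Build _ _ (sqring D) (subringClosedP _).

Definition sqideal_pred : {pred sqring D} := fun x => val x \in sq_I D.

Lemma sqideal_predE x : (x \in sqideal_pred) = (val x \in sq_I D).
Proof. by []. Qed.

Lemma sqideal_closed : zmod_closed sqideal_pred.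
Proof.
split; first by rewrite sqideal_predE raddf0 rpred0.
by move=> x y; rewrite !sqideal_predE raddfB; apply: rpredB.
Qed.
HB.instance Definition _ := GRing.isZmodClosed.Build (sqring D) sqideal_pred
  sqideal_closed.

Lemma sqidealMl (a x : sqring D) : x \in sqideal_pred -> a * x \in sqideal_pred.
Proof.
by rewrite !sqideal_predE rmorphM => hx; apply: sq_Ml => //; apply: valP.
Qed.
Lemma sqidealMr (a x : sqring D) : x \in sqideal_pred -> x * a \in sqideal_pred.
Proof.
by rewrite !sqideal_predE rmorphM => hx; apply: sq_Mr => //; apply: valP.
Qed.

Definition sqideal : two_ideal (sqring D) :=
  @TwoIdeal (sqring D) sqideal_pred sqidealMl sqidealMr.

Definition sqcls (x : A) (hx : x \in sq_S D) : qring sqideal :=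
  \pi_(qring sqideal) (exist _ x hx : sqring D).

Definition sqrep (b : qring sqideal) : A := val (repr b).

Definition sqkstr (a : k) : qring sqideal := sqcls (sq_k D a).

Lemma sqrep_in b : sqrep b \in sq_S D. Proof. exact: valP. Qed.

Lemma sqrepK b (hb : sqrep b \in sq_S D) : sqcls hb = b.
Proof.
rewrite /sqcls -[RHS]reprK; congr (\pi _); exact/val_inj.
Qed.

Lemma sqclsE (x y : A) (hx : x \in sq_S D) (hy : y \in sq_S D) :
  (sqcls hx = sqcls hy) <-> (x - y \in sq_I D).
Proof.
by rewrite /sqcls qpiE sqideal_predE raddfB.
Qed.

Lemma sqcls_rep (x : A) (hx : x \in sq_S D) : sqrep (sqcls hx) - x \in sq_I D.
Proof.
by apply/(sqclsE (sqrep_in _) hx); rewrite sqrepK.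
Qed.

Lemma sqclsD (x y : A) (hx : x \in sq_S D) (hy : y \in sq_S D)
  (hxy : x + y \in sq_S D) : sqcls hxy = sqcls hx + sqcls hy.
Proof. by rewrite /sqcls qaddE; congr (\pi _); apply: val_inj. Qed.

Lemma sqclsM (x y : A) (hx : x \in sq_S D) (hy : y \in sq_S D)
  (hxy : x * y \in sq_S D) : sqcls hxy = sqcls hx * sqcls hy.
Proof.
by rewrite /sqcls [RHS]qmulE; congr (\pi _); apply: val_inj.
Qed.

Lemma sqcls1 (h1 : 1 \in sq_S D) : sqcls h1 = 1.
Proof. by rewrite /sqcls; congr (\pi _); apply: val_inj. Qed.

Lemma sqkstr_zmod : zmod_morphism sqkstr.
Proof.
move=> a b; apply/eqP; rewrite eq_sym subr_eq eq_sym; apply/eqP.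
have h : kstr A (a - b) + kstr A b \in sq_S D by rewrite rpredD ?sq_k.
rewrite /sqkstr -(sqclsD _ _ h); apply/sqclsE.
by rewrite raddfB subrK subrr rpred0.
Qed.
Lemma sqkstr_monoid : monoid_morphism sqkstr.
Proof.
split; first by rewrite -(sqcls1 (rpred1 _)); apply/sqclsE;
  rewrite rmorph1 subrr rpred0.
move=> a b; have h : kstr A a * kstr A b \in sq_S D by rewrite rpredM ?sq_k.
by rewrite /sqkstr -(sqclsM _ _ h); apply/sqclsE; rewrite rmorphM subrr rpred0.
Qed.
HB.instance Definition _ := GRing.isZmodMorphism.Build k (qring sqideal) sqkstr
  sqkstr_zmod.
HB.instance Definition _ := GRing.isMonoidMorphism.Build k (qring sqideal)
  sqkstr sqkstr_monoid.

Lemma sqkstrC a x : sqkstr a * x = x * sqkstr a.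
Proof.
rewrite -(sqrepK (sqrep_in x)).
have h : kstr A a * sqrep x \in sq_S D by rewrite rpredM ?sq_k ?sqrep_in.
have h' : sqrep x * kstr A a \in sq_S D by rewrite rpredM ?sq_k ?sqrep_in.
rewrite /sqkstr -(sqclsM _ _ h) -(sqclsM _ _ h'); apply/sqclsE.
by rewrite kstrC subrr rpred0.
Qed.

Definition sqalg : kalg k := @KAlg k (qring sqideal) sqkstr sqkstrC.

Lemma sqrepD b c : sqrep (b + c) - (sqrep b + sqrep c) \in sq_I D.
Proof.
have h : sqrep b + sqrep c \in sq_S D by rewrite rpredD ?sqrep_in.
by apply/(sqclsE (sqrep_in _) h);
  rewrite (sqclsD (sqrep_in _) (sqrep_in _)) !sqrepK.
Qed.
Lemma sqrepM b c : sqrep (b * c) - sqrep b * sqrep c \in sq_I D.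
Proof.
have h : sqrep b * sqrep c \in sq_S D by rewrite rpredM ?sqrep_in.
by apply/(sqclsE (sqrep_in _) h);
  rewrite (sqclsM (sqrep_in _) (sqrep_in _)) !sqrepK.
Qed.
Lemma sqrep1 : sqrep 1 - 1 \in sq_I D.
Proof. by rewrite -(sqcls1 (rpred1 _)) sqcls_rep. Qed.
Lemma sqrepk a : sqrep (kstr sqalg a) - kstr A a \in sq_I D.
Proof. exact: sqcls_rep. Qed.
End SubRing.

(* Bimodules over k-algebras are k-central: both actions of k coincide.  Thus
   left S-modules are (S|k)-bimodules and right S-modules (k|S)-bimodules. *)
Record bimod (k : comPzRingType) (S R : kalg k) := Bimod {
  bsort :> zmodType;
  lact : S -> bsort -> bsort;
  ract : bsort -> R -> bsort;
  lactDl : forall s t x, lact (s + t) x = lact s x + lact t x;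
  lactDr : forall s x y, lact s (x + y) = lact s x + lact s y;
  lactA : forall s t x, lact (s * t) x = lact s (lact t x);
  lact1 : forall x, lact 1 x = x;
  ractDl : forall x y r, ract (x + y) r = ract x r + ract y r;
  ractDr : forall x r t, ract x (r + t) = ract x r + ract x t;
  ractA : forall x r t, ract x (r * t) = ract (ract x r) t;
  ract1 : forall x, ract x 1 = x;
  lractA : forall s x r, ract (lact s x) r = lact s (ract x r);
  lractk : forall a x, lact (kstr S a) x = ract x (kstr R a)
}.
Arguments lact {k S R b}.
Arguments ract {k S R b}.
Notation "s *> x" := (lact s x) (at level 40, left associativity) : ring_scope.
Notation "x <* r" := (ract x r) (at level 40, left associativity) : ring_scope.

Record bhom (k : comPzRingType) (S R : kalg k) (X Y : bimod S R) := BHom {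
  bfun :> X -> Y;
  bfunD : forall x y, bfun (x + y) = bfun x + bfun y;
  bfunl : forall s x, bfun (s *> x) = s *> bfun x;
  bfunr : forall x r, bfun (x <* r) = bfun x <* r
}.

Lemma additive0 (V W : zmodType) (f : V -> W) :
  (forall x y, f (x + y) = f x + f y) -> f 0 = 0.
Proof. by move=> fD; apply: (addrI (f 0)); rewrite -fD !addr0. Qed.

Lemma additiveN (V W : zmodType) (f : V -> W) :
  (forall x y, f (x + y) = f x + f y) -> forall x, f (- x) = - f x.
Proof.
move=> fD x; apply: (addrI (f x)).
by rewrite -fD !subrr (additive0 fD).
Qed.

Lemma additive_sum (V W : zmodType) (f : V -> W) (I : Type) (s : seq I)
    (F : I -> V) : (forall x y, f (x + y) = f x + f y) ->
  f (\sum_(i <- s) F i) = \sum_(i <- s) f (F i).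
Proof. by move=> fD; apply: (big_morph f fD (additive0 fD)). Qed.

Section BimodCategory.
Variables (k : comPzRingType) (S R : kalg k).

Lemma bhom_eq (X Y : bimod S R) (f g : bhom X Y) : (forall x, f x = g x) -> f = g.
Proof.
case: f g => [f f1 f2 f3] [g g1 g2 g3] /= /funext fg; move: g1 g2 g3.
by rewrite -fg => g1 g2 g3; congr BHom; apply: Prop_irrelevance.
Qed.

Definition bid (X : bimod S R) : bhom X X :=
  @BHom k S R X X id (fun _ _ => erefl) (fun _ _ => erefl) (fun _ _ => erefl).

Program Definition bcomp (X Y Z : bimod S R) (f : bhom Y Z) (g : bhom X Y) :
  bhom X Z := @BHom k S R X Z (fun x => f (g x)) _ _ _.
Next Obligation. by rewrite !bfunD. Qed.
Next Obligation. by rewrite !bfunl. Qed.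
Next Obligation. by rewrite !bfunr. Qed.

Program Definition BMod : category :=
  @Category (bimod S R) (@bhom k S R) bid bcomp _ _ _.
Next Obligation. exact: bhom_eq. Qed.
Next Obligation. exact: bhom_eq. Qed.
Next Obligation. exact: bhom_eq. Qed.

Lemma lact0r (X : bimod S R) (s : S) : s *> (0 : X) = 0.
Proof. exact: additive0 (@lactDr k S R X s). Qed.
Lemma ract0l (X : bimod S R) (r : R) : (0 : X) <* r = 0.
Proof. exact: additive0 (fun x y => @ractDl k S R X x y r). Qed.
Lemma lact0l (X : bimod S R) (x : X) : 0 *> x = 0.
Proof. exact: additive0 (fun s t => @lactDl k S R X s t x). Qed.
Lemma ract0r (X : bimod S R) (x : X) : x <* 0 = 0.
Proof. exact: additive0 (@ractDr k S R X x). Qed.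
Lemma lactNr (X : bimod S R) (s : S) (x : X) : s *> (- x) = - (s *> x).
Proof. exact: additiveN (@lactDr k S R X s) _. Qed.
Lemma ractNl (X : bimod S R) (x : X) (r : R) : (- x) <* r = - (x <* r).
Proof. exact: additiveN (fun x y => @ractDl k S R X x y r) _. Qed.
Lemma lactNl (X : bimod S R) (s : S) (x : X) : (- s) *> x = - (s *> x).
Proof. exact: additiveN (fun s t => @lactDl k S R X s t x) _. Qed.
Lemma ractNr (X : bimod S R) (x : X) (r : R) : x <* (- r) = - (x <* r).
Proof. exact: additiveN (@ractDr k S R X x) _. Qed.
Lemma lactBl (X : bimod S R) (s t : S) (x : X) : (s - t) *> x = s *> x - t *> x.
Proof. by rewrite lactDl lactNl. Qed.
Lemma ractBr (X : bimod S R) (x : X) (s t : R) : x <* (s - t) = x <* s - x <* t.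
Proof. by rewrite ractDr ractNr. Qed.
End BimodCategory.

Section Constructions.
Variable k : comPzRingType.

Program Definition regular (S : kalg k) : bimod S S :=
  @Bimod k S S S *%R *%R _ _ _ _ _ _ _ _ _ _.
Next Obligation. exact: mulrDl. Qed.
Next Obligation. exact: mulrDr. Qed.
Next Obligation. by rewrite mulrA. Qed.
Next Obligation. exact: mul1r. Qed.
Next Obligation. exact: mulrDl. Qed.
Next Obligation. exact: mulrDr. Qed.
Next Obligation. by rewrite mulrA. Qed.
Next Obligation. exact: mulr1. Qed.
Next Obligation. by rewrite mulrA. Qed.
Next Obligation. exact: kstrC. Qed.

Program Definition res_l (S S' R : kalg k) (phi : kalg_hom S' S)
    (X : bimod S R) : bimod S' R :=
  @Bimod k S' R X (fun s x => phi s *> x) (fun x r => x <* r)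
    _ _ _ _ _ _ _ _ _ _.
Next Obligation. by rewrite raddfD lactDl. Qed.
Next Obligation. exact: lactDr. Qed.
Next Obligation. by rewrite rmorphM lactA. Qed.
Next Obligation. by rewrite rmorph1 lact1. Qed.
Next Obligation. exact: ractDl. Qed.
Next Obligation. exact: ractDr. Qed.
Next Obligation. exact: ractA. Qed.
Next Obligation. exact: ract1. Qed.
Next Obligation. exact: lractA. Qed.
Next Obligation. by rewrite kah_kstr lractk. Qed.

Program Definition res_r (S R R' : kalg k) (phi : kalg_hom R' R)
    (X : bimod S R) : bimod S R' :=
  @Bimod k S R' X (fun s x => s *> x) (fun x r => x <* phi r)
    _ _ _ _ _ _ _ _ _ _.
Next Obligation. exact: lactDl. Qed.
Next Obligation. exact: lactDr. Qed.
Next Obligation. exact: lactA. Qed.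
Next Obligation. exact: lact1. Qed.
Next Obligation. exact: ractDl. Qed.
Next Obligation. by rewrite raddfD ractDr. Qed.
Next Obligation. by rewrite rmorphM ractA. Qed.
Next Obligation. by rewrite rmorph1 ract1. Qed.
Next Obligation. exact: lractA. Qed.
Next Obligation. by rewrite kah_kstr lractk. Qed.

Section SubBimodule.
Variables (S R : kalg k) (X : bimod S R) (P : zmodClosed X).
Hypothesis Pl : forall s x, x \in P -> s *> x \in P.
Hypothesis Pr : forall x r, x \in P -> x <* r \in P.

Definition subb := {x : X | x \in P}.
HB.instance Definition _ := SubChoice.on subb.
HB.instance Definition _ := [SubChoice_isSubZmodule of subb by <:].

Program Definition sub_bimod : bimod S R :=
  @Bimod k S R subb (fun s x => exist _ (s *> val x) (Pl s (valP x)))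
    (fun x r => exist _ (val x <* r) (Pr r (valP x)))
    _ _ _ _ _ _ _ _ _ _.
Next Obligation. by apply: val_inj; rewrite raddfD /= lactDl. Qed.
Next Obligation. by apply: val_inj; rewrite !raddfD /= lactDr. Qed.
Next Obligation. by apply: val_inj; rewrite /= lactA. Qed.
Next Obligation. by apply: val_inj; rewrite /= lact1. Qed.
Next Obligation. by apply: val_inj; rewrite !raddfD /= ractDl. Qed.
Next Obligation. by apply: val_inj; rewrite !raddfD /= ractDr. Qed.
Next Obligation. by apply: val_inj; rewrite /= ractA. Qed.
Next Obligation. by apply: val_inj; rewrite /= ract1. Qed.
Next Obligation. by apply: val_inj; rewrite /= lractA. Qed.
Next Obligation. by apply: val_inj; rewrite /= lractk. Qed.
End SubBimodule.
End Constructions.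

Section HomLeft.
Variables (k : comPzRingType) (R S T : kalg k).
Variables (X : bimod R S) (Y : bimod R T).

Record lhom := LHom {
  lh_fun :> X -> Y;
  lhD : forall x y, lh_fun (x + y) = lh_fun x + lh_fun y;
  lhl : forall r x, lh_fun (r *> x) = r *> lh_fun x
}.
HB.instance Definition _ := gen_eqMixin lhom.
HB.instance Definition _ := gen_choiceMixin lhom.

Lemma lhom_eq (f g : lhom) : (forall x, f x = g x) -> f = g.
Proof.
case: f g => [f f1 f2] [g g1 g2] /= /funext fg; move: g1 g2.
by rewrite -fg => g1 g2; congr LHom; apply: Prop_irrelevance.
Qed.

Program Definition lhom0 := @LHom (fun=> 0) _ _.
Next Obligation. by rewrite addr0. Qed.
Next Obligation. by rewrite lact0r. Qed.
Program Definition lhomN (f : lhom) := @LHom (fun x => - f x) _ _.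
Next Obligation. by rewrite lhD opprD. Qed.
Next Obligation. by rewrite lhl lactNr. Qed.
Program Definition lhomD (f g : lhom) := @LHom (fun x => f x + g x) _ _.
Next Obligation. by rewrite !lhD addrACA. Qed.
Next Obligation. by rewrite !lhl lactDr. Qed.

Lemma lhomA : associative lhomD.
Proof. by move=> f g h; apply: lhom_eq => x /=; rewrite addrA. Qed.
Lemma lhomC : commutative lhomD.
Proof. by move=> f g; apply: lhom_eq => x /=; rewrite addrC. Qed.
Lemma lhom0D : left_id lhom0 lhomD.
Proof. by move=> f; apply: lhom_eq => x /=; rewrite add0r. Qed.
Lemma lhomND : left_inverse lhom0 lhomN lhomD.
Proof. by move=> f; apply: lhom_eq => x /=; rewrite addNr. Qed.
HB.instance Definition _ := GRing.isZmodule.Build lhom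
  lhomA lhomC lhom0D lhomND.

Program Definition lhom_lact (s : S) (f : lhom) :=
  @LHom (fun x => f (x <* s)) _ _.
Next Obligation. by rewrite ractDl lhD. Qed.
Next Obligation. by rewrite lractA lhl. Qed.
Program Definition lhom_ract (f : lhom) (t : T) :=
  @LHom (fun x => f x <* t) _ _.
Next Obligation. by rewrite lhD ractDl. Qed.
Next Obligation. by rewrite lhl lractA. Qed.

Program Definition hom_l : bimod S T :=
  @Bimod k S T lhom lhom_lact lhom_ract _ _ _ _ _ _ _ _ _ _.
Next Obligation. by apply: lhom_eq => y /=; rewrite ractDr lhD. Qed.
Next Obligation. exact: lhom_eq. Qed.
Next Obligation. by apply: lhom_eq => y /=; rewrite ractA. Qed.
Next Obligation. by apply: lhom_eq => y /=; rewrite ract1. Qed.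
Next Obligation. by apply: lhom_eq => z /=; rewrite ractDl. Qed.
Next Obligation. by apply: lhom_eq => y /=; rewrite ractDr. Qed.
Next Obligation. by apply: lhom_eq => y /=; rewrite ractA. Qed.
Next Obligation. by apply: lhom_eq => y /=; rewrite ract1. Qed.
Next Obligation. exact: lhom_eq. Qed.
Next Obligation. by apply: lhom_eq => y /=; rewrite -lractk lhl lractk. Qed.
End HomLeft.

Section HomRight.
Variables (k : comPzRingType) (R S T : kalg k).
Variables (X : bimod S R) (Y : bimod T R).

Record rhom := RHom {
  rh_fun :> X -> Y;
  rhD : forall x y, rh_fun (x + y) = rh_fun x + rh_fun y;
  rhr : forall x r, rh_fun (x <* r) = rh_fun x <* r
}.
HB.instance Definition _ := gen_eqMixin rhom.
HB.instance Definition _ := gen_choiceMixin rhom.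

Lemma rhom_eq (f g : rhom) : (forall x, f x = g x) -> f = g.
Proof.
case: f g => [f f1 f2] [g g1 g2] /= /funext fg; move: g1 g2.
by rewrite -fg => g1 g2; congr RHom; apply: Prop_irrelevance.
Qed.

Program Definition rhom0 := @RHom (fun=> 0) _ _.
Next Obligation. by rewrite addr0. Qed.
Next Obligation. by rewrite ract0l. Qed.
Program Definition rhomN (f : rhom) := @RHom (fun x => - f x) _ _.
Next Obligation. by rewrite rhD opprD. Qed.
Next Obligation. by rewrite rhr ractNl. Qed.
Program Definition rhomD (f g : rhom) := @RHom (fun x => f x + g x) _ _.
Next Obligation. by rewrite !rhD addrACA. Qed.
Next Obligation. by rewrite !rhr ractDl. Qed.

Lemma rhomA : associative rhomD.
Proof. by move=> f g h; apply: rhom_eq => x /=; rewrite addrA. Qed.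
Lemma rhomC : commutative rhomD.
Proof. by move=> f g; apply: rhom_eq => x /=; rewrite addrC. Qed.
Lemma rhom0D : left_id rhom0 rhomD.
Proof. by move=> f; apply: rhom_eq => x /=; rewrite add0r. Qed.
Lemma rhomND : left_inverse rhom0 rhomN rhomD.
Proof. by move=> f; apply: rhom_eq => x /=; rewrite addNr. Qed.
HB.instance Definition _ := GRing.isZmodule.Build rhom
  rhomA rhomC rhom0D rhomND.

Program Definition rhom_lact (t : T) (f : rhom) :=
  @RHom (fun x => t *> f x) _ _.
Next Obligation. by rewrite rhD lactDr. Qed.
Next Obligation. by rewrite rhr lractA. Qed.
Program Definition rhom_ract (f : rhom) (s : S) :=
  @RHom (fun x => f (s *> x)) _ _.
Next Obligation. by rewrite lactDr rhD. Qed.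
Next Obligation. by rewrite -lractA rhr. Qed.

Program Definition hom_r : bimod T S :=
  @Bimod k T S rhom rhom_lact rhom_ract _ _ _ _ _ _ _ _ _ _.
Next Obligation. by apply: rhom_eq => y /=; rewrite lactDl. Qed.
Next Obligation. by apply: rhom_eq => z /=; rewrite lactDr. Qed.
Next Obligation. by apply: rhom_eq => y /=; rewrite lactA. Qed.
Next Obligation. by apply: rhom_eq => y /=; rewrite lact1. Qed.
Next Obligation. exact: rhom_eq. Qed.
Next Obligation. by apply: rhom_eq => y /=; rewrite lactDl rhD. Qed.
Next Obligation. by apply: rhom_eq => y /=; rewrite lactA. Qed.
Next Obligation. by apply: rhom_eq => y /=; rewrite lact1. Qed.
Next Obligation. exact: rhom_eq. Qed.
Next Obligation. by apply: rhom_eq => y /=; rewrite lractk [in RHS]lractk rhr. Qed.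
End HomRight.

Section Tensor.
Variables (k : comPzRingType) (S R T : kalg k).
Variables (X : bimod S R) (Y : bimod R T).

(* A list of pairs stands for the formal sum of its elements. *)
Inductive tens_rel : seq (X * Y) -> seq (X * Y) -> Prop :=
| tens_refl s : tens_rel s s
| tens_sym s t : tens_rel s t -> tens_rel t s
| tens_trans s t u : tens_rel s t -> tens_rel t u -> tens_rel s u
| tens_cat s s' t t' :
    tens_rel s s' -> tens_rel t t' -> tens_rel (s ++ t) (s' ++ t')
| tens_comm s t : tens_rel (s ++ t) (t ++ s)
| tens_0 y : tens_rel [:: (0, y)] [::]
| tens_Dl x x' y : tens_rel [:: (x + x', y)] [:: (x, y); (x', y)]
| tens_Dr x y y' : tens_rel [:: (x, y + y')] [:: (x, y); (x, y')]
| tens_bal x r y : tens_rel [:: (x <* r, y)] [:: (x, r *> y)].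

Definition tens_eqv : rel (seq (X * Y)) := fun s t => `[< tens_rel s t >].

Lemma tens_eqv_equiv : equiv_class_of tens_eqv.
Proof.
split.
- by move=> s; apply/asboolP/tens_refl.
- by move=> s t; apply/asboolP/asboolP; apply: tens_sym.
- by move=> s t u /asboolP h1 /asboolP h2; apply/asboolP/(tens_trans h1 h2).
Qed.
Canonical tens_equivRel := EquivRelPack tens_eqv_equiv.
Canonical tens_encModRel := defaultEncModRel tens_eqv.

Definition tens := {eq_quot tens_eqv}.
HB.instance Definition _ := Choice.on tens.
HB.instance Definition _ := Quotient.on tens.

Lemma tpiE (s t : seq (X * Y)) : \pi_tens s = \pi_tens t <-> tens_rel s t.
Proof.
split=> [/eqP|h]; first by rewrite (@eqmodE _ tens_equivRel) => /asboolP.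
by apply/eqP; rewrite (@eqmodE _ tens_equivRel); apply/asboolP.
Qed.

Definition tens0 : tens := \pi_tens [::].
Definition tensD (a b : tens) : tens := \pi_tens (repr a ++ repr b).
Definition tnegs (s : seq (X * Y)) := [seq (- xy.1, xy.2) | xy <- s].
Definition tensN (a : tens) : tens := \pi_tens (tnegs (repr a)).

Lemma tensDE s t : tensD (\pi_tens s) (\pi_tens t) = \pi_tens (s ++ t).
Proof. by apply/tpiE/tens_cat; apply/tpiE; rewrite reprK. Qed.

Lemma tnegs_rel s t : tens_rel s t -> tens_rel (tnegs s) (tnegs t).
Proof.
elim=> {s t}.
- by move=> s; apply: tens_refl.
- by move=> s t _; apply: tens_sym.
- by move=> s t u _ h1 _ h2; apply: tens_trans h1 h2.
- by move=> s s' t t' _ h1 _ h2; rewrite /tnegs !map_cat; apply: tens_cat.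
- by move=> s t; rewrite /tnegs !map_cat; apply: tens_comm.
- by move=> y; rewrite /= oppr0; apply: tens_0.
- by move=> x x' y; rewrite /= opprD; apply: tens_Dl.
- by move=> x y y'; apply: tens_Dr.
- by move=> x r y; rewrite /= -ractNl; apply: tens_bal.
Qed.

Lemma tensNE s : tensN (\pi_tens s) = \pi_tens (tnegs s).
Proof. by apply/tpiE/tnegs_rel; apply/tpiE; rewrite reprK. Qed.

Lemma tensA : associative tensD.
Proof.
move=> a b c; rewrite -[a]reprK -[b]reprK -[c]reprK.
by rewrite (tensDE (repr b)) (tensDE (repr a)) (tensDE (repr a)) tensDE catA.
Qed.
Lemma tensC : commutative tensD.
Proof. by move=> a b; apply/tpiE/tens_comm. Qed.
Lemma tens0D : left_id tens0 tensD.
Proof. by move=> a; rewrite -[a in LHS]reprK tensDE /= reprK. Qed.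
Lemma tensND : left_inverse tens0 tensN tensD.
Proof.
move=> a; rewrite -[a]reprK tensNE tensDE; apply/tpiE.
elim: (repr a) => [|[x y] s ih]; first exact: tens_refl.
apply: (@tens_trans _ (([:: (- x, y)] ++ [:: (x, y)]) ++ (tnegs s ++ s))).
  rewrite -[tnegs (_ :: _)]/([:: (- x, y)] ++ tnegs s) -[_ :: s]cat1s -!catA.
  apply: tens_cat; first exact: tens_refl.
  rewrite !catA; apply: tens_cat; last exact: tens_refl.
  exact: tens_comm.
apply: (@tens_trans _ ([::] ++ [::])); last exact: tens_refl.
apply: tens_cat => //.
apply: (@tens_trans _ [:: (- x + x, y)]); first exact/tens_sym/tens_Dl.
by rewrite addNr; apply: tens_0.
Qed.
HB.instance Definition _ := GRing.isZmodule.Build tens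
  tensA tensC tens0D tensND.

Definition tmk (x : X) (y : Y) : tens := \pi_tens [:: (x, y)].

Lemma tpi_sum s : \pi_tens s = \sum_(xy <- s) tmk xy.1 xy.2.
Proof.
elim: s => [|[x y] s ih]; first by rewrite big_nil.
by rewrite big_cons -ih /= -[LHS]/(\pi_tens ([:: (x, y)] ++ s)) -tensDE.
Qed.

Lemma tens_sum (a : tens) : a = \sum_(xy <- repr a) tmk xy.1 xy.2.
Proof. by rewrite -tpi_sum reprK. Qed.

Lemma tmkDl x x' y : tmk (x + x') y = tmk x y + tmk x' y.
Proof.
by rewrite -[RHS]/(tensD _ _) tensDE; apply/tpiE/tens_Dl.
Qed.
Lemma tmkDr x y y' : tmk x (y + y') = tmk x y + tmk x y'.
Proof.
by rewrite -[RHS]/(tensD _ _) tensDE; apply/tpiE/tens_Dr.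
Qed.
Lemma tmkbal x r y : tmk (x <* r) y = tmk x (r *> y).
Proof. exact/tpiE/tens_bal. Qed.
Lemma tmk0l y : tmk 0 y = 0.
Proof. exact: additive0 (fun x x' => tmkDl x x' y). Qed.
Lemma tmk0r x : tmk x 0 = 0.
Proof. exact: additive0 (fun y y' => tmkDr x y y'). Qed.

Definition balanced (V : zmodType) (f : X -> Y -> V) :=
  [/\ forall x x' y, f (x + x') y = f x y + f x' y,
      forall x y y', f x (y + y') = f x y + f x y' &
      forall x r y, f (x <* r) y = f x (r *> y)].

(* The additive map on X (x)_R Y induced by f; meaningful for balanced f. *)
Definition tlift (V : zmodType) (f : X -> Y -> V) (a : tens) : V :=
  \sum_(xy <- repr a) f xy.1 xy.2.

Lemma tlift_pi (V : zmodType) (f : X -> Y -> V) : balanced f ->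
  forall s, tlift f (\pi_tens s) = \sum_(xy <- s) f xy.1 xy.2.
Proof.
case=> fDl fDr fb s.
have h : forall s t, tens_rel s t ->
    \sum_(xy <- s) f xy.1 xy.2 = \sum_(xy <- t) f xy.1 xy.2.
  move=> {}s t; elim=> {s t} //.
  - by move=> s t u _ -> _ ->.
  - by move=> s s' t t' _ h1 _ h2; rewrite !big_cat /= h1 h2.
  - by move=> s t; rewrite !big_cat /= addrC.
  - by move=> y; rewrite big_seq1 big_nil (additive0 (fun x x' => fDl x x' y)).
  - by move=> x x' y; rewrite big_seq1 big_cons big_seq1 /= fDl.
  - by move=> x y y'; rewrite big_seq1 big_cons big_seq1 /= fDr.
  - by move=> x r y; rewrite !big_seq1 /= fb.
by apply: h; apply/tpiE; rewrite reprK.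
Qed.

Lemma tlift_tmk (V : zmodType) (f : X -> Y -> V) : balanced f ->
  forall x y, tlift f (tmk x y) = f x y.
Proof. by move=> fb x y; rewrite tlift_pi // big_seq1. Qed.

Lemma tliftD (V : zmodType) (f : X -> Y -> V) : balanced f ->
  forall a b, tlift f (a + b) = tlift f a + tlift f b.
Proof.
move=> fb a b; rewrite -[a]reprK -[b]reprK -[X in tlift f X]/(tensD _ _).
by rewrite tensDE !(tlift_pi fb) big_cat.
Qed.

Lemma tens_ext (V : zmodType) (f g : tens -> V) :
  (forall a b, f (a + b) = f a + f b) -> (forall a b, g (a + b) = g a + g b) ->
  (forall x y, f (tmk x y) = g (tmk x y)) -> forall a, f a = g a.
Proof.
move=> fD gD fg a; rewrite (tens_sum a) (additive_sum _ _ fD).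
by rewrite (additive_sum _ _ gD); apply: eq_bigr => xy _; apply: fg.
Qed.

Definition tens_lact (s : S) : tens -> tens := tlift (fun x y => tmk (s *> x) y).
Definition tens_ract (a : tens) (t : T) : tens :=
  tlift (fun x y => tmk x (y <* t)) a.

Lemma tens_lact_bal s : balanced (fun x y => tmk (s *> x) y).
Proof.
split=> [x x' y|x y y'|x r y]; first by rewrite lactDr tmkDl.
  by rewrite tmkDr.
by rewrite -lractA tmkbal.
Qed.
Lemma tens_ract_bal t : balanced (fun x y => tmk x (y <* t)).
Proof.
split=> [x x' y|x y y'|x r y]; first by rewrite tmkDl.
  by rewrite ractDl tmkDr.
by rewrite tmkbal lractA.
Qed.
Lemma tens_lactD s a b : tens_lact s (a + b) = tens_lact s a + tens_lact s b.
Proof. exact: tliftD (tens_lact_bal s) _ _. Qed.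
Lemma tens_ractD t a b : tens_ract (a + b) t = tens_ract a t + tens_ract b t.
Proof. exact: tliftD (tens_ract_bal t) _ _. Qed.
Lemma tens_lactE s x y : tens_lact s (tmk x y) = tmk (s *> x) y.
Proof. exact: tlift_tmk (tens_lact_bal s) _ _. Qed.
Lemma tens_ractE t x y : tens_ract (tmk x y) t = tmk x (y <* t).
Proof. exact: tlift_tmk (tens_ract_bal t) _ _. Qed.

Lemma tensor_laws :
  [/\ forall s s' a, tens_lact (s + s') a = tens_lact s a + tens_lact s' a,
      forall s s' a, tens_lact (s * s') a = tens_lact s (tens_lact s' a),
      forall a, tens_lact 1 a = a,
      forall s a t, tens_ract (tens_lact s a) t = tens_lact s (tens_ract a t) &
      forall c a, tens_lact (kstr S c) a = tens_ract a (kstr T c)] /\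
  [/\ forall a t t', tens_ract a (t + t') = tens_ract a t + tens_ract a t',
      forall a t t', tens_ract a (t * t') = tens_ract (tens_ract a t) t' &
      forall a, tens_ract a 1 = a].
Proof.
split; split.
- move=> s s'; apply: tens_ext => [a b|a b|x y]; rewrite ?tens_lactD //.
    by rewrite addrACA.
  by rewrite !tens_lactE lactDl tmkDl.
- move=> s s'; apply: tens_ext => [a b|a b|x y]; rewrite ?tens_lactD //.
  by rewrite !tens_lactE lactA.
- by apply: tens_ext => [a b|a b|x y]; rewrite ?tens_lactD // tens_lactE lact1.
- move=> s a t; move: a.
  apply: tens_ext => [a b|a b|x y]; rewrite ?(tens_lactD, tens_ractD) //.
  by rewrite !(tens_lactE, tens_ractE).
- move=> c; apply: tens_ext => [a b|a b|x y]; rewrite ?(tens_lactD, tens_ractD) //.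
  by rewrite tens_lactE tens_ractE lractk tmkbal lractk.
- move=> a t t'; move: a.
  apply: tens_ext => [a b|a b|x y]; rewrite ?tens_ractD //.
    by rewrite addrACA.
  by rewrite !tens_ractE ractDr tmkDr.
- move=> a t t'; move: a.
  apply: tens_ext => [a b|a b|x y]; rewrite ?tens_ractD //.
  by rewrite !tens_ractE ractA.
- by apply: tens_ext => [a b|a b|x y]; rewrite ?tens_ractD // tens_ractE ract1.
Qed.

Program Definition tensor : bimod S T :=
  @Bimod k S T tens tens_lact tens_ract _ _ _ _ _ _ _ _ _ _.
Next Obligation. by case: tensor_laws => -[h _ _ _ _] _; apply: h. Qed.
Next Obligation. exact: tens_lactD. Qed.
Next Obligation. by case: tensor_laws => -[_ h _ _ _] _; apply: h. Qed.
Next Obligation. by case: tensor_laws => -[_ _ h _ _] _; apply: h. Qed.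
Next Obligation. exact: tens_ractD. Qed.
Next Obligation. by case: tensor_laws => _ [h _ _]; apply: h. Qed.
Next Obligation. by case: tensor_laws => _ [_ h _]; apply: h. Qed.
Next Obligation. by case: tensor_laws => _ [_ _ h]; apply: h. Qed.
Next Obligation. by case: tensor_laws => -[_ _ _ h _] _; apply: h. Qed.
Next Obligation. by case: tensor_laws => -[_ _ _ _ h] _; apply: h. Qed.
End Tensor.

Record left_ideal (k : comPzRingType) (A : kalg k) := LeftIdeal {
  lid :> zmodClosed A;
  lidM : forall a x, x \in lid -> a * x \in lid
}.

Record right_ideal (k : comPzRingType) (A : kalg k) := RightIdeal {
  rid :> zmodClosed A;
  ridM : forall a x, x \in rid -> x * a \in rid
}.

(* Subquotients S / (S :&: N) for S contained in the idealizer of N.  For S the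
   degree 0 part this gives Zhu algebras, for S the whole idealizer the thick
   Zhu algebras. *)
Record left_sq (k : comPzRingType) (A : kalg k) (N : left_ideal A) := LeftSq {
  lsq :> subquotient A;
  lsqN : forall u s, u \in lid N -> s \in sq_S lsq -> u * s \in lid N;
  lsqI : forall s, s \in sq_S lsq -> (s \in sq_I lsq) = (s \in lid N)
}.

Record right_sq (k : comPzRingType) (A : kalg k) (N : right_ideal A) := RightSq {
  rsq :> subquotient A;
  rsqN : forall u s, u \in rid N -> s \in sq_S rsq -> s * u \in rid N;
  rsqI : forall s, s \in sq_S rsq -> (s \in sq_I rsq) = (s \in rid N)
}.

Section LeftQuotient.
Variables (k : comPzRingType) (A : kalg k) (N : left_ideal A) (D : left_sq N).
Local Notation B := (sqalg D).

Definition lquo := {ideal_quot (lid N)}.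
HB.instance Definition _ := GRing.Zmodule.on lquo.
HB.instance Definition _ := Quotient.on lquo.

Lemma lpiE (x y : A) : \pi_lquo x = \pi_lquo y <-> x - y \in lid N.
Proof. exact: qpiE. Qed.
Lemma lpiD (x y : A) : \pi_lquo x + \pi_lquo y = \pi_lquo (x + y).
Proof. by rewrite -(raddfD \pi_({ideal_quot (lid N)})). Qed.
Lemma lrepr (x : A) : repr (\pi_lquo x) - x \in lid N.
Proof. by apply/lpiE; rewrite reprK. Qed.

Definition lquo_lact (a : A) (x : lquo) : lquo := \pi_lquo (a * repr x).
Definition lquo_ract (x : lquo) (b : B) : lquo := \pi_lquo (repr x * sqrep b).

Lemma lquo_lactE a x : lquo_lact a (\pi_lquo x) = \pi_lquo (a * x).
Proof. by apply/lpiE; rewrite -mulrBr; apply/lidM/lrepr. Qed.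

Lemma lsq_rep (b : B) s : s \in sq_S D -> sqrep b - s \in sq_I D ->
  sqrep b - s \in lid N.
Proof. by move=> hs; rewrite lsqI // rpredB ?sqrep_in. Qed.

Lemma lquo_ractE x b s : s \in sq_S D -> sqrep b - s \in sq_I D ->
  lquo_ract (\pi_lquo x) b = \pi_lquo (x * s).
Proof.
move=> hs hb; apply/lpiE; set x' := repr _.
have -> : x' * sqrep b - x * s = x' * (sqrep b - s) + (x' - x) * s.
  by rewrite mulrBl mulrBr addrA subrK.
by apply: rpredD; [apply/lidM/(lsq_rep hs) | apply: (lsqN (lrepr x) hs)].
Qed.

Lemma lquo_ract_rep x b : lquo_ract (\pi_lquo x) b = \pi_lquo (x * sqrep b).
Proof. by apply: lquo_ractE; rewrite ?sqrep_in // subrr rpred0. Qed.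

Program Definition lquot : bimod A B :=
  @Bimod k A B lquo lquo_lact lquo_ract _ _ _ _ _ _ _ _ _ _.
Next Obligation.
by rewrite -[x]reprK !lquo_lactE lpiD mulrDl.
Qed.
Next Obligation.
by rewrite -[x]reprK -[y]reprK lpiD !lquo_lactE lpiD mulrDr.
Qed.
Next Obligation.
by rewrite -[x]reprK (lquo_lactE t) (lquo_lactE s (t * _)) lquo_lactE mulrA.
Qed.
Next Obligation. by rewrite -[x]reprK !lquo_lactE mul1r. Qed.
Next Obligation.
by rewrite -[x]reprK -[y]reprK lpiD !lquo_ract_rep lpiD mulrDl.
Qed.
Next Obligation.
rewrite -[x]reprK (lquo_ract_rep _ r) (lquo_ract_rep _ t) lpiD -mulrDr.
apply: lquo_ractE.
  by rewrite rpredD ?sqrep_in.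
exact: sqrepD.
Qed.
Next Obligation.
rewrite -[x]reprK (lquo_ract_rep (repr x) r) (lquo_ract_rep _ t) -mulrA.
apply: lquo_ractE.
  by rewrite rpredM ?sqrep_in.
exact: sqrepM.
Qed.
Next Obligation.
rewrite -[x in RHS]reprK -[x in LHS]reprK -[repr x in RHS]mulr1.
by apply: lquo_ractE; rewrite ?rpred1 ?sqrep1.
Qed.
Next Obligation.
rewrite -[x]reprK (lquo_lactE s (repr x)) (lquo_ract_rep (repr x)).
by rewrite (lquo_lactE s) lquo_ract_rep mulrA.
Qed.
Next Obligation.
rewrite -[x]reprK lquo_lactE kstrC; apply/esym/lquo_ractE.
  exact: sq_k.
exact: sqrepk.
Qed.

Section Omega.
Variable R : kalg k.

Definition annl_pred (W : bimod A R) : {pred W} :=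
  fun w => `[< forall u, u \in lid N -> u *> w = 0 >].

Lemma annlP (W : bimod A R) (w : W) :
  reflect (forall u, u \in lid N -> u *> w = 0) (w \in @annl_pred W).
Proof. exact: asboolP. Qed.

Arguments annl_pred : clear implicits.

Lemma annl_closed (W : bimod A R) : zmod_closed (annl_pred W).
Proof.
split; first by apply/annlP => u _; rewrite lact0r.
move=> x y /annlP hx /annlP hy; apply/annlP => u hu.
by rewrite lactDr lactNr hx // hy // subrr.
Qed.
HB.instance Definition _ (W : bimod A R) :=
  GRing.isZmodClosed.Build W (annl_pred W) (annl_closed W).

Definition annl (W : bimod A R) := {w : W | w \in annl_pred W}.
HB.instance Definition _ (W : bimod A R) := SubChoice.on (annl W).
HB.instance Definition _ (W : bimod A R) :=
  GRing.SubChoice_isSubZmodule.Build _ _ (annl W) (annl_closed W).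

Lemma annl_lact_subproof (W : bimod A R) (b : B) (w : annl W) :
  sqrep b *> val w \in annl_pred W.
Proof.
apply/annlP => u hu; rewrite -lactA.
by apply: (annlP _ (valP w)); apply: (@lsqN _ _ _ D) => //; apply: sqrep_in.
Qed.
Lemma annl_ract_subproof (W : bimod A R) (w : annl W) (r : R) :
  val w <* r \in annl_pred W.
Proof.
by apply/annlP => u hu; rewrite -lractA (annlP _ (valP w)) // ract0l.
Qed.

Definition annl_lact (W : bimod A R) (b : B) (w : annl W) : annl W :=
  exist _ (sqrep b *> val w) (annl_lact_subproof b w).
Definition annl_ract (W : bimod A R) (w : annl W) (r : R) : annl W :=
  exist _ (val w <* r) (annl_ract_subproof w r).

Lemma annl_lactE (W : bimod A R) (b : B) (w : annl W) s : s \in sq_S D ->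
  sqrep b - s \in sq_I D -> sqrep b *> val w = s *> val w.
Proof.
move=> hs hb; apply/eqP; rewrite -subr_eq0 -lactBl; apply/eqP.
by apply: (annlP _ (valP w)); apply: lsq_rep.
Qed.

Program Definition omega_l (W : bimod A R) : bimod B R :=
  @Bimod k B R (annl W) (@annl_lact W) (@annl_ract W) _ _ _ _ _ _ _ _ _ _.
Next Obligation.
apply: val_inj; rewrite raddfD /= -lactDl; apply: annl_lactE.
  by rewrite rpredD ?sqrep_in.
exact: sqrepD.
Qed.
Next Obligation. by apply: val_inj; rewrite !raddfD /= lactDr. Qed.
Next Obligation.
apply: val_inj; rewrite /= -lactA; apply: annl_lactE.
  by rewrite rpredM ?sqrep_in.
exact: sqrepM.
Qed.
Next Obligation.
apply: val_inj; rewrite /= -[RHS]lact1; apply: annl_lactE.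
  by rewrite rpred1.
exact: sqrep1.
Qed.
Next Obligation. by apply: val_inj; rewrite !raddfD /= ractDl. Qed.
Next Obligation. by apply: val_inj; rewrite raddfD /= ractDr. Qed.
Next Obligation. by apply: val_inj; rewrite /= ractA. Qed.
Next Obligation. by apply: val_inj; rewrite /= ract1. Qed.
Next Obligation. by apply: val_inj; rewrite /= lractA. Qed.
Next Obligation.
apply: val_inj; rewrite /= -lractk; apply: annl_lactE.
  exact: sq_k.
exact: sqrepk.
Qed.

Lemma omega_l_map_subproof (W W' : bimod A R) (f : bhom W W') (w : annl W) :
  f (val w) \in annl_pred W'.
Proof.
apply/annlP => u hu; rewrite -bfunl (annlP _ (valP w)) //.
exact: additive0 (bfunD f).
Qed.

Program Definition omega_l_map (W W' : bimod A R) (f : bhom W W') :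
    bhom (omega_l W) (omega_l W') :=
  @BHom k B R (omega_l W) (omega_l W')
    (fun w => exist _ (f (val w)) (omega_l_map_subproof f w) : annl W') _ _ _.
Next Obligation. by apply: val_inj; rewrite !raddfD /= bfunD. Qed.
Next Obligation. by apply: val_inj; rewrite /= bfunl. Qed.
Next Obligation. by apply: val_inj; rewrite /= bfunr. Qed.

Lemma unit_l_subproof (M : bimod B R) (m : M) :
  tmk (\pi_lquo 1 : lquot) m \in annl_pred (tensor lquot M).
Proof.
apply/annlP => u hu; rewrite [LHS]tens_lactE.
rewrite [u *> _]lquo_lactE mulr1.
rewrite (_ : \pi_lquo u = 0) ?tmk0l // -[RHS]reprK; apply/lpiE.
by rewrite rpredB // -[repr _]subr0 -lpiE reprK /= -(raddf0 \pi_({ideal_quot (lid N)})).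
Qed.

Program Definition unit_l (M : bimod B R) :
    bhom M (omega_l (tensor lquot M)) :=
  @BHom k B R M (omega_l (tensor lquot M))
    (fun m => exist _ _ (unit_l_subproof m) : annl (tensor lquot M)) _ _ _.
Next Obligation. by apply: val_inj; rewrite raddfD /= tmkDr. Qed.
Next Obligation.
apply: val_inj; rewrite /= [RHS]tens_lactE -tmkbal; congr tmk.
by rewrite [LHS]lquo_ract_rep [RHS]lquo_lactE mul1r mulr1.
Qed.
Next Obligation. by apply: val_inj; rewrite /= [RHS]tens_ractE. Qed.

Definition counit_l_fun (W : bimod A R) : tens lquot (omega_l W) -> W :=
  tlift (fun (x : lquot) (w : omega_l W) => repr x *> val w).

Lemma lquo_annE (W : bimod A R) (u : A) (w : annl W) :
  repr (\pi_lquo u) *> val w = u *> val w.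
Proof.
apply/eqP; rewrite -subr_eq0 -lactBl; apply/eqP.
by apply: (annlP _ (valP w)); apply: lrepr.
Qed.

Lemma counit_l_bal (W : bimod A R) :
  balanced (fun (x : lquot) (w : omega_l W) => repr x *> val w).
Proof.
split.
- move=> x x' w; rewrite -[x]reprK -[x']reprK [_ + _]lpiD !lquo_annE.
  by rewrite lactDl.
- by move=> x w w'; rewrite raddfD lactDr.
- move=> x b w; rewrite -[x]reprK [_ <* _]lquo_ract_rep !lquo_annE /=.
  by rewrite lactA.
Qed.

Lemma counit_lE (W : bimod A R) (u : A) (w : omega_l W) :
  counit_l_fun (tmk (\pi_lquo u : lquot) w) = u *> val w.
Proof. by rewrite [LHS](tlift_tmk (counit_l_bal W)) lquo_annE. Qed.

Lemma counit_lD (W : bimod A R) (a b : tens lquot (omega_l W)) :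
  counit_l_fun (a + b) = counit_l_fun a + counit_l_fun b.
Proof. exact: tliftD (counit_l_bal W) _ _. Qed.

Program Definition counit_l (W : bimod A R) :
    bhom (tensor lquot (omega_l W)) W :=
  @BHom k A R (tensor lquot (omega_l W)) W (@counit_l_fun W) _ _ _.
Next Obligation. exact: counit_lD. Qed.
Next Obligation.
move: x; apply: tens_ext => [a b|a b|x w].
- by rewrite [X in counit_l_fun X]tens_lactD counit_lD.
- by rewrite counit_lD lactDr.
- rewrite -[x]reprK counit_lE -lactA -counit_lE; congr counit_l_fun.
  by rewrite [LHS]tens_lactE; congr tmk; apply: lquo_lactE.
Qed.
Next Obligation.
move: x; apply: tens_ext => [a b|a b|x w].
- by rewrite [X in counit_l_fun X]tens_ractD counit_lD.
- by rewrite counit_lD ractDl.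
- rewrite -[x]reprK [X in counit_l_fun X]tens_ractE !counit_lE /=.
  by rewrite lractA.
Qed.
End Omega.
End LeftQuotient.

Section RightQuotient.
Variables (k : comPzRingType) (A : kalg k) (N : right_ideal A) (D : right_sq N).
Local Notation B := (sqalg D).

Definition rquo := {ideal_quot (rid N)}.
HB.instance Definition _ := GRing.Zmodule.on rquo.
HB.instance Definition _ := Quotient.on rquo.

Lemma rpiE (x y : A) : \pi_rquo x = \pi_rquo y <-> x - y \in rid N.
Proof. exact: qpiE. Qed.
Lemma rpiD (x y : A) : \pi_rquo x + \pi_rquo y = \pi_rquo (x + y).
Proof. by rewrite -(raddfD \pi_({ideal_quot (rid N)})). Qed.
Lemma rrepr (x : A) : repr (\pi_rquo x) - x \in rid N.
Proof. by apply/rpiE; rewrite reprK. Qed.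

Definition rquo_lact (b : B) (x : rquo) : rquo := \pi_rquo (sqrep b * repr x).
Definition rquo_ract (x : rquo) (a : A) : rquo := \pi_rquo (repr x * a).

Lemma rquo_ractE a x : rquo_ract (\pi_rquo x) a = \pi_rquo (x * a).
Proof. by apply/rpiE; rewrite -mulrBl; apply/ridM/rrepr. Qed.

Lemma rsq_rep (b : B) s : s \in sq_S D -> sqrep b - s \in sq_I D ->
  sqrep b - s \in rid N.
Proof. by move=> hs; rewrite rsqI // rpredB ?sqrep_in. Qed.

Lemma rquo_lactE x b s : s \in sq_S D -> sqrep b - s \in sq_I D ->
  rquo_lact b (\pi_rquo x) = \pi_rquo (s * x).
Proof.
move=> hs hb; apply/rpiE; set x' := repr _.
have -> : sqrep b * x' - s * x = (sqrep b - s) * x' + s * (x' - x).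
  by rewrite mulrBl mulrBr addrA subrK.
by apply: rpredD; [apply/ridM/(rsq_rep hs) | apply: (rsqN (rrepr x) hs)].
Qed.

Lemma rquo_lact_rep x b : rquo_lact b (\pi_rquo x) = \pi_rquo (sqrep b * x).
Proof. by apply: rquo_lactE; rewrite ?sqrep_in // subrr rpred0. Qed.

Program Definition rquot : bimod B A :=
  @Bimod k B A rquo rquo_lact rquo_ract _ _ _ _ _ _ _ _ _ _.
Next Obligation.
rewrite -[x]reprK (rquo_lact_rep _ s) (rquo_lact_rep _ t) rpiD -mulrDl.
apply: rquo_lactE.
  by rewrite rpredD ?sqrep_in.
exact: sqrepD.
Qed.
Next Obligation.
by rewrite -[x]reprK -[y]reprK rpiD !rquo_lact_rep rpiD mulrDr.
Qed.
Next Obligation.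
rewrite -[x]reprK (rquo_lact_rep (repr x) t) (rquo_lact_rep _ s) mulrA.
apply: rquo_lactE.
  by rewrite rpredM ?sqrep_in.
exact: sqrepM.
Qed.
Next Obligation.
rewrite -[x in RHS]reprK -[x in LHS]reprK -[repr x in RHS]mul1r.
by apply: rquo_lactE; rewrite ?rpred1 ?sqrep1.
Qed.
Next Obligation.
by rewrite -[x]reprK -[y]reprK rpiD !rquo_ractE rpiD mulrDl.
Qed.
Next Obligation.
by rewrite -[x]reprK !rquo_ractE rpiD mulrDr.
Qed.
Next Obligation.
by rewrite -[x]reprK (rquo_ractE r) (rquo_ractE t (_ * r)) rquo_ractE mulrA.
Qed.
Next Obligation. by rewrite -[x]reprK !rquo_ractE mulr1. Qed.
Next Obligation.
rewrite -[x]reprK (rquo_ractE r (repr x)) (rquo_lact_rep (repr x)).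
by rewrite (rquo_ractE r) rquo_lact_rep mulrA.
Qed.
Next Obligation.
rewrite -[x]reprK rquo_ractE -kstrC; apply: rquo_lactE.
  exact: sq_k.
exact: sqrepk.
Qed.

Section Omega.
Variable R : kalg k.

Definition annr_pred (W : bimod R A) : {pred W} :=
  fun w => `[< forall u, u \in rid N -> w <* u = 0 >].

Lemma annrP (W : bimod R A) (w : W) :
  reflect (forall u, u \in rid N -> w <* u = 0) (w \in @annr_pred W).
Proof. exact: asboolP. Qed.

Arguments annr_pred : clear implicits.

Lemma annr_closed (W : bimod R A) : zmod_closed (annr_pred W).
Proof.
split; first by apply/annrP => u _; rewrite ract0l.
move=> x y /annrP hx /annrP hy; apply/annrP => u hu.
by rewrite ractDl ractNl hx // hy // subrr.
Qed.
HB.instance Definition _ (W : bimod R A) :=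
  GRing.isZmodClosed.Build W (annr_pred W) (annr_closed W).

Definition annr (W : bimod R A) := {w : W | w \in annr_pred W}.
HB.instance Definition _ (W : bimod R A) := SubChoice.on (annr W).
HB.instance Definition _ (W : bimod R A) :=
  GRing.SubChoice_isSubZmodule.Build _ _ (annr W) (annr_closed W).

Lemma annr_ract_subproof (W : bimod R A) (w : annr W) (b : B) :
  val w <* sqrep b \in annr_pred W.
Proof.
apply/annrP => u hu; rewrite -ractA.
by apply: (annrP _ (valP w)); apply: (@rsqN _ _ _ D) => //; apply: sqrep_in.
Qed.
Lemma annr_lact_subproof (W : bimod R A) (r : R) (w : annr W) :
  r *> val w \in annr_pred W.
Proof.
by apply/annrP => u hu; rewrite lractA (annrP _ (valP w)) // lact0r.
Qed.

Definition annr_lact (W : bimod R A) (r : R) (w : annr W) : annr W :=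
  exist _ (r *> val w) (annr_lact_subproof r w).
Definition annr_ract (W : bimod R A) (w : annr W) (b : B) : annr W :=
  exist _ (val w <* sqrep b) (annr_ract_subproof w b).

Lemma annr_ractE (W : bimod R A) (b : B) (w : annr W) s : s \in sq_S D ->
  sqrep b - s \in sq_I D -> val w <* sqrep b = val w <* s.
Proof.
move=> hs hb; apply/eqP; rewrite -subr_eq0 -ractBr; apply/eqP.
by apply: (annrP _ (valP w)); apply: rsq_rep.
Qed.

Program Definition omega_r (W : bimod R A) : bimod R B :=
  @Bimod k R B (annr W) (@annr_lact W) (@annr_ract W) _ _ _ _ _ _ _ _ _ _.
Next Obligation. by apply: val_inj; rewrite raddfD /= lactDl. Qed.
Next Obligation. by apply: val_inj; rewrite !raddfD /= lactDr. Qed.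
Next Obligation. by apply: val_inj; rewrite /= lactA. Qed.
Next Obligation. by apply: val_inj; rewrite /= lact1. Qed.
Next Obligation. by apply: val_inj; rewrite !raddfD /= ractDl. Qed.
Next Obligation.
apply: val_inj; rewrite raddfD /= -ractDr; apply: annr_ractE.
  by rewrite rpredD ?sqrep_in.
exact: sqrepD.
Qed.
Next Obligation.
apply: val_inj; rewrite /= -ractA; apply: annr_ractE.
  by rewrite rpredM ?sqrep_in.
exact: sqrepM.
Qed.
Next Obligation.
apply: val_inj; rewrite /= -[RHS]ract1; apply: annr_ractE.
  by rewrite rpred1.
exact: sqrep1.
Qed.
Next Obligation. by apply: val_inj; rewrite /= lractA. Qed.
Next Obligation.
apply: val_inj; rewrite /= lractk; apply/esym/annr_ractE.
  exact: sq_k.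
exact: sqrepk.
Qed.

Lemma omega_r_map_subproof (W W' : bimod R A) (f : bhom W W') (w : annr W) :
  f (val w) \in annr_pred W'.
Proof.
apply/annrP => u hu; rewrite -bfunr (annrP _ (valP w)) //.
exact: additive0 (bfunD f).
Qed.

Program Definition omega_r_map (W W' : bimod R A) (f : bhom W W') :
    bhom (omega_r W) (omega_r W') :=
  @BHom k R B (omega_r W) (omega_r W')
    (fun w => exist _ (f (val w)) (omega_r_map_subproof f w) : annr W') _ _ _.
Next Obligation. by apply: val_inj; rewrite !raddfD /= bfunD. Qed.
Next Obligation. by apply: val_inj; rewrite /= bfunl. Qed.
Next Obligation. by apply: val_inj; rewrite /= bfunr. Qed.

Lemma unit_r_subproof (M : bimod R B) (m : M) :
  tmk m (\pi_rquo 1 : rquot) \in annr_pred (tensor M rquot).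
Proof.
apply/annrP => u hu; rewrite [LHS]tens_ractE.
rewrite [_ <* u]rquo_ractE mul1r.
rewrite (_ : \pi_rquo u = 0) ?tmk0r // -[RHS]reprK; apply/rpiE.
by rewrite rpredB // -[repr _]subr0 -rpiE reprK /= -(raddf0 \pi_({ideal_quot (rid N)})).
Qed.

Program Definition unit_r (M : bimod R B) :
    bhom M (omega_r (tensor M rquot)) :=
  @BHom k R B M (omega_r (tensor M rquot))
    (fun m => exist _ _ (unit_r_subproof m) : annr (tensor M rquot)) _ _ _.
Next Obligation. by apply: val_inj; rewrite raddfD /= tmkDl. Qed.
Next Obligation. by apply: val_inj; rewrite /= [RHS]tens_lactE. Qed.
Next Obligation.
apply: val_inj; rewrite /= [RHS]tens_ractE tmkbal; congr tmk.
by rewrite [LHS]rquo_lact_rep [RHS]rquo_ractE mul1r mulr1.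
Qed.

Definition counit_r_fun (W : bimod R A) : tens (omega_r W) rquot -> W :=
  tlift (fun (w : omega_r W) (x : rquot) => val w <* repr x).

Lemma rquo_annE (W : bimod R A) (u : A) (w : annr W) :
  val w <* repr (\pi_rquo u) = val w <* u.
Proof.
apply/eqP; rewrite -subr_eq0 -ractBr; apply/eqP.
by apply: (annrP _ (valP w)); apply: rrepr.
Qed.

Lemma counit_r_bal (W : bimod R A) :
  balanced (fun (w : omega_r W) (x : rquot) => val w <* repr x).
Proof.
split.
- by move=> w w' x; rewrite raddfD ractDl.
- move=> w x x'; rewrite -[x]reprK -[x']reprK [_ + _]rpiD !rquo_annE.
  by rewrite ractDr.
- move=> w b x; rewrite -[x]reprK [_ *> _]rquo_lact_rep !rquo_annE /=.
  by rewrite ractA.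
Qed.

Lemma counit_rE (W : bimod R A) (u : A) (w : omega_r W) :
  counit_r_fun (tmk w (\pi_rquo u : rquot)) = val w <* u.
Proof. by rewrite [LHS](tlift_tmk (counit_r_bal W)) rquo_annE. Qed.

Lemma counit_rD (W : bimod R A) (a b : tens (omega_r W) rquot) :
  counit_r_fun (a + b) = counit_r_fun a + counit_r_fun b.
Proof. exact: tliftD (counit_r_bal W) _ _. Qed.

Program Definition counit_r (W : bimod R A) :
    bhom (tensor (omega_r W) rquot) W :=
  @BHom k R A (tensor (omega_r W) rquot) W (@counit_r_fun W) _ _ _.
Next Obligation. exact: counit_rD. Qed.
Next Obligation.
move: x; apply: tens_ext => [a b|a b|w x].
- by rewrite [X in counit_r_fun X]tens_lactD counit_rD.
- by rewrite counit_rD lactDr.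
- rewrite -[x]reprK [X in counit_r_fun X]tens_lactE !counit_rE /=.
  by rewrite lractA.
Qed.
Next Obligation.
move: x; apply: tens_ext => [a b|a b|w x].
- by rewrite [X in counit_r_fun X]tens_ractD counit_rD.
- by rewrite counit_rD ractDl.
- rewrite -[x]reprK counit_rE -ractA -counit_rE; congr counit_r_fun.
  by rewrite [LHS]tens_ractE; congr tmk; apply: rquo_ractE.
Qed.
End Omega.
End RightQuotient.

Section TensorMap.
Variables (k : comPzRingType) (S R T : kalg k).
Variables (X X' : bimod S R) (Y Y' : bimod R T).

Definition tmap_fun (f : bhom X X') (g : bhom Y Y') : tens X Y -> tens X' Y' :=
  tlift (fun x y => tmk (f x) (g y)).

Lemma tmap_bal (f : bhom X X') (g : bhom Y Y') :
  balanced (fun x y => tmk (f x) (g y)).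
Proof.
split=> [x x' y|x y y'|x r y]; first by rewrite bfunD tmkDl.
  by rewrite bfunD tmkDr.
by rewrite bfunr bfunl tmkbal.
Qed.

Lemma tmap_tmk (f : bhom X X') (g : bhom Y Y') x y :
  tmap_fun f g (tmk x y) = tmk (f x) (g y).
Proof. exact: tlift_tmk (tmap_bal f g) _ _. Qed.
Lemma tmap_funD (f : bhom X X') (g : bhom Y Y') a b :
  tmap_fun f g (a + b) = tmap_fun f g a + tmap_fun f g b.
Proof. exact: tliftD (tmap_bal f g) _ _. Qed.

Program Definition tmap (f : bhom X X') (g : bhom Y Y') :
    bhom (tensor X Y) (tensor X' Y') :=
  @BHom k S T (tensor X Y) (tensor X' Y') (tmap_fun f g) _ _ _.
Next Obligation. exact: tmap_funD. Qed.
Next Obligation.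
move: x; apply: tens_ext => [a b|a b|x y].
- by rewrite [X in tmap_fun _ _ X]tens_lactD tmap_funD.
- by rewrite tmap_funD [LHS]tens_lactD.
- rewrite tmap_tmk [X in tmap_fun _ _ X]tens_lactE tmap_tmk bfunl.
  by rewrite [RHS]tens_lactE.
Qed.
Next Obligation.
move: x; apply: tens_ext => [a b|a b|x y].
- by rewrite [X in tmap_fun _ _ X]tens_ractD tmap_funD.
- by rewrite tmap_funD [LHS]tens_ractD.
- rewrite tmap_tmk [X in tmap_fun _ _ X]tens_ractE tmap_tmk bfunr.
  by rewrite [RHS]tens_ractE.
Qed.
End TensorMap.

Lemma bhom_tens_ext (k : comPzRingType) (S R T : kalg k) (X : bimod S R)
    (Y : bimod R T) (Z : bimod S T) (f g : bhom (tensor X Y) Z) :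
  (forall x y, f (tmk x y) = g (tmk x y)) -> f = g.
Proof.
by move=> fg; apply: bhom_eq; apply: (tens_ext (bfunD f) (bfunD g) fg).
Qed.

(* A Z-grading, given by the projections hc p onto the homogeneous components;
   the component of degree p is the set of fixed points of hc p. *)
Record graded_alg (k : comPzRingType) := GradedAlg {
  gr_alg :> kalg k;
  hc : int -> gr_alg -> gr_alg;
  hcD : forall p u v, hc p (u + v) = hc p u + hc p v;
  hck : forall p a u, hc p (kstr gr_alg a * u) = kstr gr_alg a * hc p u;
  hc_hc : forall p q u, hc p (hc q u) = if p == q then hc p u else 0;
  hc_dec : forall u, exists s : seq int, uniq s /\ u = \sum_(p <- s) hc p u;
  hc1 : hc 0 1 = 1;
  hcM : forall p q u v, hc p u = u -> hc q v = v -> hc (p + q) (u * v) = u * v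
}.

Section Graded.
Variables (k : comPzRingType) (U : graded_alg k).

Definition homog (p : int) : {pred U} := fun u => hc p u == u.

Lemma homogP p u : reflect (hc p u = u) (u \in homog p).
Proof. exact: eqP. Qed.

Definition deg_le (p : int) : {pred U} :=
  fun u => `[< forall q, (p < q)%R -> hc q u = 0 >].

Definition left_span_le (p : int) : {pred U} :=
  fun u => `[< exists s : seq (U * U),
    (forall xy, xy \in s -> xy.2 \in deg_le p) /\
    u = \sum_(xy <- s) xy.1 * xy.2 >].

Lemma homog_hc p u : hc p u \in homog p.
Proof. by apply/homogP; rewrite hc_hc eqxx. Qed.

Lemma hc_homog p q u : u \in homog q -> hc p u = if p == q then u else 0.
Proof.
move=> /homogP hu; rewrite -{1}hu hc_hc; case: eqP => // -> //.
Qed.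

Lemma homogM p q u v : u \in homog p -> v \in homog q -> u * v \in homog (p + q).
Proof. by move=> /homogP hu /homogP hv; apply/homogP/hcM. Qed.

Lemma hc_sum p (I : Type) (s : seq I) (F : I -> U) :
  hc p (\sum_(i <- s) F i) = \sum_(i <- s) hc p (F i).
Proof. exact: additive_sum (hcD p). Qed.

Lemma homog_zmod p : zmod_closed (homog p).
Proof.
split; first by apply/homogP; rewrite (additive0 (hcD p)).
move=> x y /homogP hx /homogP hy; apply/homogP.
by rewrite hcD (additiveN (hcD p)) hx hy.
Qed.
HB.instance Definition _ p := GRing.isZmodClosed.Build U (homog p) (homog_zmod p).

Lemma homog_kstr a : kstr U a \in homog 0.
Proof. by apply/homogP; rewrite -[kstr U a]mulr1 hck hc1. Qed.

Definition homog0 : {pred U} := homog 0.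
Lemma homog0_subring : subring_closed homog0.
Proof.
split; first by apply/homogP/hc1.
- by move=> x y hx hy; apply: rpredB.
- by move=> x y hx hy; rewrite -[_ \in _]/(_ \in homog (0 + 0)); apply: homogM.
Qed.
HB.instance Definition _ := GRing.isSubringClosed.Build U homog0 homog0_subring.
End Graded.
Arguments homog {k} U p : rename.
Arguments homog0 {k} U : rename.
Arguments left_span_le {k} U p : rename.

Record acs_alg (k : comPzRingType) := AcsAlg {
  acs_gr :> graded_alg k;
  NL : int -> zmodClosed acs_gr;
  NL_k : forall n a u, u \in NL n -> kstr acs_gr a * u \in NL n;
  NL_hc : forall n p u, u \in NL n -> hc p u \in NL n;
  NL_decr : forall m n, (m <= n)%R -> {subset NL n <= NL m};
  NL_span : forall n, {subset left_span_le acs_gr (- n) <= NL n};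
  NL_dense : forall n m p u, (n <= m)%R -> u \in NL n -> u \in homog acs_gr p ->
    exists v w : acs_gr,
      [/\ v \in left_span_le acs_gr (- n), v \in homog acs_gr p,
          w \in NL m, w \in homog acs_gr p & u = v + w];
  NL_Mr : forall n p q u v, u \in NL n -> u \in homog acs_gr p ->
    v \in homog acs_gr q -> u * v \in NL (n - q);
  NL_Ml : forall n p q u v, u \in homog acs_gr p -> v \in NL n ->
    v \in homog acs_gr q -> u * v \in NL n
}.

Section Acs.
Variables (k : comPzRingType) (U : acs_alg k).
Local Notation homog := (homog U).

Lemma NL_left n (a x : U) : x \in NL U n -> a * x \in NL U n.
Proof.
move=> hx; have [s [_ ->]] := hc_dec a; have [t [_ ->]] := hc_dec x.
rewrite mulr_suml; apply: rpred_sum => p _; rewrite mulr_sumr.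
apply: rpred_sum => q _; apply: (@NL_Ml _ _ _ p q); rewrite ?homog_hc //.
exact: NL_hc.
Qed.

Definition NLi n : left_ideal U := @LeftIdeal k U (NL U n) (@NL_left n).

Lemma NL_right n q (x v : U) : x \in NL U n -> v \in homog q ->
  x * v \in NL U (n - q).
Proof.
move=> hx hv; have [t [_ ->]] := hc_dec x.
rewrite mulr_suml; apply: rpred_sum => p _.
by apply: (@NL_Mr _ _ _ p); rewrite ?homog_hc //; apply: NL_hc.
Qed.

Definition NR_pred (n : int) : {pred U} :=
  fun u => `[< forall p, hc p u \in NL U (n - p) >].

Lemma NRP n u : reflect (forall p, hc p u \in NL U (n - p)) (u \in NR_pred n).
Proof. exact: asboolP. Qed.

Lemma NR_closed n : zmod_closed (NR_pred n).
Proof.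
split; first by apply/NRP => p; rewrite (additive0 (hcD p)) rpred0.
move=> x y /NRP hx /NRP hy; apply/NRP => p.
by rewrite hcD (additiveN (hcD p)) rpredB.
Qed.
HB.instance Definition _ n := GRing.isZmodClosed.Build U (NR_pred n) (NR_closed n).

Lemma NR_homog n p (u : U) : u \in homog p ->
  (u \in NR_pred n) = (u \in NL U (n - p)).
Proof.
move=> hu; apply/NRP/idP => [/(_ p)|h q]; rewrite (hc_homog _ hu) ?eqxx //.
by case: eqP => [->|_] //; rewrite rpred0.
Qed.

Lemma NR_right n (a x : U) : x \in NR_pred n -> x * a \in NR_pred n.
Proof.
move=> /NRP hx; have [s [_ ->]] := hc_dec a; have [t [_ xE]] := hc_dec x.
rewrite xE mulr_suml; apply: rpred_sum => p _; rewrite mulr_sumr.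
apply: rpred_sum => q _.
rewrite (@NR_homog _ (p + q)) ?homogM ?homog_hc // opprD addrA.
by apply: NL_right; rewrite ?homog_hc.
Qed.

Lemma NR_left n p (a x : U) : x \in NR_pred n -> a \in homog p ->
  a * x \in NR_pred (n + p).
Proof.
move=> /NRP hx ha; have [t [_ xE]] := hc_dec x.
rewrite xE mulr_sumr; apply: rpred_sum => q _.
rewrite (@NR_homog _ (p + q)) ?homogM ?homog_hc //.
by rewrite opprD addrA addrK; apply: NL_left.
Qed.

Definition NRi n : right_ideal U :=
  @RightIdeal k U (NR_pred n) (@NR_right n).

Lemma NR_decr m n : (m <= n)%R -> {subset NR_pred n <= NR_pred m}.
Proof.
move=> mn u /NRP hu; apply/NRP => p; apply: NL_decr (hu p).
by rewrite Num.Theory.lerD2r.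
Qed.

Program Definition zhu_sq (n : nat) : subquotient U :=
  @SubQuotient k U (homog0 U) (@homog_kstr k U) (NL U n.+1) _ _.
Next Obligation. exact: NL_left. Qed.
Next Obligation. by rewrite -[n.+1%:Z]subr0; apply: NL_right. Qed.

Program Definition zhu_l (n : nat) : left_sq (NLi n.+1) :=
  @LeftSq k U (NLi n.+1) (zhu_sq n) _ _.
Next Obligation. by rewrite -[n.+1%:Z]subr0; apply: NL_right. Qed.

Program Definition zhu_r (n : nat) : right_sq (NRi n.+1) :=
  @RightSq k U (NRi n.+1) (zhu_sq n) _ _.
Next Obligation. by rewrite -[n.+1%:Z]addr0; apply: NR_left. Qed.
Next Obligation. by rewrite (@NR_homog _ 0) // subr0. Qed.

Definition idealizer_l (n : int) : {pred U} :=
  fun s => `[< forall u, u \in NL U n -> u * s \in NL U n >].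
Definition idealizer_r (n : int) : {pred U} :=
  fun s => `[< forall u, u \in NR_pred n -> s * u \in NR_pred n >].

Lemma idealizer_lP n s :
  reflect (forall u, u \in NL U n -> u * s \in NL U n) (s \in idealizer_l n).
Proof. exact: asboolP. Qed.
Lemma idealizer_rP n s :
  reflect (forall u, u \in NR_pred n -> s * u \in NR_pred n)
    (s \in idealizer_r n).
Proof. exact: asboolP. Qed.

Lemma idealizer_l_subring n : subring_closed (idealizer_l n).
Proof.
split; first by apply/idealizer_lP => u; rewrite mulr1.
- move=> x y /idealizer_lP hx /idealizer_lP hy; apply/idealizer_lP => u hu.
  by rewrite mulrBr rpredB ?hx ?hy.
- move=> x y /idealizer_lP hx /idealizer_lP hy; apply/idealizer_lP => u hu.
  by rewrite mulrA hy ?hx.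
Qed.
HB.instance Definition _ n := GRing.isSubringClosed.Build U (idealizer_l n)
  (idealizer_l_subring n).

Lemma idealizer_r_subring n : subring_closed (idealizer_r n).
Proof.
split; first by apply/idealizer_rP => u; rewrite mul1r.
- move=> x y /idealizer_rP hx /idealizer_rP hy; apply/idealizer_rP => u hu.
  by rewrite mulrBl rpredB ?hx ?hy.
- move=> x y /idealizer_rP hx /idealizer_rP hy; apply/idealizer_rP => u hu.
  by rewrite -mulrA hx ?hy.
Qed.
HB.instance Definition _ n := GRing.isSubringClosed.Build U (idealizer_r n)
  (idealizer_r_subring n).

Program Definition thick_l (n : nat) : left_sq (NLi n.+1) :=
  @LeftSq k U (NLi n.+1)
    (@SubQuotient k U (idealizer_l n.+1) _ (NL U n.+1) _ _) _ _.
Next Obligation. by apply/idealizer_lP => u hu; rewrite -kstrC NL_left. Qed.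
Next Obligation. exact: NL_left. Qed.
Next Obligation. exact: (idealizer_lP _ _ H). Qed.
Next Obligation. exact: (idealizer_lP _ _ H0). Qed.

Program Definition thick_r (n : nat) : right_sq (NRi n.+1) :=
  @RightSq k U (NRi n.+1)
    (@SubQuotient k U (idealizer_r n.+1) _ (NR_pred n.+1) _ _) _ _.
Next Obligation. by apply/idealizer_rP => u hu; rewrite kstrC NR_right. Qed.
Next Obligation. exact: (idealizer_rP _ _ H). Qed.
Next Obligation. exact: NR_right. Qed.
Next Obligation. exact: (idealizer_rP _ _ H0). Qed.

Definition exhaustive_l (R : kalg k) (W : bimod U R) :=
  forall w : W, exists n : nat, w \in annl_pred (NLi n.+1) (W := W).
Definition exhaustive_r (R : kalg k) (W : bimod R U) :=
  forall w : W, exists n : nat, w \in annr_pred (NRi n.+1) (W := W).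

Definition ModExL (R : kalg k) : category :=
  full_sub (fun W : BMod U R => exhaustive_l W).
Definition ModExR (R : kalg k) : category :=
  full_sub (fun W : BMod R U => exhaustive_r W).

Lemma annl_le (R : kalg k) (W : bimod U R) (w : W) (m n : nat) : (m <= n)%N ->
  w \in annl_pred (NLi m.+1) (W := W) -> w \in annl_pred (NLi n.+1) (W := W).
Proof.
move=> mn /annlP hw; apply/annlP => u hu; apply: hw.
by apply: NL_decr hu; rewrite lez_nat.
Qed.
Lemma annr_le (R : kalg k) (W : bimod R U) (w : W) (m n : nat) : (m <= n)%N ->
  w \in annr_pred (NRi m.+1) (W := W) -> w \in annr_pred (NRi n.+1) (W := W).
Proof.
move=> mn /annrP hw; apply/annrP => u hu; apply: hw.
by apply: NR_decr hu; rewrite lez_nat.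
Qed.

Lemma exhaustive_l_sum (R : kalg k) (W : bimod U R) (I : Type) (s : seq I)
    (F : I -> W) :
  (forall i, exists n : nat, F i \in annl_pred (NLi n.+1) (W := W)) ->
  exists n : nat, \sum_(i <- s) F i \in annl_pred (NLi n.+1) (W := W).
Proof.
move=> hF; elim: s => [|i s [n hn]]; first by exists 0%N; rewrite big_nil rpred0.
have [m hm] := hF i; exists (maxn m n); rewrite big_cons rpredD //.
  exact: annl_le (leq_maxl _ _) hm.
exact: annl_le (leq_maxr _ _) hn.
Qed.
Lemma exhaustive_r_sum (R : kalg k) (W : bimod R U) (I : Type) (s : seq I)
    (F : I -> W) :
  (forall i, exists n : nat, F i \in annr_pred (NRi n.+1) (W := W)) ->
  exists n : nat, \sum_(i <- s) F i \in annr_pred (NRi n.+1) (W := W).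
Proof.
move=> hF; elim: s => [|i s [n hn]]; first by exists 0%N; rewrite big_nil rpred0.
have [m hm] := hF i; exists (maxn m n); rewrite big_cons rpredD //.
  exact: annr_le (leq_maxl _ _) hm.
exact: annr_le (leq_maxr _ _) hn.
Qed.

Lemma NL_absorb (n : nat) (u : U) :
  exists m : nat, forall v, v \in NL U m.+1 -> v * u \in NL U n.+1.
Proof.
have [s [_ ->]] := hc_dec u; elim: s => [|p s [m hm]].
  by exists 0%N => v _; rewrite big_nil mulr0 rpred0.
exists (maxn m (n + `|p|))%N => v hv; rewrite big_cons mulrDr rpredD //.
  apply: (@NL_decr _ _ n.+1 ((maxn m (n + `|p|)).+1%:Z - p)).
    by lia.
  by apply: NL_right; rewrite ?homog_hc.
by apply: hm; apply: NL_decr hv; rewrite lez_nat ltnS leq_maxl.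
Qed.

Lemma NR_absorb (n : nat) (u : U) :
  exists m : nat, forall v, v \in NR_pred m.+1 -> u * v \in NR_pred n.+1.
Proof.
have [s [_ ->]] := hc_dec u; elim: s => [|p s [m hm]].
  by exists 0%N => v _; rewrite big_nil mul0r rpred0.
exists (maxn m (n + `|p|))%N => v hv; rewrite big_cons mulrDl rpredD //.
  apply: (@NR_decr n.+1 ((maxn m (n + `|p|)).+1%:Z + p)).
    by lia.
  by apply: NR_left; rewrite ?homog_hc.
by apply: hm; apply: NR_decr hv; rewrite lez_nat ltnS leq_maxl.
Qed.
End Acs.
Arguments NR_pred {k} U n : rename.

Section LeftInduction.
Variables (k : comPzRingType) (U : acs_alg k) (n : nat).
Variables (D : left_sq (NLi U n.+1)) (R : kalg k).
Local Notation B := (sqalg D).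

Lemma lpi0 (u : U) : u \in NL U n.+1 -> \pi_(lquo (NLi U n.+1)) u = 0.
Proof.
move=> hu; rewrite -(raddf0 \pi_({ideal_quot (NL U n.+1)})).
by apply/(@lpiE _ _ (NLi U n.+1)); rewrite subr0.
Qed.

Lemma lquot_exhaustive : exhaustive_l (lquot D).
Proof.
move=> x; rewrite -[x]reprK; have [m hm] := NL_absorb n (repr x); exists m.
by apply/annlP => v hv; rewrite [LHS]lquo_lactE lpi0 // hm.
Qed.

Lemma phi_l_exhaustive (M : bimod B R) : exhaustive_l (tensor (lquot D) M).
Proof.
move=> t; rewrite (tens_sum t); apply: exhaustive_l_sum => -[x y] /=.
have [m /annlP hm] := lquot_exhaustive x; exists m.
by apply/annlP => v hv; rewrite [LHS]tens_lactE hm // tmk0l.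
Qed.

Program Definition phi_l : functor (BMod B R) (ModExL U R) :=
  @Functor (BMod B R) (ModExL U R)
    (fun M => exist _ (tensor (lquot D) M) (@phi_l_exhaustive M))
    (fun M M' f => tmap (bid (lquot D)) f) _ _.
Next Obligation. by apply: bhom_tens_ext => x y /=; rewrite tmap_tmk. Qed.
Next Obligation. by apply: bhom_tens_ext => x y /=; rewrite !tmap_tmk. Qed.

Program Definition Omega_l : functor (ModExL U R) (BMod B R) :=
  @Functor (ModExL U R) (BMod B R) (fun W => omega_l D (sval W))
    (fun W W' f => omega_l_map D f) _ _.
Next Obligation. by apply: bhom_eq => x; apply: val_inj. Qed.
Next Obligation. by apply: bhom_eq => x; apply: val_inj. Qed.

Program Definition adj_l : adjunction phi_l Omega_l :=
  @Adjunction _ _ phi_l Omega_l (fun M => @unit_l k U _ D R M)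
    (fun W => counit_l D (sval W)) _ _ _ _.
Next Obligation.
by apply: bhom_eq => x; apply: val_inj; rewrite /= tmap_tmk.
Qed.
Next Obligation.
apply: bhom_tens_ext => x y /=; rewrite tmap_tmk -[x]reprK /=.
by rewrite [LHS]counit_lE counit_lE /= bfunl.
Qed.
Next Obligation.
apply: bhom_tens_ext => x y /=; rewrite tmap_tmk -[x]reprK /=.
rewrite counit_lE /= [LHS]tens_lactE; congr tmk.
by rewrite [LHS]lquo_lactE mulr1.
Qed.
Next Obligation.
by apply: bhom_eq => w; apply: val_inj; rewrite /= counit_lE lact1.
Qed.
End LeftInduction.

Section RightInduction.
Variables (k : comPzRingType) (U : acs_alg k) (n : nat).
Variables (D : right_sq (NRi U n.+1)) (R : kalg k).
Local Notation B := (sqalg D).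

Lemma rpi0 (u : U) : u \in NRi U n.+1 -> \pi_(rquo (NRi U n.+1)) u = 0.
Proof.
move=> hu; rewrite -(raddf0 \pi_({ideal_quot (rid (NRi U n.+1))})).
by apply/(@rpiE _ _ (NRi U n.+1)); rewrite subr0.
Qed.

Lemma rquot_exhaustive : exhaustive_r (rquot D).
Proof.
move=> x; rewrite -[x]reprK; have [m hm] := NR_absorb n (repr x); exists m.
by apply/annrP => v hv; rewrite [LHS]rquo_ractE rpi0 //; apply: hm.
Qed.

Lemma phi_r_exhaustive (M : bimod R B) : exhaustive_r (tensor M (rquot D)).
Proof.
move=> t; rewrite (tens_sum t); apply: exhaustive_r_sum => -[x y] /=.
have [m /annrP hm] := rquot_exhaustive y; exists m.
by apply/annrP => v hv; rewrite [LHS]tens_ractE hm // tmk0r.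
Qed.

Program Definition phi_r : functor (BMod R B) (ModExR U R) :=
  @Functor (BMod R B) (ModExR U R)
    (fun M => exist _ (tensor M (rquot D)) (@phi_r_exhaustive M))
    (fun M M' f => tmap f (bid (rquot D))) _ _.
Next Obligation. by apply: bhom_tens_ext => x y /=; rewrite tmap_tmk. Qed.
Next Obligation. by apply: bhom_tens_ext => x y /=; rewrite !tmap_tmk. Qed.

Program Definition Omega_r : functor (ModExR U R) (BMod R B) :=
  @Functor (ModExR U R) (BMod R B) (fun W => omega_r D (sval W))
    (fun W W' f => omega_r_map D f) _ _.
Next Obligation. by apply: bhom_eq => x; apply: val_inj. Qed.
Next Obligation. by apply: bhom_eq => x; apply: val_inj. Qed.

Program Definition adj_r : adjunction phi_r Omega_r :=
  @Adjunction _ _ phi_r Omega_r (fun M => @unit_r k U _ D R M)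
    (fun W => counit_r D (sval W)) _ _ _ _.
Next Obligation.
by apply: bhom_eq => x; apply: val_inj; rewrite /= tmap_tmk.
Qed.
Next Obligation.
apply: bhom_tens_ext => x y /=; rewrite tmap_tmk -[y]reprK /=.
by rewrite [LHS]counit_rE counit_rE /= bfunr.
Qed.
Next Obligation.
apply: bhom_tens_ext => x y /=; rewrite tmap_tmk -[y]reprK /=.
rewrite counit_rE /= [LHS]tens_ractE; congr tmk.
by rewrite [LHS]rquo_ractE mul1r.
Qed.
Next Obligation.
by apply: bhom_eq => w; apply: val_inj; rewrite /= counit_rE ract1.
Qed.
End RightInduction.

Section ModeTransition.
Variables (k : comPzRingType) (U : acs_alg k).

Definition zhu (n : nat) : kalg k := sqalg (zhu_sq U n).
Definition Lmod (n : nat) : bimod U (zhu n) := lquot (zhu_l U n).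
Definition Rmod (n : nat) : bimod (zhu n) U := rquot (zhu_r U n).

Definition Lcls (n : nat) (u : U) : Lmod n := \pi_(lquo (NLi U n.+1)) u.
Definition Rcls (n : nat) (u : U) : Rmod n := \pi_(rquo (NRi U n.+1)) u.
Definition zcls (n : nat) (u : U) (hu : u \in homog U 0) : zhu n :=
  sqcls (D := zhu_sq U n) hu.

Lemma Lrepr (n : nat) (x : Lmod n) : exists u, x = Lcls n u.
Proof. by exists (repr (x : lquo (NLi U n.+1))); rewrite /Lcls reprK. Qed.
Lemma Rrepr (n : nat) (x : Rmod n) : exists u, x = Rcls n u.
Proof. by exists (repr (x : rquo (NRi U n.+1))); rewrite /Rcls reprK. Qed.
Lemma zrepr (n : nat) (b : zhu n) : exists u (hu : u \in homog U 0), b = zcls n hu.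
Proof.
have h : sqrep (b : qring _) \in homog U 0 by apply: (@sqrep_in k U (zhu_sq U n)).
by exists (sqrep (b : qring _)), h; rewrite /zcls sqrepK.
Qed.

Lemma LclsD n u v : Lcls n u + Lcls n v = Lcls n (u + v).
Proof. exact: lpiD. Qed.
Lemma RclsD n u v : Rcls n u + Rcls n v = Rcls n (u + v).
Proof. exact: rpiD. Qed.
Lemma LclsE n u v : Lcls n u = Lcls n v <-> u - v \in NL U n.+1.
Proof. exact: (@lpiE k U (NLi U n.+1)). Qed.
Lemma RclsE n u v : Rcls n u = Rcls n v <-> u - v \in NR_pred U n.+1.
Proof. exact: (@rpiE k U (NRi U n.+1)). Qed.
Lemma zclsE n u v (hu : u \in homog U 0) (hv : v \in homog U 0) :
  zcls n hu = zcls n hv <-> u - v \in NL U n.+1.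
Proof. exact: (@sqclsE k U (zhu_sq U n)). Qed.
Lemma Lcls_lact n u v : u *> Lcls n v = Lcls n (u * v).
Proof. exact: lquo_lactE. Qed.
Lemma Rcls_ract n u v : Rcls n u <* v = Rcls n (u * v).
Proof. exact: rquo_ractE. Qed.
Lemma Lcls_ract n u v (hv : v \in homog U 0) :
  Lcls n u <* zcls n hv = Lcls n (u * v).
Proof. by apply: lquo_ractE => //; apply: sqcls_rep. Qed.
Lemma Rcls_lact n u v (hv : v \in homog U 0) :
  zcls n hv *> Rcls n u = Rcls n (v * u).
Proof. by apply: rquo_lactE => //; apply: sqcls_rep. Qed.

(* The pairing R^0 x L^0 -> A_0.  The degree 0 component of a * b is the sum of
   the products of components of a and b of opposite degrees, so this is the
   biadditive extension of the formula for homogeneous a and b: see [mpairE]. *)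
Definition mpair (a : Rmod 0) (b : Lmod 0) : zhu 0 :=
  zcls 0 (@homog_hc k U 0 (repr (a : rquo _) * repr (b : lquo _))).

Lemma mpair_cls (u v : U) : mpair (Rcls 0 u) (Lcls 0 v) = zcls 0 (homog_hc 0 (u * v)).
Proof.
apply/zclsE; set u' := repr _; set v' := repr _.
have hu : u' - u \in NR_pred U 1 by apply/(RclsE 0); rewrite /Rcls reprK.
have hv : v' - v \in NL U 1 by apply/(LclsE 0); rewrite /Lcls reprK.
rewrite -(additiveN (hcD 0)) -hcD.
have -> : u' * v' - u * v = (u' - u) * v' + u * (v' - v).
  by rewrite mulrBl mulrBr addrA subrK.
rewrite hcD rpredD //; last by apply/NL_hc/NL_left.
by move/NRP: (NR_right v' hu) => /(_ 0); rewrite subr0.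
Qed.

Lemma mpairE (p q : int) (u v : U) : u \in homog U p -> v \in homog U q ->
  (forall h : p + q = 0, exists huv : u * v \in homog U 0,
     mpair (Rcls 0 u) (Lcls 0 v) = zcls 0 huv) /\
  (p + q != 0 -> mpair (Rcls 0 u) (Lcls 0 v) = 0).
Proof.
move=> hu hv; have huv := homogM hu hv; rewrite mpair_cls; split=> [h|h].
  rewrite h in huv; exists huv; apply/zclsE.
  by rewrite (hc_homog _ huv) eqxx subrr rpred0.
have h0 : 0 \in homog U 0 by rewrite rpred0.
have z0 : zcls 0 h0 = 0.
  apply: (addrI (zcls 0 h0)); rewrite addr0 /zcls.
  have h00 : (0 : U) + 0 \in sq_S (zhu_sq U 0) by rewrite addr0 rpred0.
  rewrite -(@sqclsD k U (zhu_sq U 0) _ _ h0 h0 h00).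
  by apply/(@sqclsE k U (zhu_sq U 0)); rewrite addr0 subrr rpred0.
rewrite -z0; apply/zclsE; rewrite (hc_homog _ huv) eq_sym (negbTE h).
by rewrite subrr rpred0.
Qed.

Lemma zclsD n u v (hu : u \in homog U 0) (hv : v \in homog U 0)
  (huv : u + v \in homog U 0) : zcls n huv = zcls n hu + zcls n hv.
Proof. exact: (@sqclsD k U (zhu_sq U n)). Qed.
Lemma zclsM n u v (hu : u \in homog U 0) (hv : v \in homog U 0)
  (huv : u * v \in homog U 0) : zcls n huv = zcls n hu * zcls n hv.
Proof. exact: (@sqclsM k U (zhu_sq U n)). Qed.

Lemma mpair_bal : balanced mpair.
Proof.
split.
- move=> x x' y; have [u ->] := Rrepr x; have [u' ->] := Rrepr x'.
  have [v ->] := Lrepr y; rewrite RclsD !mpair_cls.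
  have h : hc 0 (u * v) + hc 0 (u' * v) \in homog U 0 by rewrite rpredD ?homog_hc.
  by rewrite -(zclsD _ _ _ h); apply/zclsE; rewrite mulrDl hcD subrr rpred0.
- move=> x y y'; have [u ->] := Rrepr x; have [v ->] := Lrepr y.
  have [v' ->] := Lrepr y'; rewrite LclsD !mpair_cls.
  have h : hc 0 (u * v) + hc 0 (u * v') \in homog U 0 by rewrite rpredD ?homog_hc.
  by rewrite -(zclsD _ _ _ h); apply/zclsE; rewrite mulrDr hcD subrr rpred0.
- move=> x r y; have [u ->] := Rrepr x; have [v ->] := Lrepr y.
  rewrite Rcls_ract Lcls_lact !mpair_cls; apply/zclsE.
  by rewrite mulrA subrr rpred0.
Qed.

Definition circ : tensor (Rmod 0) (Lmod 0) -> zhu 0 := tlift mpair.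

Lemma circE a b : circ (tmk a b) = mpair a b.
Proof. exact: tlift_tmk mpair_bal a b. Qed.

Lemma hc0_Ml (s u : U) : s \in homog U 0 -> hc 0 (s * u) = s * hc 0 u.
Proof.
move=> hs; have [t [_ {1 2}->]] := hc_dec u; rewrite mulr_sumr !hc_sum mulr_sumr.
apply: eq_bigr => p _; rewrite (hc_homog 0 (homog_hc p u)).
rewrite (@hc_homog _ _ 0 p); first by case: eqP => // _; rewrite mulr0.
by rewrite -[p]add0r; apply: homogM => //; rewrite add0r homog_hc.
Qed.
Lemma hc0_Mr (s u : U) : s \in homog U 0 -> hc 0 (u * s) = hc 0 u * s.
Proof.
move=> hs; have [t [_ {1 2}->]] := hc_dec u; rewrite mulr_suml !hc_sum mulr_suml.
apply: eq_bigr => p _; rewrite (hc_homog 0 (homog_hc p u)).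
rewrite (@hc_homog _ _ 0 p); first by case: eqP => // _; rewrite mul0r.
by rewrite -[p]addr0; apply: homogM => //; rewrite addr0 homog_hc.
Qed.

Lemma circ_l (r : zhu 0) a b : circ (tmk (r *> a) b) = r * circ (tmk a b).
Proof.
rewrite !circE; have [s [hs ->]] := zrepr r; have [u ->] := Rrepr a.
have [v ->] := Lrepr b; rewrite Rcls_lact !mpair_cls.
have h : s * hc 0 (u * v) \in homog U 0 by rewrite -hc0_Ml // homog_hc.
rewrite -(zclsM _ _ _ h); apply/zclsE.
by rewrite -mulrA hc0_Ml // subrr rpred0.
Qed.
Lemma circ_r (r : zhu 0) a b : circ (tmk a (b <* r)) = circ (tmk a b) * r.
Proof.
rewrite !circE; have [s [hs ->]] := zrepr r; have [u ->] := Rrepr a.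
have [v ->] := Lrepr b; rewrite Lcls_ract !mpair_cls.
have h : hc 0 (u * v) * s \in homog U 0 by rewrite -hc0_Mr // homog_hc.
rewrite -(zclsM _ _ _ h); apply/zclsE.
by rewrite mulrA hc0_Mr // subrr rpred0.
Qed.

Definition mta : bimod U U := tensor (Lmod 0) (Rmod 0).

Definition star (x y : mta) : mta :=
  tlift (fun a b =>
    tlift (fun a' b' => tmk a (circ (tmk b a') *> b')) y) x.

Lemma star_bal1 a b :
  balanced (fun a' b' => tmk a (circ (tmk b a') *> b') : mta).
Proof.
have [pDl pDr _] := mpair_bal; split=> [x x' y|x y y'|x r y].
- by rewrite !circE pDr lactDl tmkDr.
- by rewrite lactDr tmkDr.
- by rewrite circ_r lactA.
Qed.

Lemma star_bal2 (y : mta) : balanced (fun a b =>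
  tlift (fun a' b' => tmk a (circ (tmk b a') *> b')) y : mta).
Proof.
have [pDl pDr _] := mpair_bal; split=> [a a' b|a b b'|a r b]; rewrite /tlift.
- by rewrite -big_split; apply: eq_bigr => xy _; rewrite tmkDl.
- rewrite -big_split; apply: eq_bigr => xy _.
  by rewrite !circE pDl lactDl tmkDr.
- by apply: eq_bigr => xy _; rewrite tmkbal circ_l lactA.
Qed.

Lemma starE a b a' b' :
  star (tmk a b) (tmk a' b') = tmk a (circ (tmk b a') *> b').
Proof.
rewrite [LHS](tlift_tmk (star_bal2 _)).
exact: (tlift_tmk (star_bal1 a b)).
Qed.
Lemma starDl x x' y : star (x + x') y = star x y + star x' y.
Proof. exact: tliftD (star_bal2 y) _ _. Qed.
Lemma starDr x y y' : star x (y + y') = star x y + star x y'.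
Proof.
rewrite /star /tlift -big_split; apply: eq_bigr => ab _.
exact: tliftD (star_bal1 _ _) _ _.
Qed.

Definition Lgr (n : nat) (p : int) : {pred Lmod n} :=
  fun x => `[< exists2 u, u \in homog U p & x = Lcls n u >].
Definition Rgr (n : nat) (p : int) : {pred Rmod n} :=
  fun x => `[< exists2 u, u \in homog U p & x = Rcls n u >].
Arguments Lgr : clear implicits.
Arguments Rgr : clear implicits.

Lemma LgrP n p x :
  reflect (exists2 u, u \in homog U p & x = Lcls n u) (x \in Lgr n p).
Proof. exact: asboolP. Qed.
Lemma RgrP n p x :
  reflect (exists2 u, u \in homog U p & x = Rcls n u) (x \in Rgr n p).
Proof. exact: asboolP. Qed.

Lemma LclsN n u : - Lcls n u = Lcls n (- u).
Proof. by rewrite -(raddfN \pi_({ideal_quot (NL U n.+1)})). Qed.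
Lemma RclsN n u : - Rcls n u = Rcls n (- u).
Proof. by rewrite -(raddfN \pi_({ideal_quot (rid (NRi U n.+1))})). Qed.

Lemma Lgr_closed n p : zmod_closed (Lgr n p).
Proof.
split.
  apply/LgrP; exists 0; first by rewrite rpred0.
  by apply: (addrI (Lcls n 0)); rewrite LclsD !addr0.
move=> x y /LgrP[u hu ->] /LgrP[v hv ->]; apply/LgrP; exists (u - v).
  by rewrite rpredB.
by rewrite LclsN LclsD.
Qed.
HB.instance Definition _ n p :=
  GRing.isZmodClosed.Build (Lmod n) (Lgr n p) (Lgr_closed n p).
Lemma Rgr_closed n p : zmod_closed (Rgr n p).
Proof.
split.
  apply/RgrP; exists 0; first by rewrite rpred0.
  by apply: (addrI (Rcls n 0)); rewrite RclsD !addr0.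
move=> x y /RgrP[u hu ->] /RgrP[v hv ->]; apply/RgrP; exists (u - v).
  by rewrite rpredB.
by rewrite RclsN RclsD.
Qed.
HB.instance Definition _ n p :=
  GRing.isZmodClosed.Build (Rmod n) (Rgr n p) (Rgr_closed n p).

Lemma L0_comp_l p (a : base_alg k) (x : res_l (kstr_hom U) (Lmod 0)) :
  x \in Lgr 0 p -> a *> x \in Lgr 0 p.
Proof.
move=> /LgrP[u hu ->]; apply/LgrP; exists (kstr U a * u).
  by rewrite -[p]add0r; apply: homogM => //; apply: homog_kstr.
exact: Lcls_lact.
Qed.
Lemma L0_comp_r p (x : res_l (kstr_hom U) (Lmod 0)) (b : zhu 0) :
  x \in Lgr 0 p -> x <* b \in Lgr 0 p.
Proof.
have [s [hs ->]] := zrepr b.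
move=> /LgrP[u hu ->]; apply/LgrP; exists (u * s); last exact: Lcls_ract.
by rewrite -[p]addr0; apply: homogM.
Qed.
Definition L0_comp (p : int) : bimod (base_alg k) (zhu 0) :=
  sub_bimod (@L0_comp_l p) (@L0_comp_r p).

Lemma R0_comp_r p (x : res_r (kstr_hom U) (Rmod 0)) (a : base_alg k) :
  x \in Rgr 0 p -> x <* a \in Rgr 0 p.
Proof.
move=> /RgrP[u hu ->]; apply/RgrP; exists (u * kstr U a).
  by rewrite -[p]addr0; apply: homogM => //; apply: homog_kstr.
exact: Rcls_ract.
Qed.
Lemma R0_comp_l p (b : zhu 0) (x : res_r (kstr_hom U) (Rmod 0)) :
  x \in Rgr 0 p -> b *> x \in Rgr 0 p.
Proof.
have [s [hs ->]] := zrepr b.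
move=> /RgrP[u hu ->]; apply/RgrP; exists (s * u); last exact: Rcls_lact.
by rewrite -[p]add0r; apply: homogM.
Qed.
Definition R0_comp (p : int) : bimod (zhu 0) (base_alg k) :=
  sub_bimod (@R0_comp_l p) (@R0_comp_r p).

Definition tens_span (S R T : kalg k) (X : bimod S R) (Y : bimod R T)
    (P : {pred X}) (Q : {pred Y}) : {pred tensor X Y} :=
  fun t => `[< exists s : seq (X * Y),
    (forall xy, xy \in s -> (xy.1 \in P) /\ (xy.2 \in Q)) /\
    t = \sum_(xy <- s) tmk xy.1 xy.2 >].

Lemma tens_spanP (S R T : kalg k) (X : bimod S R) (Y : bimod R T)
    (P : {pred X}) (Q : {pred Y}) (t : tensor X Y) :
  reflect (exists s : seq (X * Y),
    (forall xy, xy \in s -> (xy.1 \in P) /\ (xy.2 \in Q)) /\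
    t = \sum_(xy <- s) tmk xy.1 xy.2) (t \in tens_span P Q).
Proof. exact: asboolP. Qed.

Lemma tens_span_closed (S R T : kalg k) (X : bimod S R) (Y : bimod R T)
  (P : {pred X}) (Q : {pred Y}) :
  (forall x, x \in P -> - x \in P) -> zmod_closed (tens_span P Q).
Proof.
move=> PN; split; first by apply/tens_spanP; exists [::]; rewrite big_nil.
move=> x y /tens_spanP[s [hs ->]] /tens_spanP[t [ht ->]]; apply/tens_spanP.
exists (s ++ tnegs t); split.
  move=> xy; rewrite mem_cat => /orP[/hs //|/mapP[ab /ht[h1 h2] ->]] /=.
  by split; first exact: PN.
rewrite big_cat /=; congr (_ + _); rewrite big_map -sumrN.
apply: eq_bigr => ab _ /=; apply: (addrI (tmk ab.1 ab.2)).
by rewrite subrr -tmkDl subrr tmk0l.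
Qed.

(* A_{p,q} = L^0_p (x) R^0_q inside L^0 (x) R^0; since L^0 and R^0 are the direct
   sums of these A_0-submodules, the tensor product of the components embeds. *)
Definition mta_comp (p q : int) : {pred mta} := tens_span (Lgr 0 p) (Rgr 0 q).

Definition SIC : Prop :=
  exists one : nat -> mta,
    (forall n : nat, one n \in mta_comp n%:Z (- n%:Z)) /\
    (forall (n m : nat) (a : mta), a \in mta_comp n%:Z (- m%:Z) ->
       star (one n) a = a /\ star a (one m) = a).

Section InducedComponents.
Variable R : kalg k.

Definition indl_pred (M : bimod (zhu 0) R) (p : int) : {pred tensor (Lmod 0) M} :=
  tens_span (Lgr 0 p) predT.
Lemma indl_closed (M : bimod (zhu 0) R) (p : int) : zmod_closed (@indl_pred M p).
Proof. by apply: tens_span_closed => x; rewrite rpredN. Qed.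
HB.instance Definition _ (M : bimod (zhu 0) R) p :=
  GRing.isZmodClosed.Build (tensor (Lmod 0) M) (@indl_pred M p)
    (@indl_closed M p).

Lemma indl_l (M : bimod (zhu 0) R) p (a : base_alg k)
    (t : res_l (kstr_hom U) (tensor (Lmod 0) M)) :
  t \in @indl_pred M p -> a *> t \in @indl_pred M p.
Proof.
move=> /tens_spanP[s [hs ->]]; rewrite (additive_sum _ _ (lactDr a)).
rewrite big_seq; apply: rpred_sum => xy /hs[h _]; apply/tens_spanP.
exists [:: (kstr U a *> xy.1, xy.2)]; split; last first.
  by rewrite big_seq1; apply: tens_lactE.
move=> _ /[1!inE] /eqP -> /=; split=> //.
exact: (@L0_comp_l p a).
Qed.
Lemma indl_r (M : bimod (zhu 0) R) p
    (t : res_l (kstr_hom U) (tensor (Lmod 0) M)) (r : R) :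
  t \in @indl_pred M p -> t <* r \in @indl_pred M p.
Proof.
move=> /tens_spanP[s [hs ->]].
rewrite (additive_sum _ _ (fun x y => ractDl x y r)).
rewrite big_seq; apply: rpred_sum => xy /hs[h _]; apply/tens_spanP.
exists [:: (xy.1, xy.2 <* r)]; split; last first.
  by rewrite big_seq1; apply: tens_ractE.
by move=> _ /[1!inE] /eqP -> /=.
Qed.
Definition indl_comp (M : bimod (zhu 0) R) (p : int) : bimod (base_alg k) R :=
  sub_bimod (@indl_l M p) (@indl_r M p).

Definition indr_pred (M : bimod R (zhu 0)) (p : int) : {pred tensor M (Rmod 0)} :=
  tens_span predT (Rgr 0 p).
Lemma indr_closed (M : bimod R (zhu 0)) (p : int) : zmod_closed (@indr_pred M p).
Proof. exact: tens_span_closed. Qed.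
HB.instance Definition _ (M : bimod R (zhu 0)) p :=
  GRing.isZmodClosed.Build (tensor M (Rmod 0)) (@indr_pred M p)
    (@indr_closed M p).

Lemma indr_r (M : bimod R (zhu 0)) p
    (t : res_r (kstr_hom U) (tensor M (Rmod 0))) (a : base_alg k) :
  t \in @indr_pred M p -> t <* a \in @indr_pred M p.
Proof.
move=> /tens_spanP[s [hs ->]].
rewrite (additive_sum _ _ (fun x y => ractDl x y a)).
rewrite big_seq; apply: rpred_sum => xy /hs[_ h]; apply/tens_spanP.
exists [:: (xy.1, xy.2 <* kstr U a)]; split; last first.
  by rewrite big_seq1; apply: tens_ractE.
move=> _ /[1!inE] /eqP -> /=; split=> //.
exact: (@R0_comp_r p _ a).
Qed.
Lemma indr_l (M : bimod R (zhu 0)) p (r : R)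
    (t : res_r (kstr_hom U) (tensor M (Rmod 0))) :
  t \in @indr_pred M p -> r *> t \in @indr_pred M p.
Proof.
move=> /tens_spanP[s [hs ->]]; rewrite (additive_sum _ _ (lactDr r)).
rewrite big_seq; apply: rpred_sum => xy /hs[_ h]; apply/tens_spanP.
exists [:: (r *> xy.1, xy.2)]; split; last first.
  by rewrite big_seq1; apply: tens_lactE.
by move=> _ /[1!inE] /eqP -> /=.
Qed.
Definition indr_comp (M : bimod R (zhu 0)) (p : int) : bimod R (base_alg k) :=
  sub_bimod (@indr_l M p) (@indr_r M p).
End InducedComponents.

Definition Lmod_ex (n : nat) : ModExL U (base_alg k) :=
  exist (fun W : bimod U (base_alg k) => exhaustive_l W)
    (res_r (kstr_hom (zhu n)) (Lmod n)) (lquot_exhaustive (D := zhu_l U n)).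
Definition Rmod_ex (n : nat) : ModExR U (base_alg k) :=
  exist (fun W : bimod (base_alg k) U => exhaustive_r W)
    (res_l (kstr_hom (zhu n)) (Rmod n)) (rquot_exhaustive (D := zhu_r U n)).

End ModeTransition.

Definition fin_gen_l (k : comPzRingType) (S R : kalg k) (M : bimod S R) :=
  exists s : seq M, forall x : M, exists c : M -> S, x = \sum_(m <- s) c m *> m.
Definition fin_gen_r (k : comPzRingType) (S R : kalg k) (M : bimod S R) :=
  exists s : seq M, forall x : M, exists c : M -> R, x = \sum_(m <- s) m <* c m.

Definition fg_projective_l (k : comPzRingType) (S : kalg k)
    (M : bimod S (base_alg k)) :=
  fin_gen_l M /\ projective (M : BMod S (base_alg k)).
Definition fg_projective_r (k : comPzRingType) (R : kalg k)
    (M : bimod (base_alg k) R) :=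
  fin_gen_r M /\ projective (M : BMod (base_alg k) R).

Section Completion.
Variables (k : comPzRingType) (U : acs_alg k).

Definition icls (n : int) (u : U) : lquo (NLi U n) := \pi_(lquo (NLi U n)) u.

Lemma iclsE n u v : icls n u = icls n v <-> u - v \in NL U n.
Proof. exact: (@lpiE k U (NLi U n)). Qed.
Lemma iclsD n u v : icls n u + icls n v = icls n (u + v).
Proof. exact: lpiD. Qed.
Lemma iclsN n u : - icls n u = icls n (- u).
Proof. by rewrite -(raddfN \pi_({ideal_quot (NL U n)})). Qed.
Lemma icls0 n : icls n 0 = 0.
Proof. by apply: (addrI (icls n 0)); rewrite iclsD !addr0. Qed.

(* The inverse limit of the groups U_p / N_L^n U_p, where the latter is viewed
   as the image of U_p in U / N_L^n U. *)
Record hat (p : int) := Hat {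
  hfam : forall n : int, lquo (NLi U n);
  hfam_homog : forall n, exists2 u, u \in homog U p & hfam n = icls n u;
  hfam_compat : forall m n u, (m <= n)%R -> hfam n = icls n u ->
    hfam m = icls m u
}.

Section HatZmodule.
Variable p : int.
HB.instance Definition _ := gen_eqMixin (hat p).
HB.instance Definition _ := gen_choiceMixin (hat p).

Lemma hat_eq (x y : hat p) : (forall n, hfam x n = hfam y n) -> x = y.
Proof.
case: x y => [x x1 x2] [y y1 y2] /= h.
have xy : x = y by apply: functional_extensionality_dep.
by move: y1 y2; rewrite -xy => y1 y2; congr Hat; apply: Prop_irrelevance.
Qed.

Program Definition hatc (u : U) (hu : u \in homog U p) : hat p :=
  @Hat p (fun n => icls n u) _ _.
Next Obligation. by exists u. Qed.
Next Obligation.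
by apply/iclsE; move/iclsE: H0; apply: NL_decr.
Qed.

Definition hat0 : hat p := hatc (rpred0 (homog U p)).

Program Definition hatD (x y : hat p) : hat p :=
  @Hat p (fun n => hfam x n + hfam y n) _ _.
Next Obligation.
have [u hu ->] := hfam_homog x n; have [v hv ->] := hfam_homog y n.
by exists (u + v); rewrite ?rpredD ?iclsD.
Qed.
Next Obligation.
have [v _ xv] := hfam_homog x n; have [w _ yw] := hfam_homog y n.
rewrite (hfam_compat H xv) (hfam_compat H yw) iclsD.
move: H0; rewrite xv yw iclsD => /iclsE h; apply/iclsE; exact: NL_decr h.
Qed.

Program Definition hatN (x : hat p) : hat p := @Hat p (fun n => - hfam x n) _ _.
Next Obligation.
have [u hu ->] := hfam_homog x n.
by exists (- u); rewrite ?rpredN ?iclsN.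
Qed.
Next Obligation.
have [v _ xv] := hfam_homog x n; rewrite (hfam_compat H xv) iclsN.
move: H0; rewrite xv iclsN => /iclsE h; apply/iclsE; exact: NL_decr h.
Qed.

Lemma hatA : associative hatD.
Proof. by move=> x y z; apply: hat_eq => n /=; rewrite addrA. Qed.
Lemma hatC : commutative hatD.
Proof. by move=> x y; apply: hat_eq => n /=; rewrite addrC. Qed.
Lemma hat0D : left_id hat0 hatD.
Proof. by move=> x; apply: hat_eq => n /=; rewrite icls0 add0r. Qed.
Lemma hatND : left_inverse hat0 hatN hatD.
Proof. by move=> x; apply: hat_eq => n /=; rewrite icls0 addNr. Qed.
HB.instance Definition _ := GRing.isZmodule.Build (hat p)
  hatA hatC hat0D hatND.
End HatZmodule.

(* The continuous extension of U_p x U_q -> U_(p+q): modulo N_L^n, the product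
   depends on the first factor modulo N_L^(n+q) and on the second modulo N_L^n;
   see [hmul_famE]. *)
Definition hmul_fam (p q : int) (x : hat p) (y : hat q) (n : int) :=
  icls n (hc p (repr (hfam x (n + q))) * hc q (repr (hfam y n))).

Lemma hmul_famE (p q : int) (x : hat p) (y : hat q) (n : int) (u v : U) :
  u \in homog U p -> v \in homog U q ->
  hfam x (n + q) = icls (n + q) u -> hfam y n = icls n v ->
  hmul_fam x y n = icls n (u * v).
Proof.
move=> hu hv xu yv; apply/iclsE; rewrite xu yv; set u' := repr _; set v' := repr _.
have hu' : hc p u' - u \in NL U (n + q).
  rewrite -{1}(homogP _ _ hu) -(additiveN (hcD p)) -hcD.
  by apply/NL_hc/iclsE; rewrite /icls reprK.
have hv' : hc q v' - v \in NL U n.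
  rewrite -{1}(homogP _ _ hv) -(additiveN (hcD q)) -hcD.
  by apply/NL_hc/iclsE; rewrite /icls reprK.
have -> : hc p u' * hc q v' - u * v
    = (hc p u' - u) * hc q v' + u * (hc q v' - v).
  by rewrite mulrBl mulrBr addrA subrK.
apply: rpredD; last exact: NL_left.
by move: (NL_right hu' (homog_hc q v')); rewrite addrK.
Qed.

Program Definition hmul (p q : int) (x : hat p) (y : hat q) : hat (p + q) :=
  @Hat (p + q) (hmul_fam x y) _ _.
Next Obligation.
have [u hu xu] := hfam_homog x (n + q); have [v hv yv] := hfam_homog y n.
by exists (u * v); [apply: homogM | apply: hmul_famE].
Qed.
Next Obligation.
have [v hv xv] := hfam_homog x (n + q); have [w hw yw] := hfam_homog y n.
rewrite (@hmul_famE _ _ x y m v w) //; last exact: hfam_compat yw.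
  apply/iclsE; apply: NL_decr H _ _; apply/iclsE.
  by rewrite -H0 (@hmul_famE _ _ x y n v w).
by apply: hfam_compat xv; rewrite Num.Theory.lerD2r.
Qed.

Definition hat1 : hat 0 := hatc (rpred1 (homog0 U)).

Definition hatker (n : int) (x : hat 0) : Prop := hfam x n = 0.

Definition hat_cvg (s : nat -> hat 0) (l : hat 0) : Prop :=
  forall n : int, exists K : nat, forall j : nat, (K <= j)%N ->
    hatker n (s j - l).

Definition tail_in (e : nat -> hat 0) (n : int) (N : nat) : Prop :=
  exists2 l, hat_cvg (fun K => \sum_(N <= i < K) e i) l & hatker n l.

Definition least_tail (e : nat -> hat 0) (n : int) (N : nat) : Prop :=
  tail_in e n N /\ forall M, tail_in e n M -> (N <= M)%N.

Definition strong_identity_expansion (e : nat -> hat 0) : Prop :=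
  [/\ hat_cvg (fun K => \sum_(0 <= i < K) e i) hat1,
      forall m n : nat, m <> n -> hmul (e m) (e n) = 0 &
      forall n : nat, exists2 N : nat, least_tail e n%:Z N &
        (forall x : hat (- n%:Z), hmul x (\sum_(0 <= i < N) e i) = 0) /\
        (forall x : hat n%:Z, hmul (\sum_(0 <= i < N) e i) x = 0)].
End Completion.

(* Main.v *)
(* SIC, an identity expansion and the projectivity of all L^n and R^n each amount
   to approximate units: for all n and m, elements e of degree 0 in N_L^n U with
   x = x e modulo N_L^m U for x in N_L^n U, and mirrored ones for N_R^n U.  Given
   these, a module annihilated by N_L^(m+1) decomposes through the pieces cut out
   by the units, which makes unit and counit of the inductions bijective.

   Conversely, let level-zero induction with coefficients R be an equivalence.  Its
   unit at A_0 shows that the idealizer of N_R^1 U is U_0 + N_R^1 U.  Its counit at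
   R (x)_k R^p writes 1 (x) v, for v in U_p, as a sum of r_i (x) y_i x_i v with
   y_i in U_p and x_i in U_(-p).  It remains to find t in U_p U_(-p) with a = t a
   modulo N_L^1 U for a in U_p: an induction on p using the idealizer shows that t
   is then a right unit for U_(-p) as well.  For R = k the sum of the r_i y_i x_i is
   such a t.  In general, let B be an ideal of k maximal among those modulo which no
   t exists.  A dual basis of L^0_p over R shows that B is prime and that no z
   outside B acts on U_p modulo B as an element of U_p U_(-p).  But R modulo B has a
   torsion-free quotient of rank one over k/B in which 1 survives, and mapping the
   r_i to it produces such a z. *)
Require Import Defs.
From HB Require Import structures.
From mathcomp Require Import all_boot all_order all_algebra ring_quotient.
From mathcomp Require Import boolp classical_sets functions zify.

Set Implicit Arguments.
Unset Strict Implicit.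
Unset Printing Implicit Defensive.

Import Order.TTheory GRing.Theory Num.Theory.
Local Open Scope ring_scope.
Local Open Scope quotient_scope.

Inductive psum (R : pzRingType) (P : R -> R -> Prop) : R -> Prop :=
| psum0 : psum P 0
| psum_cons x y v : P x y -> psum P v -> psum P (x * y + v).

Section Psum.
Variables (R : pzRingType) (P : R -> R -> Prop).

Lemma psumD u v : psum P u -> psum P v -> psum P (u + v).
Proof.
elim=> [|x y w h _ ih] hv; first by rewrite add0r.
by rewrite -addrA; apply: psum_cons => //; apply: ih.
Qed.

Lemma psum_mul x y : P x y -> psum P (x * y).
Proof. by move=> h; rewrite -[x * y]addr0; apply: psum_cons => //; apply: psum0. Qed.

Lemma psum_closed (Q : zmodClosed R) u :
  (forall x y, P x y -> x * y \in Q) -> psum P u -> u \in Q.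
Proof. by move=> h; elim=> [|x y v /h hxy _ ih]; rewrite ?rpred0 ?rpredD. Qed.

Lemma psum_bigD (I : Type) (s : seq I) (F : I -> R) :
  (forall i, psum P (F i)) -> psum P (\sum_(i <- s) F i).
Proof.
move=> h; elim: s => [|i s ih]; first by rewrite big_nil; apply: psum0.
by rewrite big_cons; apply: psumD.
Qed.

Lemma psum_seq u : psum P u -> exists s : seq (R * R),
  (forall xy, xy \in s -> P xy.1 xy.2) /\ u = \sum_(xy <- s) xy.1 * xy.2.
Proof.
elim=> [|x y v h _ [s [hs ->]]]; first by exists [::]; rewrite big_nil.
exists ((x, y) :: s); rewrite big_cons; split=> // xy.
by rewrite inE => /predU1P[->|/hs].
Qed.

Lemma seq_psum (s : seq (R * R)) :
  (forall xy, xy \in s -> P xy.1 xy.2) -> psum P (\sum_(xy <- s) xy.1 * xy.2).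
Proof.
elim: s => [|[x y] s ih] hs; first by rewrite big_nil; apply: psum0.
rewrite big_cons; apply: psum_cons; first by apply: (hs (x, y)); rewrite mem_head.
by apply: ih => xy h; apply: hs; rewrite inE h orbT.
Qed.

Lemma psum_mono (P' : R -> R -> Prop) u : (forall x y, P x y -> P' x y) ->
  psum P u -> psum P' u.
Proof. by move=> h; elim=> *; [apply: psum0 | apply: psum_cons => //; apply: h]. Qed.

Lemma psumMl (P' : R -> R -> Prop) a u : (forall x y, P x y -> P' (a * x) y) ->
  psum P u -> psum P' (a * u).
Proof.
move=> h; elim=> [|x y v hxy _ ih]; first by rewrite mulr0; apply: psum0.
by rewrite mulrDr mulrA; apply: psum_cons => //; apply: h.
Qed.

Lemma psumMr (P' : R -> R -> Prop) a u : (forall x y, P x y -> P' x (y * a)) ->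
  psum P u -> psum P' (u * a).
Proof.
move=> h; elim=> [|x y v hxy _ ih]; first by rewrite mul0r; apply: psum0.
by rewrite mulrDl -mulrA; apply: psum_cons => //; apply: h.
Qed.
End Psum.

Section GradedAlgebra.
Variables (k : comPzRingType) (U : graded_alg k).

Lemma hcN p (u : U) : hc p (- u) = - hc p u.
Proof. exact: additiveN (hcD p) u. Qed.
Lemma hcB p (u v : U) : hc p (u - v) = hc p u - hc p v.
Proof. by rewrite hcD hcN. Qed.

Lemma hcMr p q (u v : U) : v \in homog U q -> hc p (u * v) = hc (p - q) u * v.
Proof.
move=> hv; have [t [_ {1 2}->]] := hc_dec u; rewrite mulr_suml !hc_sum mulr_suml.
apply: eq_bigr => r _; rewrite (hc_homog _ (homog_hc r u)).
rewrite (@hc_homog _ _ p (r + q)); last by apply: homogM => //; apply: homog_hc.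
by rewrite subr_eq; case: eqP => // _; rewrite mul0r.
Qed.
Lemma hcMl p q (u v : U) : v \in homog U q -> hc p (v * u) = v * hc (p - q) u.
Proof.
move=> hv; have [t [_ {1 2}->]] := hc_dec u; rewrite mulr_sumr !hc_sum mulr_sumr.
apply: eq_bigr => r _; rewrite (hc_homog _ (homog_hc r u)).
rewrite (@hc_homog _ _ p (q + r)); last by apply: homogM => //; apply: homog_hc.
by rewrite subr_eq [r + q]addrC; case: eqP => // _; rewrite mulr0.
Qed.

Lemma homogM0l p (u v : U) : u \in homog U 0 -> v \in homog U p -> u * v \in homog U p.
Proof. by move=> hu hv; rewrite -[p]add0r; apply: homogM. Qed.
Lemma homogM0r p (u v : U) : u \in homog U p -> v \in homog U 0 -> u * v \in homog U p.
Proof. by move=> hu hv; rewrite -[p]addr0; apply: homogM. Qed.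
Lemma homogMN0 p (u v : U) : u \in homog U p -> v \in homog U (- p) -> u * v \in homog U 0.
Proof. by move=> hu hv; rewrite -(subrr p); apply: homogM. Qed.
Lemma homogNM0 p (u v : U) : u \in homog U (- p) -> v \in homog U p -> u * v \in homog U 0.
Proof. by move=> hu hv; rewrite -(addNr p); apply: homogM. Qed.
Lemma homog1 : (1 : U) \in homog U 0.
Proof. exact/homogP/hc1. Qed.

Lemma homog_deg_le p q (u : U) : u \in homog U q -> (q <= p)%R -> u \in deg_le p.
Proof.
move=> hu qp; apply/asboolP => r pr; rewrite (hc_homog _ hu).
by case: eqP pr => // -> ; rewrite ltNge qp.
Qed.
End GradedAlgebra.

(** * Approximate units *)

Section Seminorms.
Variables (k : comPzRingType) (U : acs_alg k).
Implicit Types (u v x y : U) (j m n p q : int).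

Lemma NL_mul_neg n j x y : y \in homog U (- j) -> (n <= j)%R -> x * y \in NL U n.
Proof.
move=> hy nj; apply: NL_span; apply/asboolP; exists [:: (x, y)].
have hy' : y \in deg_le (- n) by apply: homog_deg_le hy _; rewrite lerN2.
by rewrite big_seq1; split=> // xy; rewrite mem_seq1 => /eqP ->.
Qed.
Lemma NL_neg n j y : y \in homog U (- j) -> (n <= j)%R -> y \in NL U n.
Proof. by move=> hy nj; rewrite -[y]mul1r; apply: NL_mul_neg nj. Qed.
Lemma NL_all n u : (n <= 0)%R -> u \in NL U n.
Proof.
by move=> n0; rewrite -[u]mulr1; apply: NL_mul_neg n0; rewrite oppr0 homog1.
Qed.
Lemma NR_pos n j y : y \in homog U j -> (n <= j)%R -> y \in NR_pred U n.
Proof. by move=> hy nj; rewrite (NR_homog _ hy) NL_all // subr_le0. Qed.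
Lemma NLM0 n x v : x \in NL U n -> v \in homog U 0 -> x * v \in NL U n.
Proof. by move=> hx hv; rewrite -[n]subr0; apply: NL_right. Qed.
Lemma NR0 n u : u \in homog U 0 -> (u \in NR_pred U n) = (u \in NL U n).
Proof. by move=> hu; rewrite (NR_homog _ hu) subr0. Qed.
Lemma NR_hc n p u : u \in NR_pred U n -> hc p u \in NR_pred U n.
Proof. by move=> /NRP h; rewrite (NR_homog _ (homog_hc p u)); apply: h. Qed.

Definition factors n p x y :=
  exists j, [/\ (n <= j)%R, x \in homog U (p + j) & y \in homog U (- j)].

Lemma NL_factor n p m u : u \in NL U n -> u \in homog U p ->
  exists v, psum (factors n p) v /\ u - v \in NL U m.
Proof.
move=> hu hp; case: (lerP n m) => nm; last first.
  by exists 0; split; [apply: psum0 | rewrite subr0; apply: NL_decr (ltW nm) _ hu].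
have [v [w [/asboolP[s [hs vE]] hv hw _ ->]]] := NL_dense nm hu hp.
exists v; rewrite addrAC subrr add0r; split=> //.
rewrite -(homogP _ _ hv) vE hc_sum big_seq.
elim/big_rec: _ => [|xy w' /hs/asboolP hy hw']; first exact: psum0.
apply: psumD => //; have [t [_ yE]] := hc_dec xy.2.
rewrite yE mulr_sumr hc_sum; apply: psum_bigD => q.
case: (lerP q (- n)) => qn; last by rewrite hy // mulr0 (additive0 (hcD p)); apply: psum0.
rewrite (hcMr _ _ (homog_hc q _)); apply: psum_mul; exists (- q).
by rewrite opprK !homog_hc lerNr.
Qed.

Lemma NL_lead n p u : u \in NL U n -> u \in homog U p -> exists v,
  psum (fun x y => x \in homog U (p + n) /\ y \in homog U (- n)) v /\
  u - v \in NL U (n + 1).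
Proof.
move=> hu hp; have [v [hv uv]] := NL_factor (n + 1) hu hp.
suff [w [hw vw]] : exists w,
    psum (fun x y => x \in homog U (p + n) /\ y \in homog U (- n)) w /\
    v - w \in NL U (n + 1).
  by exists w; split=> //; rewrite -(subrKA v) rpredD.
elim: hv => {v uv} [|x y v [j [nj hx hy]] _ [w [hw vw]]].
  by exists 0; split; [apply: psum0 | rewrite subrr rpred0].
have [nj'|jn] := eqVneq j n.
  exists (x * y + w); split; last by rewrite opprD addrACA subrr add0r.
  by rewrite -nj'; rewrite nj' in hx hy *; apply: psum_cons.
exists w; split=> //; rewrite -addrA rpredD //; apply: (NL_mul_neg _ hy).
by rewrite lezD1 lt_neqAle eq_sym jn.
Qed.

Definition lunit n m (e : U) := [/\ e \in homog U 0, e \in NL U n &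
  forall x, x \in NL U n -> x - x * e \in NL U m].
Definition runit n m (e : U) := [/\ e \in homog U 0, e \in NR_pred U n &
  forall x, x \in NR_pred U n -> x - e * x \in NR_pred U m].

Lemma lunit_crit n e : e \in homog U 0 -> e \in NL U n ->
  (forall b, b \in homog U (- n) -> b - b * e \in NL U (n + 1)) ->
  lunit n (n + 1) e.
Proof.
move=> e0 en h; split=> // x hx; have [t [_ ->]] := hc_dec x.
rewrite mulr_suml -sumrB; apply: rpred_sum => p _.
have [v [hv xv]] := NL_factor (n + 1) (NL_hc p hx) (homog_hc p x).
rewrite -(subrK v (hc p x)) mulrDl opprD addrACA rpredD //.
  by rewrite rpredB // NLM0.
elim: hv => {xv v} [|y z v [j [nj hy hz]] _ ih]; first by rewrite mul0r subrr rpred0.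
rewrite mulrDl opprD addrACA rpredD // -mulrA -mulrBr; apply: NL_left.
have [jn|jn] := eqVneq j n; first by apply: h; rewrite -jn.
have hz' : z \in NL U (n + 1).
  by apply: (NL_neg hz); rewrite lezD1 lt_neqAle eq_sym jn.
by rewrite rpredB // NLM0.
Qed.

Lemma lunit_comp n m l e f : (n <= m)%R -> lunit n m e -> lunit m l f ->
  lunit n l (e + f - e * f).
Proof.
move=> nm [e0 en he] [f0 fm hf].
have fn : f \in NL U n by apply: NL_decr fm.
split; first by rewrite rpredB ?rpredD ?homogM0l.
  by rewrite rpredB ?rpredD // NL_left.
move=> x hx; have -> : x - x * (e + f - e * f) = (x - x * e) - (x - x * e) * f.
  by rewrite mulrBr mulrDr mulrBl mulrA !opprB !opprD !addrA; congr (_ + _); rewrite addrAC.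
exact/hf/he.
Qed.

Lemma lunit_le n m m' e : (m' <= m)%R -> lunit n m e -> lunit n m' e.
Proof. by move=> mm' [h1 h2 h]; split=> // x /h; apply: NL_decr. Qed.

Lemma lunit_all : (forall n : nat, exists e, lunit n%:Z (n%:Z + 1) e) ->
  forall (n : nat) m, exists e, lunit n%:Z m e.
Proof.
move=> h n m; have [mn|nm] := lerP m n.
  exists 0; split; rewrite ?rpred0 // => x; rewrite mulr0 subr0; exact: NL_decr.
suff {nm} H d : exists e, lunit n%:Z (n + d)%:Z e.
  by have [e he] := H `|m - n%:Z|%N; exists e; apply: lunit_le he; lia.
elim: d => [|d [e he]].
  exists 0; rewrite addn0; split; rewrite ?rpred0 // => x; by rewrite mulr0 subr0.
have [f hf] := h (n + d)%N; exists (e + f - e * f).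
apply: lunit_comp he _; first by lia.
by rewrite addnS -addn1 PoszD.
Qed.
End Seminorms.

(** * The opposite algebra *)

Section Opposite.
Variable k : comPzRingType.

Definition op_str (A : kalg k) (a : k) : (A : pzRingType)^c := kstr A a.

Lemma op_str_zmod (A : kalg k) : zmod_morphism (@op_str A).
Proof. exact: (raddfB (kstr A)). Qed.
Lemma op_str_monoid (A : kalg k) : monoid_morphism (@op_str A).
Proof.
split; first exact: (rmorph1 (kstr A)).
by move=> a b; rewrite /op_str [a * b]mulrC (rmorphM (kstr A)).
Qed.
HB.instance Definition _ (A : kalg k) :=
  GRing.isZmodMorphism.Build k ((A : pzRingType)^c) (@op_str A) (op_str_zmod A).
HB.instance Definition _ (A : kalg k) :=
  GRing.isMonoidMorphism.Build k ((A : pzRingType)^c) (@op_str A) (op_str_monoid A).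

Definition op_alg (A : kalg k) : kalg k :=
  @KAlg k ((A : pzRingType)^c) (@op_str A) (fun a x => esym (@kstrC k A a x)).

Variable U : acs_alg k.

Program Definition op_gr : graded_alg k :=
  @GradedAlg k (op_alg U) (fun p (u : U) => hc (- p) u) _ _ _ _ _ _.
Next Obligation. exact: hcD. Qed.
Next Obligation.
rewrite -[LHS]/(hc (- p) ((u : U) * kstr U a)).
by rewrite -[RHS]/((hc (- p) u : U) * kstr U a) -!kstrC hck.
Qed.
Next Obligation. by rewrite hc_hc eqr_opp. Qed.
Next Obligation.
have [s [us uE]] := hc_dec (u : U); exists [seq - p | p <- s]; split.
  by rewrite map_inj_uniq //; apply: oppr_inj.
by rewrite big_map uE; under [RHS]eq_bigr do rewrite opprK -uE.
Qed.
Next Obligation. by rewrite oppr0 hc1. Qed.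
Next Obligation. by rewrite opprD addrC; apply: hcM. Qed.
End Opposite.

Section OppositeSeminorm.
Variables (k : comPzRingType) (U : acs_alg k).

Lemma op_span n : {subset left_span_le (op_gr U) (- n) <= NR_pred U n}.
Proof.
move=> u /asboolP[s [hs ->]]; rewrite big_seq; apply: rpred_sum => -[x y] /hs/asboolP /= hy.
rewrite -[_ * _]/((y : U) * (x : U)); apply: NR_right; have [t [_ ->]] := hc_dec (y : U).
apply: rpred_sum => q _; have [nq|qn] := lerP n q; first exact: NR_pos (homog_hc q _) nq.
have := hy (- q); rewrite ltrN2 => /(_ qn) /=; rewrite opprK => ->; exact: rpred0.
Qed.

Lemma op_dense n m p u : (n <= m)%R -> u \in NR_pred U n -> u \in homog (op_gr U) p ->
  exists v w : op_gr U, [/\ v \in left_span_le (op_gr U) (- n), v \in homog (op_gr U) p,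
    w \in NR_pred U m, w \in homog (op_gr U) p & u = v + w].
Proof.
move=> nm hu hp; have hp' : (u : U) \in homog U (- p) by [].
have hu' : u \in NL U (n + p) by rewrite (NR_homog _ hp') opprK in hu.
have [v [hv uv]] := NL_factor (m + p) hu' hp'.
have vp : v \in homog U (- p).
  move: hv; apply: psum_closed => x y [j [_ hx hy]].
  by rewrite -[- p](addrK j); apply: homogM.
exists v, (u - v); split=> //; last 3 first.
- by rewrite (@NR_homog _ _ _ (- p)) ?opprK // rpredB.
- by apply/homogP; rewrite /= hcB; congr (_ - _); apply/eqP.
- by rewrite addrC subrK.
have [s [hs ->]] := psum_seq hv; apply/asboolP.
exists [seq (xy.2, xy.1) | xy <- s]; rewrite big_map; split=> // _ /mapP[xy /hs[j [nj hx _]] ->].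
apply/asboolP => q nq /=; rewrite (hc_homog _ hx); case: eqP => // qE.
by move: nq nj; rewrite -(opprK q) qE; lia.
Qed.

Program Definition acs_op : acs_alg k :=
  @AcsAlg k (op_gr U) (fun n => NR_pred U n : zmodClosed U) _ _ _ (@op_span) (@op_dense) _ _.
Next Obligation. exact: (@NR_right k U). Qed.
Next Obligation. exact: NR_hc. Qed.
Next Obligation. exact: NR_decr. Qed.
Next Obligation. exact: (@NR_left k U n (- q) (v : U) (u : U)). Qed.
Next Obligation. exact: (@NR_right k U n (u : U) (v : U)). Qed.

Lemma op_homog p (u : U) : ((u : acs_op) \in homog acs_op p) = (u \in homog U (- p)).
Proof. by []. Qed.

Lemma op_NL n (u : U) : ((u : acs_op) \in NL acs_op n) = (u \in NR_pred U n).
Proof. by []. Qed.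

Lemma op_NR n (u : U) : ((u : acs_op) \in NR_pred acs_op n) = (u \in NL U n).
Proof.
apply/NRP/idP => [h|h p]; last first.
  rewrite op_NL (NR_homog _ (homog_hc (- p) u)) opprK subrK; exact: NL_hc.
have [t [_ ->]] := hc_dec u; apply: rpred_sum => p _.
have := h (- p); rewrite op_NL -[hc _ _]/(hc (- - p) u) !opprK.
by rewrite (NR_homog _ (homog_hc p u)) addrK.
Qed.

Lemma op_unit_l n m (e : U) : lunit (U := acs_op) n m e <-> runit (U := U) n m e.
Proof.
by split=> -[h1 h2 h3]; split; rewrite ?op_homog ?oppr0 // in h1 *.
Qed.
Lemma op_unit_r n m (e : U) : runit (U := acs_op) n m e <-> lunit (U := U) n m e.
Proof.
split=> -[h1 h2 h3]; split; rewrite ?op_homog ?oppr0 // in h1 *; rewrite ?op_NR // in h2 *.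
  by move=> x; have := h3 x; rewrite !op_NR.
by move=> x; have := h3 x; rewrite !op_NR.
Qed.
End OppositeSeminorm.

Section TwoSidedUnits.
Variables (k : comPzRingType) (U : acs_alg k).
Implicit Types (u v x y a b e f : U) (j m n p q : int).

Lemma runit_crit n e : e \in homog U 0 -> e \in NR_pred U n ->
  (forall a, a \in homog U n -> a - e * a \in NR_pred U (n + 1)) ->
  runit n (n + 1) e.
Proof.
move=> e0 en h; apply/op_unit_l; apply: (@lunit_crit _ (acs_op U)) => //.
by move=> b; rewrite op_homog opprK; apply: h.
Qed.

Lemma runit_all : (forall n : nat, exists e : U, runit n%:Z (n%:Z + 1) e) ->
  forall (n : nat) m, exists e : U, runit n%:Z m e.
Proof.
move=> h n m; have [e /op_unit_l he] : exists e : U, lunit (U := acs_op U) n%:Z m e.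
  by apply: (@lunit_all _ (acs_op U)) => i; have [e he] := h i; exists e; apply/op_unit_l.
by exists e.
Qed.

Lemma unit_lr n m m' e f : lunit n m e -> runit n m f -> f - e \in NL U m.
Proof.
move=> [e0 en he] [f0 fn hf]; rewrite NR0 // in fn.
have h1 : f - f * e \in NL U m by apply: he.
have h2 : e - f * e \in NL U m.
  have hh : e - f * e \in homog U 0 by rewrite rpredB ?homogM0l.
  by rewrite -(NR0 _ hh); apply: hf; rewrite NR0.
have -> : f - e = (f - f * e) - (e - f * e) by rewrite opprB addrA subrK.
exact: rpredB.
Qed.

Definition unit2 n m e := lunit n m e /\ runit n m e.

Lemma unit2_exists n m : (exists e, lunit n m e) -> (exists f, runit n m f) ->
  exists e, unit2 n m e.
Proof.
move=> [e he] [f hf]; exists e; split=> //; have ef := unit_lr 0 he hf.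
case: he hf => e0 en he [f0 fn hf]; split=> //; first by rewrite NR0.
move=> x hx; rewrite -(subrKA (f * x)) rpredD ?hf //.
by rewrite -mulrBl; apply: NR_right; rewrite NR0 // rpredB.
Qed.

Lemma unit2_uniq n m m' e e' : (m <= m')%R -> unit2 n m e -> unit2 n m' e' ->
  e' - e \in NL U m.
Proof.
move=> mm' [he _] [_ [h1 h2 h3]]; apply: (unit_lr 0 he); split=> // x /h3.
exact: NR_decr.
Qed.

Definition rank_sum n := psum (fun x y : U => x \in homog U n /\ y \in homog U (- n)).

Lemma rank_sum_homog n u : rank_sum n u -> u \in homog U 0.
Proof. by apply: psum_closed => x y [hx hy]; apply: homogMN0 hx hy. Qed.
Lemma rank_sum_NL n u : rank_sum n u -> u \in NL U n.
Proof. by apply: psum_closed => x y [_ hy]; apply: NL_mul_neg hy _. Qed.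

Definition sic_at n := exists u, [/\ rank_sum n u,
  forall a, a \in homog U n -> a - u * a \in NL U 1 &
  forall b, b \in homog U (- n) -> b - b * u \in NR_pred U 1].

Lemma sic_at_units n : sic_at n ->
  (exists e, lunit n (n + 1) e) /\ (exists e, runit n (n + 1) e).
Proof.
move=> [u [hu ha hb]]; have u0 := rank_sum_homog hu; have un := rank_sum_NL hu.
split; exists u; [apply: lunit_crit | apply: runit_crit]; rewrite ?NR0 //.
- move=> b bn; have hh : b - b * u \in homog U (- n) by rewrite rpredB ?homogM0r.
  by have := hb b bn; rewrite (NR_homog _ hh) opprK [1 + n]addrC.
- move=> a an; have hh : a - u * a \in homog U n by rewrite rpredB ?homogM0l.
  by rewrite (NR_homog _ hh) addrAC subrr add0r; apply: ha.
Qed.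

Lemma units_sic_at n : (exists e, lunit n (n + 1) e) ->
  (exists e, runit n (n + 1) e) -> sic_at n.
Proof.
move=> hl hr; have [e [[e0 en he] [_ _ he']]] := unit2_exists hl hr.
have [u [hu eu]] := NL_lead en e0; rewrite add0r in hu.
exists u; split=> //.
- move=> a an; rewrite -(subrKA (e * a)) -mulrBl rpredD //.
    have hh : a - e * a \in homog U n by rewrite rpredB ?homogM0l.
    have := he' a (NR_pos an (lexx n)); rewrite (NR_homog _ hh).
    by rewrite addrAC subrr add0r.
  by move: (NL_right eu an); rewrite addrAC subrr add0r.
- move=> b bn; have hh : b - b * u \in homog U (- n).
    by rewrite rpredB // homogM0r // (rank_sum_homog hu).
  rewrite (NR_homog _ hh) opprK [1 + n]addrC -(subrKA (b * e)) -mulrBr rpredD //; last exact: NL_left.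
  by apply: he; apply: NL_neg bn _.
Qed.

Definition all_unit_l := forall (n : nat) m, exists e, lunit n%:Z m e.
Definition all_unit_r := forall (n : nat) m, exists e, runit n%:Z m e.

Lemma sic_units : (forall n : nat, sic_at n%:Z) <-> all_unit_l /\ all_unit_r.
Proof.
split=> [h|[hl hr] n]; last exact: units_sic_at.
by split; [apply: lunit_all | apply: runit_all] => n; have [] := sic_at_units (h n).
Qed.
End TwoSidedUnits.

(** * The strong identity condition *)

Section StrongIdentityCondition.
Variables (k : comPzRingType) (U : acs_alg k).

Lemma mta_comp_rep p q (t : mta U) : t \in @mta_comp k U p q ->
  exists s : seq (U * U),
    (forall xy, xy \in s -> xy.1 \in homog U p /\ xy.2 \in homog U q) /\
    t = \sum_(xy <- s) tmk (Lcls 0 xy.1) (Rcls 0 xy.2).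
Proof.
move=> /tens_spanP[s [hs ->]]; elim: s hs => [|[x y] s ih] hs.
  by exists [::]; rewrite !big_nil.
have [xy h|s' [hs' sE]] := ih; first by apply: hs; rewrite inE h orbT.
have [/LgrP[a ha xE] /RgrP[b hb yE]] := hs (x, y) (mem_head _ _).
exists ((a, b) :: s'); rewrite !big_cons sE xE yE; split=> // xy.
by rewrite inE => /predU1P[->|/hs'].
Qed.

Lemma star_cls n (x y a b : U) : y \in homog U (- n) -> a \in homog U n ->
  star (tmk (Lcls 0 x) (Rcls 0 y)) (tmk (Lcls 0 a) (Rcls 0 b)) =
    tmk (Lcls 0 (x * y * a)) (Rcls 0 b) /\
  star (tmk (Lcls 0 x) (Rcls 0 y)) (tmk (Lcls 0 a) (Rcls 0 b)) =
    tmk (Lcls 0 x) (Rcls 0 (y * a * b)).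
Proof.
move=> hy ha; rewrite starE circE.
have [/(_ (addNr n))[h ->] _] := mpairE hy ha.
by split; [rewrite -tmkbal Lcls_ract mulrA | rewrite Rcls_lact].
Qed.

Lemma star_suml (I : Type) (s : seq I) (F : I -> mta U) t :
  star (\sum_(i <- s) F i) t = \sum_(i <- s) star (F i) t.
Proof. exact: (additive_sum _ _ (fun x y => starDl x y t)). Qed.
Lemma star_sumr (I : Type) (s : seq I) (F : I -> mta U) t :
  star t (\sum_(i <- s) F i) = \sum_(i <- s) star t (F i).
Proof. exact: (additive_sum _ _ (starDr t)). Qed.

Lemma Lcls_sum n (I : Type) (s : seq I) (F : I -> U) :
  Lcls n (\sum_(i <- s) F i) = \sum_(i <- s) Lcls n (F i).
Proof. by apply: (additive_sum _ _ (fun u v => esym (LclsD n u v))). Qed.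
Lemma Rcls_sum n (I : Type) (s : seq I) (F : I -> U) :
  Rcls n (\sum_(i <- s) F i) = \sum_(i <- s) Rcls n (F i).
Proof. by apply: (additive_sum _ _ (fun u v => esym (RclsD n u v))). Qed.

Lemma Lcls_inj_mta (u v : U) :
  tmk (Lcls 0 u) (Rcls 0 1) = tmk (Lcls 0 v) (Rcls 0 1) -> Lcls 0 u = Lcls 0 v.
Proof.
have bal : balanced (fun (x : Lmod U 0) (y : Rmod U 0) => x <* mpair y (Lcls 0 1)).
  have [pDl _ _] := @mpair_bal k U; split=> [x x' y|x y y'|x r y].
  - exact: ractDl.
  - by rewrite pDl ractDr.
  - by rewrite -!circE circ_l ractA.
move/(congr1 (tlift (fun (x : Lmod U 0) (y : Rmod U 0) => x <* mpair y (Lcls 0 1)))).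
rewrite !(tlift_tmk bal) mpair_cls !Lcls_ract mulr1 hc1.
by rewrite !mulr1.
Qed.

Lemma Rcls_inj_mta (u v : U) :
  tmk (Lcls 0 1) (Rcls 0 u) = tmk (Lcls 0 1) (Rcls 0 v) -> Rcls 0 u = Rcls 0 v.
Proof.
have bal : balanced (fun (x : Lmod U 0) (y : Rmod U 0) => mpair (Rcls 0 1) x *> y).
  have [_ pDr _] := @mpair_bal k U; split=> [x x' y|x y y'|x r y].
  - by rewrite pDr lactDl.
  - exact: lactDr.
  - by rewrite -!circE circ_r lactA.
move/(congr1 (tlift (fun (x : Lmod U 0) (y : Rmod U 0) => mpair (Rcls 0 1) x *> y))).
rewrite !(tlift_tmk bal) mpair_cls !Rcls_lact mulr1 hc1.
by rewrite !mul1r.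
Qed.

Lemma mta_comp_mk p q (a b : U) : a \in homog U p -> b \in homog U q ->
  tmk (Lcls 0 a) (Rcls 0 b) \in @mta_comp k U p q.
Proof.
move=> ha hb; apply/tens_spanP; exists [:: (Lcls 0 a, Rcls 0 b)].
rewrite big_seq1; split=> // xy; rewrite mem_seq1 => /eqP ->; split.
  by apply/LgrP; exists a.
by apply/RgrP; exists b.
Qed.

Lemma SIC_sic_at : SIC U <-> forall n : nat, sic_at U n%:Z.
Proof.
split=> [[one [h1 h2]] n|h].
  have [s [hs sE]] := mta_comp_rep (h1 n).
  exists (\sum_(xy <- s) xy.1 * xy.2); split; first exact: seq_psum.
  - move=> a ha; have [] := h2 n 0%N _ (mta_comp_mk ha (homog1 U)).
    rewrite sE star_suml big_seq => + _.
    under eq_bigr => xy hxy do rewrite (star_cls _ _ (hs _ hxy).2 ha).1.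
    rewrite -big_seq -(additive_sum _ _ (fun u v => tmkDl u v _)) -Lcls_sum -mulr_suml.
    by move/Lcls_inj_mta/esym/LclsE.
  - move=> b hb; have [_] := h2 0%N n _ (mta_comp_mk (homog1 U) hb).
    rewrite sE star_sumr big_seq.
    under eq_bigr => xy hxy do rewrite (star_cls _ _ hb (hs _ hxy).1).2 -mulrA.
    rewrite -big_seq -(additive_sum _ _ (tmkDr _)) -Rcls_sum -mulr_sumr.
    by move/Rcls_inj_mta/esym/RclsE.
have {}h n : exists t : mta U, t \in @mta_comp k U n%:Z (- n%:Z) /\
  ((forall a, a \in homog U n%:Z -> forall b,
      star t (tmk (Lcls 0 a) (Rcls 0 b)) = tmk (Lcls 0 a) (Rcls 0 b)) /\
   (forall b, b \in homog U (- n%:Z) -> forall a,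
      star (tmk (Lcls 0 a) (Rcls 0 b)) t = tmk (Lcls 0 a) (Rcls 0 b))).
  have [u [/psum_seq[s [hs uE]] hl hr]] := h n.
  exists (\sum_(xy <- s) tmk (Lcls 0 xy.1) (Rcls 0 xy.2)); split.
    apply/tens_spanP; exists [seq (Lcls 0 xy.1, Rcls 0 xy.2) | xy <- s].
    rewrite big_map; split=> // _ /mapP[xy /hs[h1 h2] ->]; split.
      by apply/LgrP; exists xy.1.
    by apply/RgrP; exists xy.2.
  split=> [a ha b|b hb a].
    rewrite star_suml big_seq.
    under eq_bigr => xy hxy do rewrite (star_cls _ _ (hs _ hxy).2 ha).1.
    rewrite -big_seq -(additive_sum _ _ (fun u v => tmkDl u v _)) -Lcls_sum -mulr_suml.
    by rewrite -uE; congr tmk; apply/esym/LclsE/hl.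
  rewrite star_sumr big_seq.
  under eq_bigr => xy hxy do rewrite (star_cls _ _ hb (hs _ hxy).1).2 -mulrA.
  rewrite -big_seq -(additive_sum _ _ (tmkDr _)) -Rcls_sum -mulr_sumr.
  by rewrite -uE; congr tmk; apply/esym/RclsE/hr.
have [one hone] := choice h; exists one; split=> [n|n m a]; first by have [] := hone n.
move=> /mta_comp_rep[s [hs ->]]; split.
  rewrite star_sumr; apply: eq_big_seq => xy /hs[h1 h2].
  by have [_ [hl _]] := hone n; apply: hl.
rewrite star_suml; apply: eq_big_seq => xy /hs[h1 h2].
by have [_ [_ hr]] := hone m; apply: hr.
Qed.
End StrongIdentityCondition.

(** * Identity expansions *)

Section HatTheory.
Variables (k : comPzRingType) (U : acs_alg k).
Implicit Types (m n p : int).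

Lemma hfamB p (x y : hat U p) n : hfam (x - y) n = hfam x n - hfam y n.
Proof. by []. Qed.

Lemma hmul_eq0 p q (x : hat U p) (y : hat U q) : hmul x y = 0 <->
  forall n u v, u \in homog U p -> v \in homog U q ->
    hfam x (n + q) = icls (n + q) u -> hfam y n = icls n v -> u * v \in NL U n.
Proof.
split=> [h n u v hu hv xu yv|h].
  have : hfam (hmul x y) n = icls n (u * v) by apply: hmul_famE.
  by rewrite h -[LHS]/(icls n 0) => /esym/iclsE; rewrite subr0.
apply: hat_eq => n; have [u hu xu] := hfam_homog x (n + q).
have [v hv yv] := hfam_homog y n.
rewrite -[LHS]/(hmul_fam x y n) (hmul_famE hu hv xu yv) -[RHS]/(icls n 0).
by apply/iclsE; rewrite subr0; apply: h xu yv.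
Qed.

Lemma hat_cvg_unique (s : nat -> hat U 0) (l l' : hat U 0) :
  hat_cvg s l -> hat_cvg s l' -> l = l'.
Proof.
move=> h h'; apply: hat_eq => n; have [K hK] := h n; have [K' hK'] := h' n.
have := hK _ (leq_maxl K K'); have := hK' _ (leq_maxr K K').
rewrite /hatker !hfamB => /subr0_eq <- /subr0_eq <-; exact: erefl.
Qed.
End HatTheory.

Section UnitsToExpansion.
Variables (k : comPzRingType) (U : acs_alg k) (eps : nat -> int -> U).
Hypothesis heps : forall n m, unit2 n%:Z m (eps n m).
Implicit Types (i j M N : nat) (m n p : int).

Let eps0 i m : eps i m \in homog U 0. Proof. by have [[]] := heps i m. Qed.
Let epsN i m : eps i m \in NL U i%:Z. Proof. by have [[]] := heps i m. Qed.
Let epsl i m x : x \in NL U i%:Z -> x - x * eps i m \in NL U m.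
Proof. by have [[_ _ h] _] := heps i m; apply: h. Qed.
Let epsr i m x : x \in NR_pred U i%:Z -> x - eps i m * x \in NR_pred U m.
Proof. by have [_ [_ _ h]] := heps i m; apply: h. Qed.

Program Definition ehat i : hat U 0 := @Hat k U 0 (fun m => icls m (eps i m)) _ _.
Next Obligation. by exists (eps i n). Qed.
Next Obligation.
apply/iclsE; move/iclsE: H0 => H0.
rewrite -(subrKA (eps i n)) rpredD //; last exact: NL_decr H0.
by rewrite -opprB rpredN; apply: unit2_uniq H (heps i m) (heps i n).
Qed.

Let e i : hat U 0 := ehat i - ehat i.+1.

Let esum M K : (M <= K)%N -> \sum_(M <= i < K) e i = ehat M - ehat K.
Proof.
move=> MK; rewrite -[RHS]opprB -(telescope_sumr _ MK) -sumrN.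
by apply: eq_bigr => i _; rewrite opprB.
Qed.

Let ehat0 : ehat 0 = hat1 U.
Proof.
apply: hat_eq => n /=; apply/iclsE; rewrite -opprB rpredN.
by rewrite -[eps 0 n]mul1r; apply: epsl; apply: NL_all.
Qed.

Let ecvg M : hat_cvg (fun K => \sum_(M <= i < K) e i) (ehat M).
Proof.
move=> n; exists (maxn M `|n|) => j hj; rewrite esum; last first.
  exact: leq_trans (leq_maxl _ _) hj.
rewrite /hatker addrAC subrr add0r -[LHS]/(- icls n (eps j n)) iclsN -(icls0 U n).
apply/iclsE; rewrite subr0 rpredN; apply: NL_decr (epsN j n).
by have := leq_trans (leq_maxr _ _) hj; lia.
Qed.

Let tailE n M : tail_in e n M <-> eps M n \in NL U n.
Proof.
have hE : hatker n (ehat M) <-> eps M n \in NL U n.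
  rewrite /hatker -[hfam _ _]/(icls n (eps M n)) -(icls0 U n).
  by rewrite iclsE subr0.
split=> [[l hl]|h]; first by rewrite -(hat_cvg_unique (@ecvg M) hl) hE.
by exists (ehat M); [apply: ecvg | apply/hE].
Qed.

Let eps_mul i j n : (i <= j)%N ->
  eps j n - eps i n * eps j n \in NL U n /\ eps j n - eps j n * eps i n \in NL U n.
Proof.
move=> ij; have hj : eps j n \in NL U i%:Z by apply: NL_decr (epsN j n); lia.
split; last exact: epsl.
have hh : eps j n - eps i n * eps j n \in homog U 0 by rewrite rpredB ?homogM0l.
by rewrite -(NR0 _ hh); apply: epsr; rewrite NR0.
Qed.

Let eps_orth i j n : (i < j)%N ->
  (eps i n - eps i.+1 n) * (eps j n - eps j.+1 n) \in NL U n /\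
  (eps j n - eps j.+1 n) * (eps i n - eps i.+1 n) \in NL U n.
Proof.
move=> ij.
have E (a c d : U) : a - c - (a - d) = d - c by rewrite opprB addrC subrKA.
have F (a b c d : U) : a - b - (c - d) = a - c - (b - d).
  by rewrite !opprD !opprK addrACA.
have h (x x' a b : U) : a - x * a \in NL U n -> b - x * b \in NL U n ->
    a - x' * a \in NL U n -> b - x' * b \in NL U n -> (x - x') * (a - b) \in NL U n.
  move=> h1 h2 h3 h4; rewrite mulrBl !mulrBr F.
  by rewrite -(E a (x' * a)) -(E b (x' * b)); apply: rpredB; apply: rpredB.
have h' (x x' a b : U) : a - a * x \in NL U n -> b - b * x \in NL U n ->
    a - a * x' \in NL U n -> b - b * x' \in NL U n -> (a - b) * (x - x') \in NL U n.
  move=> h1 h2 h3 h4; rewrite mulrBl !mulrBr.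
  by rewrite -(E a (a * x')) -(E b (b * x')); apply: rpredB; apply: rpredB.
have i1 := eps_mul n (ltnW ij); have i2 := eps_mul n ij.
have i3 := eps_mul n (leq_trans (ltnW ij) (leqnSn j)).
have i4 := eps_mul n (leq_trans ij (leqnSn j)).
by split; [apply: h | apply: h']; tauto.
Qed.

Lemma expansion_of_units : exists e, strong_identity_expansion (U := U) e.
Proof.
have P (a b u v : U) n : u \in homog U 0 -> v \in homog U 0 ->
    u - a \in NL U n -> v - b \in NL U n -> a * b \in NL U n -> u * v \in NL U n.
  move=> hu hv ua vb ab.
  have -> : u * v = (u - a) * v + (a * (v - b) + a * b).
    by rewrite mulrBl mulrBr !subrK.
  apply: rpredD; first exact: NLM0.
  by apply: rpredD => //; apply: NL_left.
exists e; split.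
- by rewrite -ehat0; apply: ecvg.
- move=> i j /eqP; rewrite neq_ltn => ij; apply/hmul_eq0 => n u v hu hv.
  rewrite addr0 !hfamB -![hfam (ehat _) n]/(icls n _) !iclsN !iclsD.
  move=> /esym/iclsE xu /esym/iclsE yv; apply: P hu hv xu yv _.
  by case/orP: ij => ij; have [h1 h2] := eps_orth n ij.
move=> n; have ex : exists N, `[< tail_in e n%:Z N >].
  by exists n; apply/asboolP/tailE/epsN.
have [N /asboolP hN hmin] := ex_minnP ex.
have Nn : (N <= n)%N by apply/hmin/asboolP/tailE/epsN.
exists N; first by split=> // M hM; apply: hmin; apply/asboolP.
have f0 m : 1 - eps N m \in homog U 0 by rewrite rpredB ?homog1.
rewrite esum // ehat0; split=> x; apply/hmul_eq0 => m u v hu hv.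
  rewrite addr0 hfamB -[hfam (hat1 U) m]/(icls m 1) -[hfam (ehat N) m]/(icls m (eps N m)) iclsN.
  rewrite iclsD => _ /esym/iclsE hv'.
  rewrite -(subrK (1 - eps N m) v) mulrDr; apply: rpredD; first exact: NL_left.
  rewrite mulrBr mulr1.
  by apply: epsl; apply: NL_neg hu _; rewrite lez_nat.
rewrite hfamB -[hfam (hat1 U) (m + n%:Z)]/(icls _ 1) -[hfam (ehat N) (m + n%:Z)]/(icls _ (eps N (m + n%:Z))) iclsN iclsD.
move=> /esym/iclsE hu' _.
rewrite -(subrK (1 - eps N (m + n%:Z)) u) mulrDl; apply: rpredD.
  by move: (NL_right hu' hv); rewrite addrK.
rewrite mulrBl mul1r; have hh : v - eps N (m + n%:Z) * v \in homog U n%:Z.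
  by rewrite rpredB ?homogM0l.
have := epsr (m + n%:Z) (NR_pos hv (_ : N%:Z <= n%:Z)%R).
by rewrite lez_nat (NR_homog _ hh) addrK => /(_ Nn).
Qed.
End UnitsToExpansion.

Section ExpansionToUnits.
Variables (k : comPzRingType) (U : acs_alg k).

Lemma units_of_expansion (e : nat -> hat U 0) : strong_identity_expansion e ->
  forall n : nat, (exists f : U, lunit n%:Z (n%:Z + 1) f) /\ (exists f : U, runit n%:Z (n%:Z + 1) f).
Proof.
move=> [ecvg _ esi] n; have [N [[l hl ln] _] [el er]] := esi n.
set g := \sum_(0 <= i < N) e i in el er.
have gl : g + l = hat1 U.
  apply: (hat_cvg_unique (s := fun K => \sum_(0 <= i < K) e i)) => // m.
  have [K hK] := hl m; exists (maxn N K) => j hj.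
  rewrite (big_cat_nat (n := N)) //=; last exact: leq_trans (leq_maxl _ _) hj.
  rewrite -/g opprD addrACA subrr add0r; apply: hK.
  exact: leq_trans (leq_maxr _ _) hj.
have lam m : exists2 f, f \in homog U 0 & hfam l m = icls m f /\ hfam g m = icls m (1 - f).
  have [f hf lf] := hfam_homog l m; exists f => //; split=> //.
  have -> : g = hat1 U - l by rewrite -gl addrK.
  by rewrite hfamB lf iclsN -[hfam _ m]/(icls m 1) iclsD.
have lamN m f : (n%:Z <= m)%R -> hfam l m = icls m f -> f \in NL U n%:Z.
  move=> nm hf; have := hfam_compat nm hf; rewrite ln -(icls0 U) => /esym/iclsE.
  by rewrite subr0.
split.
  have [f hf [lf gf]] := lam (n%:Z + 1); exists f; apply: lunit_crit => //.
    by apply: lamN lf; lia.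
  move=> b hb; have /hmul_eq0 H := el (hatc hb).
  rewrite -[X in X - _]mulr1 -mulrBr; apply: (H _ b (1 - f)) => //.
  by rewrite rpredB ?homog1.
have [f hf [lf gf]] := lam (1 + n%:Z); exists f; apply: runit_crit => //.
  by rewrite NR0 //; apply: lamN lf; lia.
move=> a ha; have /hmul_eq0 H := er (hatc ha).
have hh : a - f * a \in homog U n%:Z by rewrite rpredB ?homogM0l.
rewrite (NR_homog _ hh) addrAC subrr add0r.
rewrite -[X in X - _]mul1r -mulrBl; apply: (H _ (1 - f) a) => //.
by rewrite rpredB ?homog1.
Qed.
End ExpansionToUnits.

(** * Epimorphisms of bimodules *)

Section BimoduleMaps.
Variables (k : comPzRingType) (S R : kalg k).
Implicit Types X Y Z : bimod S R.

Definition bij_hom X Y (f : bhom X Y) :=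
  (forall x y, f x = f y -> x = y) /\ (forall y, exists x, f x = y).

Lemma bhom_inj X Y (f : bhom X Y) : (forall x, f x = 0 -> x = 0) ->
  forall x y, f x = f y -> x = y.
Proof.
move=> h x y xy; apply/subr0_eq/h.
by rewrite bfunD (additiveN (bfunD f)) xy subrr.
Qed.

Lemma iso_bij X Y (f : bhom X Y) : @is_iso (BMod S R) X Y f <-> bij_hom f.
Proof.
split=> [[g [gf fg]]|[fi fs]].
  have gfK x : g (f x) = x by rewrite -[LHS]/(bcomp g f x) [bcomp g f]gf.
  have fgK y : f (g y) = y by rewrite -[LHS]/(bcomp f g y) [bcomp f g]fg.
  by split=> [x y /(congr1 g)|y]; [rewrite !gfK | exists (g y)].
have [g gK] := choice fs.
have gD x y : g (x + y) = g x + g y by apply: fi; rewrite bfunD !gK.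
have gl s x : g (s *> x) = s *> g x by apply: fi; rewrite bfunl !gK.
have gr x r : g (x <* r) = g x <* r by apply: fi; rewrite bfunr !gK.
exists (BHom gD gl gr); split; apply: bhom_eq => x /=; last exact: gK.
by apply: fi; rewrite gK.
Qed.

Lemma bhom_surj_epi X Y (f : bhom X Y) : (forall y, exists x, f x = y) ->
  @epi (BMod S R) X Y f.
Proof.
move=> fs Z g h gh; apply: bhom_eq => y; have [x <-] := fs y.
by rewrite -[LHS]/(bcomp g f x) [bcomp g f]gh.
Qed.

Section Quotient.
Variables (X : bimod S R) (P : zmodClosed X).
Hypothesis Pl : forall s x, x \in P -> s *> x \in P.
Hypothesis Pr : forall x r, x \in P -> x <* r \in P.

Definition bquo := {ideal_quot P}.
HB.instance Definition _ := GRing.Zmodule.on bquo.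
HB.instance Definition _ := Quotient.on bquo.

Lemma bquoD (x y : X) : \pi_bquo x + \pi_bquo y = \pi_bquo (x + y).
Proof. by rewrite -(raddfD \pi_({ideal_quot P})). Qed.
Lemma bquo_repr (x : X) : repr (\pi_bquo x) - x \in P.
Proof. by apply/qpiE; rewrite reprK. Qed.

Definition bquo_lact (s : S) (x : bquo) : bquo := \pi_bquo (s *> repr x).
Definition bquo_ract (x : bquo) (r : R) : bquo := \pi_bquo (repr x <* r).

Lemma bquo_lactE s x : bquo_lact s (\pi_bquo x) = \pi_bquo (s *> x).
Proof. by apply/qpiE; rewrite -lactNr -lactDr; apply/Pl/bquo_repr. Qed.
Lemma bquo_ractE r x : bquo_ract (\pi_bquo x) r = \pi_bquo (x <* r).
Proof. by apply/qpiE; rewrite -ractNl -ractDl; apply/Pr/bquo_repr. Qed.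

Program Definition quo_bimod : bimod S R :=
  @Bimod k S R bquo bquo_lact bquo_ract _ _ _ _ _ _ _ _ _ _.
Next Obligation. by rewrite -[x]reprK !bquo_lactE bquoD lactDl. Qed.
Next Obligation. by rewrite -[x]reprK -[y]reprK bquoD !bquo_lactE bquoD lactDr. Qed.
Next Obligation.
by rewrite -[x]reprK (bquo_lactE t) (bquo_lactE s (t *> _)) bquo_lactE lactA.
Qed.
Next Obligation. by rewrite -[x]reprK bquo_lactE lact1. Qed.
Next Obligation. by rewrite -[x]reprK -[y]reprK bquoD !bquo_ractE bquoD ractDl. Qed.
Next Obligation. by rewrite -[x]reprK !bquo_ractE bquoD ractDr. Qed.
Next Obligation.
by rewrite -[x]reprK (bquo_ractE r) (bquo_ractE t (_ <* r)) bquo_ractE ractA.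
Qed.
Next Obligation. by rewrite -[x]reprK bquo_ractE ract1. Qed.
Next Obligation.
rewrite -[x]reprK (bquo_lactE s) (bquo_ractE r (s *> _)) (bquo_ractE r (repr x)).
by rewrite bquo_lactE lractA.
Qed.
Next Obligation. by rewrite -[x]reprK bquo_lactE bquo_ractE lractk. Qed.

Program Definition quo_proj : bhom X quo_bimod := @BHom k S R X quo_bimod (\pi_bquo) _ _ _.
Next Obligation. by rewrite -bquoD. Qed.
Next Obligation. exact/esym/bquo_lactE. Qed.
Next Obligation. exact/esym/bquo_ractE. Qed.

Lemma quo_proj_eq0 x : quo_proj x = 0 <-> x \in P.
Proof.
rewrite -(additive0 (bfunD quo_proj)) /= -[x in x \in _]subr0.
exact: qpiE.
Qed.
End Quotient.

Program Definition bzero X Y : bhom X Y := @BHom k S R X Y (fun=> 0) _ _ _.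
Next Obligation. by rewrite addr0. Qed.
Next Obligation. by rewrite lact0r. Qed.
Next Obligation. by rewrite ract0l. Qed.

Definition im_pred X Y (f : bhom X Y) : {pred Y} := fun y => `[< exists x, f x = y >].
Lemma im_closed X Y (f : bhom X Y) : zmod_closed (im_pred f).
Proof.
split; first by apply/asboolP; exists 0; apply: additive0 (bfunD f).
move=> _ _ /asboolP[x <-] /asboolP[y <-]; apply/asboolP; exists (x - y).
by rewrite bfunD (additiveN (bfunD f)).
Qed.
HB.instance Definition _ X Y (f : bhom X Y) :=
  GRing.isZmodClosed.Build Y (im_pred f) (im_closed f).

Lemma im_l X Y (f : bhom X Y) s y : y \in im_pred f -> s *> y \in im_pred f.
Proof. by move=> /asboolP[x <-]; apply/asboolP; exists (s *> x); rewrite bfunl. Qed.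
Lemma im_r X Y (f : bhom X Y) y r : y \in im_pred f -> y <* r \in im_pred f.
Proof. by move=> /asboolP[x <-]; apply/asboolP; exists (x <* r); rewrite bfunr. Qed.

Definition coker X Y (f : bhom X Y) := quo_bimod (@im_l X Y f) (@im_r X Y f).

Lemma coker_surj X Y (f : bhom X Y) :
  (forall g h : bhom Y (coker f), bcomp g f = bcomp h f -> g = h) ->
  forall y, exists x, f x = y.
Proof.
move=> fe y; have e : quo_proj (@im_l X Y f) (@im_r X Y f) = bzero Y (coker f).
  apply: fe; apply: bhom_eq => x.
  by apply/(quo_proj_eq0 (@im_l X Y f) (@im_r X Y f)); apply/asboolP; exists x.
have /(quo_proj_eq0 (@im_l X Y f) (@im_r X Y f)) : 
  quo_proj (@im_l X Y f) (@im_r X Y f) y = 0 by rewrite e.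
by move/asboolP.
Qed.

Lemma epi_surj X Y (f : bhom X Y) : @epi (BMod S R) X Y f ->
  forall y, exists x, f x = y.
Proof. by move=> fe; apply: coker_surj => g h; apply: fe. Qed.
End BimoduleMaps.

Section ExhaustiveEpi.
Variables (k : comPzRingType) (U : acs_alg k) (R : kalg k).

Lemma quo_exhaustive_l (X : bimod U R) (P : zmodClosed X)
    (Pl : forall s x, x \in P -> s *> x \in P) (Pr : forall x r, x \in P -> x <* r \in P) :
  exhaustive_l X -> exhaustive_l (quo_bimod Pl Pr).
Proof.
move=> hX x; have [n /annlP hn] := hX (repr (x : bquo P)); exists n.
apply/annlP => u /hn h; rewrite -[x]reprK -[\pi_ _ _]/(quo_proj Pl Pr _) -bfunl h.
exact: additive0 (bfunD _).
Qed.
Lemma quo_exhaustive_r (X : bimod R U) (P : zmodClosed X)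
    (Pl : forall s x, x \in P -> s *> x \in P) (Pr : forall x r, x \in P -> x <* r \in P) :
  exhaustive_r X -> exhaustive_r (quo_bimod Pl Pr).
Proof.
move=> hX x; have [n /annrP hn] := hX (repr (x : bquo P)); exists n.
apply/annrP => u /hn h; rewrite -[x]reprK -[\pi_ _ _]/(quo_proj Pl Pr _) -bfunr h.
exact: additive0 (bfunD _).
Qed.

Lemma epi_surj_exl (X Y : ModExL U R) (f : Defs.Hom X Y) : epi f ->
  forall y : sval Y, exists x, (f : bhom _ _) x = y.
Proof.
move=> fe; apply: coker_surj => g h.
pose Z : ModExL U R := exist (fun W : BMod U R => exhaustive_l W) (coker _)
  (@quo_exhaustive_l _ _ (@im_l _ _ _ _ _ f) (@im_r _ _ _ _ _ f) (svalP Y)).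
exact: (fe Z).
Qed.
Lemma epi_surj_exr (X Y : ModExR U R) (f : Defs.Hom X Y) : epi f ->
  forall y : sval Y, exists x, (f : bhom _ _) x = y.
Proof.
move=> fe; apply: coker_surj => g h.
pose Z : ModExR U R := exist (fun W : BMod R U => exhaustive_r W) (coker _)
  (@quo_exhaustive_r _ _ (@im_l _ _ _ _ _ f) (@im_r _ _ _ _ _ f) (svalP Y)).
exact: (fe Z).
Qed.
Lemma surj_epi_exl (X Y : ModExL U R) (f : Defs.Hom X Y) :
  (forall y : sval Y, exists x, (f : bhom _ _) x = y) -> epi f.
Proof. by move=> fs Z; apply: bhom_surj_epi fs (sval Z). Qed.
Lemma surj_epi_exr (X Y : ModExR U R) (f : Defs.Hom X Y) :
  (forall y : sval Y, exists x, (f : bhom _ _) x = y) -> epi f.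
Proof. by move=> fs Z; apply: bhom_surj_epi fs (sval Z). Qed.
End ExhaustiveEpi.

Section EquivalenceEpi.
Variables (C D : category) (F : functor C D) (G : functor D C) (adj : adjunction F G).

Lemma adjoint_equivalence_epi (X Y : D) (f : Defs.Hom X Y) :
  adjoint_equivalence adj -> epi f -> epi (fmap G f).
Proof.
move=> [hu hc] fe Z g h gh.
have {gh} Fgh : cmp (fmap F g) (fmap F (fmap G f)) = cmp (fmap F h) (fmap F (fmap G f)).
  by rewrite -!fmapM gh.
have [v [vl vr]] := hc Y; have [w [wl wr]] := hc X.
have Ff : cmp (fmap F (fmap G f)) w = cmp v f.
  rewrite -[LHS]cmp1m -vl -cmpA [cmp (adj_counit adj Y) (cmp _ _)]cmpA counit_nat.
  by rewrite -[cmp (cmp f _) w]cmpA wr cmpm1.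
have {Fgh Ff} : cmp (cmp (fmap F g) v) f = cmp (cmp (fmap F h) v) f.
  by rewrite -!cmpA -Ff !cmpA Fgh.
move=> /fe /(congr1 (fun t => cmp t (adj_counit adj Y))).
rewrite -!cmpA vl !cmpm1 => Fgh; have [t [tl _]] := hu Z.
by rewrite -[g]cmp1m -[h]cmp1m -tl -!cmpA !unit_nat Fgh.
Qed.
End EquivalenceEpi.

(** * Projectivity and thick induction *)

Section LeftModules.
Variables (k : comPzRingType) (U : acs_alg k).

Lemma lunit_hc n m (e : U) : e \in NL U n ->
  (forall x, x \in NL U n -> x - x * e \in NL U m) -> lunit n m (hc 0 e).
Proof.
move=> en h; split; [exact: homog_hc | exact: NL_hc | move=> x hx].
have [t [_ ->]] := hc_dec x; rewrite mulr_suml -sumrB; apply: rpred_sum => p _.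
have := NL_hc p (h _ (NL_hc p hx)).
rewrite hcB (hcMl _ _ (homog_hc p x)) subrr (hc_homog _ (homog_hc p x)) eqxx.
by [].
Qed.

Lemma split_unit_l n m (v : U) : 1 - v \in NL U n ->
  (forall x, x \in NL U n -> x * v \in NL U m) -> exists e : U, lunit n m e.
Proof.
move=> v1 h; exists (hc 0 (1 - v)); apply: lunit_hc => // x hx.
by rewrite mulrBr mulr1 subKr; apply: h.
Qed.

Lemma all_unit_lP : all_unit_l U <->
  forall n M : nat, (n <= M)%N -> exists e : U, lunit n.+1%:Z M.+1%:Z e.
Proof.
split=> [h n M _|h [|n] m]; first exact: h.
  exists 1; split; [exact: homog1 | exact: NL_all | move=> x _].
  by rewrite mulr1 subrr rpred0.
have [e he] := h n (maxn n `|m|) (leq_maxl _ _).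
by exists e; apply: lunit_le he; have := leq_maxr n `|m|; lia.
Qed.

Section LquotMap.
Variables (n : nat) (D : left_sq (NLi U n.+1)) (W : bimod U (base_alg k)) (x : W).
Hypothesis hx : x \in annl_pred (NLi U n.+1) (W := W).
Local Notation L := (res_r (kstr_hom (sqalg D)) (lquot D)).

Let xE (u : U) : repr (\pi_(lquo (NLi U n.+1)) u) *> x = u *> x.
Proof. exact: (lquo_annE u (exist _ x hx : annl (NLi U n.+1) W)). Qed.

Program Definition lquot_map : bhom L W :=
  @BHom k U (base_alg k) L W (fun z : lquo _ => repr z *> x) _ _ _.
Next Obligation.
by rewrite -[x0]reprK -[y]reprK [_ + _]lpiD !xE lactDl.
Qed.
Next Obligation.
by rewrite -[x0]reprK lquo_lactE !xE lactA.
Qed.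
Next Obligation.
rewrite -[RHS]lractk -lactA; have /= <- := @lractk k _ _ (lquot D) r x0.
by rewrite /lquo_lact xE.
Qed.

Lemma lquot_mapE (u : U) : lquot_map (\pi_(lquo (NLi U n.+1)) u : L) = u *> x.
Proof. exact: xE. Qed.
End LquotMap.

Lemma Lcls1_annl (n M : nat) : (n <= M)%N ->
  (Lcls n 1 : sval (Lmod_ex U n)) \in annl_pred (NLi U M.+1) (W := sval (Lmod_ex U n)).
Proof.
move=> nM; apply/annlP => u hu; rewrite [LHS]Lcls_lact mulr1; apply: lpi0.
by apply: NL_decr hu; rewrite lez_nat.
Qed.

Definition Lmod_down n M (nM : (n <= M)%N) : @Defs.Hom (ModExL U (base_alg k)) (Lmod_ex U M) (Lmod_ex U n) :=
  lquot_map (zhu_l U M) (Lcls1_annl nM).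

Lemma Lmod_downE n M (nM : (n <= M)%N) (u : U) :
  (Lmod_down nM : bhom _ _) (Lcls M u) = Lcls n u.
Proof. by rewrite [LHS]lquot_mapE [LHS]Lcls_lact mulr1. Qed.

Lemma Lmod_down_epi n M (nM : (n <= M)%N) : epi (Lmod_down nM).
Proof.
apply: surj_epi_exl => y; have [u ->] := Lrepr y; exists (Lcls M u).
exact: Lmod_downE.
Qed.

Lemma Lmod_down_unit n M (nM : (n <= M)%N) (v : U) : Lcls n v = Lcls n 1 ->
  (forall x, x \in NL U n.+1%:Z -> x *> Lcls M v = 0) ->
  exists e : U, lunit n.+1%:Z M.+1%:Z e.
Proof.
move=> /esym/LclsE h1 h; apply: split_unit_l h1 _ => x /h.
rewrite Lcls_lact; have <- : Lcls M (0 : U) = 0 by apply: lpi0; rewrite rpred0.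
by move/LclsE; rewrite subr0.
Qed.

Lemma projective_all_unit_l :
  (forall n, projective (Lmod_ex U n)) <-> all_unit_l U.
Proof.
rewrite all_unit_lP; split=> h n.
  move=> M nM; have [g gE] := h n _ _ _ (@Lmod_down_epi _ _ nM) (idm _).
  have [v gv] := Lrepr ((g : bhom _ _) (Lcls n 1)).
  apply: (Lmod_down_unit nM (v := v)) => [|x hx].
    by rewrite -(Lmod_downE nM) -gv -[LHS]/(bcomp (Lmod_down nM) g _) [bcomp _ g]gE.
  rewrite -gv -[LHS](bfunl (g : bhom _ _)) [x *> _]Lcls_lact mulr1.
  by rewrite [Lcls n x]lpi0 //; apply: additive0 (bfunD (g : bhom _ _)).
move=> X Y e /epi_surj_exl es f; have [x0 x0E] := es ((f : bhom _ _) (Lcls n 1)).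
have [m /annlP hm] := svalP X x0.
have [eps [_ epsn heps]] : exists eps : U, lunit n.+1%:Z m.+1%:Z eps.
  have [nm|/ltnW mn] := leqP n m; first exact: h.
  have [eps heps] := h n n (leqnn n); exists eps; apply: lunit_le heps.
  by rewrite lez_nat.
have hx : (1 - eps) *> x0 \in annl_pred (NLi U n.+1) (W := sval X).
  apply/annlP => u hu; rewrite -lactA mulrBr mulr1; apply: hm; exact: heps.
exists (lquot_map (zhu_l U n) hx); apply: bhom_eq => y; have [u ->] := Lrepr y.
have H a b : a *> (Lcls n b : sval (Lmod_ex U n)) = Lcls n (a * b) by exact: Lcls_lact.
rewrite -[LHS]/((e : bhom _ _) (lquot_map (zhu_l U n) hx (Lcls n u))) lquot_mapE.
rewrite !bfunl x0E -!(bfunl (f : bhom _ _)) !H mulr1.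
by congr (_ _); apply/LclsE; rewrite mulrBr mulr1 addrAC subrr add0r rpredN NL_left.
Qed.

Lemma adj_l_all_unit_l :
  (forall n, adjoint_equivalence (adj_l (thick_l U n) (base_alg k))) -> all_unit_l U.
Proof.
move=> h; apply/all_unit_lP => n M nM.
have /epi_surj es := adjoint_equivalence_epi (h n) (@Lmod_down_epi _ _ nM).
have [w wE] := es (exist _ (Lcls n 1) (Lcls1_annl (leqnn n))).
have [v vE] := Lrepr (val w : Lmod U M).
apply: (Lmod_down_unit nM (v := v)) => [|x hx].
  by rewrite -(Lmod_downE nM) -vE; move/(congr1 val): wE.
by have /annlP hw := valP (w : annl _ _); rewrite -vE; apply: hw.
Qed.
End LeftModules.

Section LeftEquivalence.
Variables (k : comPzRingType) (U : acs_alg k).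
Hypotheses (Ul : all_unit_l U) (Ur : all_unit_r U).

(* Multiplying the factorisation at level m by 1 - e, with e the unit of N^(m+1)
   modulo N^(m+2), leaves the error e, which lies in U_(m+1) U_(-m-1). *)
Lemma partition_l (m : nat) : exists v,
  psum (fun _ y : U => forall u, u \in NL U 1 -> u * y \in NL U m.+1%:Z) v /\
  1 - v \in NL U m.+1%:Z.
Proof.
elim: m => [|m [v [hv v1]]].
  exists 1; rewrite subrr rpred0 -[X in psum _ X]mulr1; split=> //.
  by apply: psum_mul => u; rewrite mulr1.
have [e [e0 en he]] := Ul m.+1 m.+2%:Z.
have [w [hw ew]] := NL_lead en e0.
have m2 : (m.+1%:Z + 1 = m.+2%:Z)%R by lia.
exists (v * (1 - e) + w); split.
  apply: psumD.
    apply: psumMr hv => x y h u hu; rewrite mulrA mulrBr mulr1; exact/he/h.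
  apply: psum_mono hw => x y [_ hy] u hu.
  by have := NL_right hu hy; rewrite opprK addrC m2.
have -> : 1 - (v * (1 - e) + w) = ((1 - v) - (1 - v) * e) + (e - w).
  rewrite mulrBr mulr1 mulrBl mul1r [- (e - _)]opprB -[RHS]addrA subrKA.
  by rewrite opprD opprB [v * e - v]addrC !addrA.
rewrite rpredD //; first exact: he.
by rewrite -m2.
Qed.

Variables (n : nat) (D : left_sq (NLi U n.+1)).
Hypothesis full : forall s, (forall u, u \in NL U n.+1%:Z -> u * s \in NL U n.+1%:Z) ->
  exists2 s', s' \in sq_S D & s - s' \in NL U n.+1%:Z.
Local Notation B := (sqalg D).
Local Notation L := (lquo (NLi U n.+1)).

Let sq_NL s : s \in sq_S D -> s \in sq_I D -> s \in NL U n.+1%:Z.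
Proof. by move=> hs; rewrite lsqI. Qed.

Lemma NL_absorb_seq (s : seq L) : exists m : nat, forall x, x \in s ->
  forall v, v \in NL U m.+1%:Z -> v * repr x \in NL U n.+1%:Z.
Proof.
elim: s => [|x s [m hm]]; first by exists 0%N.
have [m' hm'] := NL_absorb n (repr x); exists (maxn m m') => y.
rewrite inE => /predU1P[->|/hm h] v hv; [apply: hm' | apply: h];
  by apply: NL_decr hv; rewrite lez_nat ltnS ?leq_maxl ?leq_maxr.
Qed.

Let eps_ex m : exists e : U, unit2 n.+1%:Z m e.
Proof. exact: unit2_exists (Ul _ _) (Ur _ _). Qed.
Let eps m := projT1 (cid (eps_ex m)).
Let heps m : unit2 n.+1%:Z m (eps m). Proof. exact: projT2 (cid (eps_ex m)). Qed.
Let epsN m : eps m \in NL U n.+1%:Z. Proof. by have [[]] := heps m. Qed.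
Let epsl m x : x \in NL U n.+1%:Z -> x - x * eps m \in NL U m.
Proof. by have [[_ _ h] _] := heps m; apply: h. Qed.

Lemma cut_idealizer (m : nat) (x : U) :
  (forall v, v \in NL U m.+1%:Z -> v * x \in NL U n.+1%:Z) ->
  exists2 s, s \in sq_S D & (1 - eps m.+1%:Z) * x - s \in NL U n.+1%:Z.
Proof.
move=> h; apply: full => u hu; rewrite mulrA; apply: h.
by rewrite mulrBr mulr1; apply: epsl.
Qed.

Let cut_rel (x : L) (b : B) := exists m : nat, forall m' : nat, (m <= m')%N ->
  (1 - eps m'.+1%:Z) * repr x - sqrep b \in NL U n.+1%:Z.

Let cut_ex x : exists b, cut_rel x b.
Proof.
have [m hm] := NL_absorb n (repr x); have [s hs xs] := cut_idealizer hm.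
exists (sqcls hs), m => m' mm'.
rewrite -[X in X \in _](subrKA s) rpredD //; last first.
  by rewrite -opprB rpredN sq_NL ?sqcls_rep // rpredB ?sqrep_in.
rewrite -[X in X \in _](subrKA ((1 - eps m.+1%:Z) * repr x)) rpredD // -mulrBl; apply: hm.
rewrite opprB addrC subrKA -opprB rpredN.
by apply: unit2_uniq (heps _) (heps _); lia.
Qed.
Let cut x := projT1 (cid (cut_ex x)).
Let cutP x : cut_rel x (cut x). Proof. exact: projT2 (cid (cut_ex x)). Qed.

Let cut_uniq x b : cut_rel x b -> cut x = b.
Proof.
move=> [m hm]; have [m' hm'] := cutP x; set M := maxn m m'.
have h := hm M (leq_maxl _ _); have h' := hm' M (leq_maxr _ _).
rewrite -(sqrepK (sqrep_in (cut x))) -(sqrepK (sqrep_in b)); apply/sqclsE.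
have hs : sqrep (cut x) - sqrep b \in sq_S D by rewrite rpredB ?sqrep_in.
rewrite lsqI //; move: hs => _.
have -> : sqrep (cut x) - sqrep b = ((1 - eps M.+1%:Z) * repr x - sqrep b)
   - ((1 - eps M.+1%:Z) * repr x - sqrep (cut x)).
  by rewrite opprB [RHS]addrC subrKA.
exact: rpredB.
Qed.

Let cutD x y : cut (x + y) = cut x + cut y.
Proof.
apply: cut_uniq; have [m hm] := cutP x; have [m' hm'] := cutP y.
exists (maxn m m') => M hM; rewrite geq_max in hM; have {hM} /andP[h1 h2] := hM.
have h : (1 - eps M.+1%:Z) * (repr (x + y) - (repr x + repr y)) \in NL U n.+1%:Z.
  by apply: NL_left; apply/(@lpiE _ _ (NLi U n.+1)); rewrite reprK -lpiD !reprK.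
have h' : sqrep (cut x + cut y) - (sqrep (cut x) + sqrep (cut y)) \in NL U n.+1%:Z.
  by apply: sq_NL (sqrepD _ _); rewrite rpredB ?rpredD ?sqrep_in.
rewrite -[X in X \in _](subrKA ((1 - eps M.+1%:Z) * (repr x + repr y))) -mulrBr.
apply: rpredD => //.
rewrite -[X in X \in _](subrKA (sqrep (cut x) + sqrep (cut y))); apply: rpredD; last first.
  by rewrite -opprB rpredN.
by rewrite mulrDr opprD addrACA rpredD ?hm ?hm'.
Qed.

Let cutM x b : cut (lquo_ract x b) = cut x * b.
Proof.
apply: cut_uniq; have [m hm] := cutP x; exists m => M /hm h.
have h1 : repr (lquo_ract x b) - repr x * sqrep b \in NL U n.+1%:Z by apply: lrepr.
have h' : sqrep (cut x * b) - sqrep (cut x) * sqrep b \in NL U n.+1%:Z.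
  by apply: sq_NL (sqrepM _ _); rewrite rpredB ?rpredM ?sqrep_in.
rewrite -[X in X \in _](subrKA ((1 - eps M.+1%:Z) * (repr x * sqrep b))) -mulrBr.
apply: rpredD; first exact: NL_left.
rewrite -[X in X \in _](subrKA (sqrep (cut x) * sqrep b)); apply: rpredD; last first.
  by rewrite -opprB rpredN.
by rewrite mulrA -mulrBl; apply: (@lsqN _ _ _ D) => //; apply: sqrep_in.
Qed.

Let cut1 : cut (\pi_L 1) = 1.
Proof.
apply: cut_uniq; exists 0%N => M _; have h1 := @lrepr _ _ (NLi U n.+1) 1.
have h2 : sqrep (1 : B) - 1 \in NL U n.+1%:Z.
  by apply: sq_NL (sqrep1 _); rewrite rpredB ?rpred1 ?sqrep_in.
rewrite -[X in X \in _](subrKA (1 - eps M.+1%:Z)) rpredD //.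
  by rewrite -[X in _ - X]mulr1 -mulrBr; apply: NL_left.
have -> : 1 - eps M.+1%:Z - sqrep (1 : B) = - (eps M.+1%:Z + (sqrep (1 : B) - 1)).
  by rewrite [in RHS]opprD opprB [RHS]addrCA addrA.
by rewrite rpredN; apply: rpredD.
Qed.

Section Unit.
Variables (R : kalg k) (M : bimod B R).

Lemma unit_l_inj (x y : M) : @unit_l _ _ _ D _ M x = @unit_l _ _ _ D _ M y -> x = y.
Proof.
have bal : balanced (fun (z : lquot D) (x : M) => cut z *> x).
  split=> [z z' m|z m m'|z b m]; first by rewrite cutD lactDl.
    exact: lactDr.
  by rewrite [cut _]cutM lactA.
move=> /(congr1 (fun t => tlift (fun (z : lquot D) (x : M) => cut z *> x) (val t))) /=.
by rewrite !(tlift_tmk bal) cut1 !lact1.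
Qed.

Lemma unit_l_surj (t : tensor (lquot D) M) : t \in annl_pred (NLi U n.+1) (W := tensor (lquot D) M) ->
  exists x, t = tmk (\pi_L 1 : lquot D) x.
Proof.
move=> /annlP ht; have [m hm] := NL_absorb_seq [seq xy.1 | xy <- repr t].
have -> : t = (1 - eps m.+1%:Z) *> t by rewrite lactBl lact1 ht ?subr0.
rewrite (tens_sum t) (additive_sum _ _ (lactDr _)).
have : {subset repr t <= repr t} by [].
elim: {-2}(repr t) => [|[x y] s ih] hs.
  by exists 0; rewrite big_nil tmk0r.
have [xy h|z zE] := ih; first by apply: hs; rewrite inE h orbT.
rewrite big_cons zE.
have [b hb xb] := cut_idealizer (hm x (map_f _ (hs _ (mem_head _ _)))).
exists ((sqcls hb : B) *> y + z); rewrite tmkDr; congr (_ + _).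
rewrite [LHS]tens_lactE -tmkbal; congr tmk.
rewrite -[x in LHS]reprK [LHS]lquo_lactE.
rewrite [RHS](@lquo_ractE _ _ _ D 1 _ b hb) ?sqcls_rep //; apply/(@lpiE _ _ (NLi U n.+1)).
by rewrite mul1r.
Qed.

Lemma unit_l_bij : bij_hom (@unit_l _ _ _ D _ M).
Proof.
split; first exact: unit_l_inj.
move=> t; have [x xE] := unit_l_surj (valP t); exists x; exact: val_inj.
Qed.
End Unit.

Lemma counit_l_bij (R : kalg k) (W : bimod U R) : exhaustive_l W -> bij_hom (counit_l D W).
Proof.
move=> hW; split.
  apply: bhom_inj => t t0; have [m /annlP hm] := phi_l_exhaustive t.
  have [v [hv v1]] := partition_l m.
  have -> : t = v *> t.
    by apply/eqP; rewrite -subr_eq0 -[t in t - _]lact1 -lactBl hm.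
  elim: hv => [|x y w hy _ ih]; first exact: lact0l.
  rewrite lactDl ih addr0 lactA.
  have ht : y *> t \in annl_pred (NLi U n.+1) (W := tensor (lquot D) (omega_l D W)).
    apply/annlP => u hu; rewrite -lactA; apply: hm; apply: hy.
    by apply: NL_decr hu; lia.
  have [w' w'E] := unit_l_surj ht.
  have : counit_l D W (y *> t) = 0 by rewrite bfunl t0 lact0r.
  rewrite w'E [LHS]counit_lE lact1 => w0.
  have -> : w' = 0 by apply: val_inj.
  by rewrite tmk0r lact0r.
move=> w; have [m /annlP hm] := hW w; have [v [hv v1]] := partition_l m.
have -> : w = v *> w by apply/eqP; rewrite -subr_eq0 -[w in w - _]lact1 -lactBl hm.
elim: hv => [|x y v' hy _ [t tE]]; first by exists 0; rewrite lact0l (additive0 (bfunD _)).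
have hw : y *> w \in annl_pred (NLi U n.+1) (W := W).
  apply/annlP => u hu; rewrite -lactA; apply: hm; apply: hy.
  by apply: NL_decr hu; lia.
pose w' : omega_l D W := (exist _ (y *> w) hw : annl (NLi U n.+1) W).
exists (tmk (\pi_L x : lquot D) w' + t).
by rewrite bfunD tE [counit_l D W (tmk _ _)]counit_lE lactDl lactA.
Qed.

Lemma adj_l_equivalence (R : kalg k) : adjoint_equivalence (adj_l D R).
Proof.
split=> [M|W]; first exact/iso_bij/unit_l_bij.
by have /iso_bij := counit_l_bij (svalP W).
Qed.
End LeftEquivalence.

Section RightModules.
Variables (k : comPzRingType) (U : acs_alg k).

Lemma split_unit_r n m (v : U) : 1 - v \in NR_pred U n ->
  (forall x, x \in NR_pred U n -> v * x \in NR_pred U m) -> exists e : U, runit n m e.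
Proof.
by move=> v1 h; have [e /op_unit_l he] := @split_unit_l _ (acs_op U) n m v v1 h; exists e.
Qed.

Lemma op_all_unit_l : all_unit_l (acs_op U) <-> all_unit_r U.
Proof. by split=> h n m; have [e /op_unit_l he] := h n m; exists e => //; apply/op_unit_l. Qed.
Lemma op_all_unit_r : all_unit_r (acs_op U) <-> all_unit_l U.
Proof. by split=> h n m; have [e /op_unit_r he] := h n m; exists e => //; apply/op_unit_r. Qed.

Lemma all_unit_rP : all_unit_r U <->
  forall n M : nat, (n <= M)%N -> exists e : U, runit n.+1%:Z M.+1%:Z e.
Proof.
rewrite -op_all_unit_l all_unit_lP.
by split=> h n M /h[e /op_unit_l he]; exists e => //; apply/op_unit_l.
Qed.

Section RquotMap.
Variables (n : nat) (D : right_sq (NRi U n.+1)) (W : bimod (base_alg k) U) (x : W).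
Hypothesis hx : x \in annr_pred (NRi U n.+1) (W := W).
Local Notation L := (res_l (kstr_hom (sqalg D)) (rquot D)).

Let xE (u : U) : x <* repr (\pi_(rquo (NRi U n.+1)) u) = x <* u.
Proof. exact: (rquo_annE u (exist _ x hx : annr (NRi U n.+1) W)). Qed.

Program Definition rquot_map : bhom L W :=
  @BHom k (base_alg k) U L W (fun z : rquo _ => x <* repr z) _ _ _.
Next Obligation.
by rewrite -[x0]reprK -[y]reprK [_ + _]rpiD !xE ractDr.
Qed.
Next Obligation.
rewrite [RHS]lractk -ractA; have /= -> := @lractk k _ _ (rquot D) s x0.
by rewrite /rquo_ract xE.
Qed.
Next Obligation. by rewrite -[x0]reprK rquo_ractE !xE ractA. Qed.

Lemma rquot_mapE (u : U) : rquot_map (\pi_(rquo (NRi U n.+1)) u : L) = x <* u.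
Proof. exact: xE. Qed.
End RquotMap.

Lemma Rcls1_annr (n M : nat) : (n <= M)%N ->
  (Rcls n 1 : sval (Rmod_ex U n)) \in annr_pred (NRi U M.+1) (W := sval (Rmod_ex U n)).
Proof.
move=> nM; apply/annrP => u hu; rewrite [LHS]Rcls_ract mul1r; apply: rpi0.
by apply: NR_decr hu; rewrite lez_nat.
Qed.

Definition Rmod_down n M (nM : (n <= M)%N) : @Defs.Hom (ModExR U (base_alg k)) (Rmod_ex U M) (Rmod_ex U n) :=
  rquot_map (zhu_r U M) (Rcls1_annr nM).

Lemma Rmod_downE n M (nM : (n <= M)%N) (u : U) :
  (Rmod_down nM : bhom _ _) (Rcls M u) = Rcls n u.
Proof. by rewrite [LHS]rquot_mapE [LHS]Rcls_ract mul1r. Qed.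

Lemma Rmod_down_epi n M (nM : (n <= M)%N) : epi (Rmod_down nM).
Proof.
apply: surj_epi_exr => y; have [u ->] := Rrepr y; exists (Rcls M u).
exact: Rmod_downE.
Qed.

Lemma Rmod_down_unit n M (nM : (n <= M)%N) (v : U) : Rcls n v = Rcls n 1 ->
  (forall x, x \in NR_pred U n.+1%:Z -> Rcls M v <* x = 0) ->
  exists e : U, runit n.+1%:Z M.+1%:Z e.
Proof.
move=> /esym/RclsE h1 h; apply: split_unit_r h1 _ => x /h.
rewrite Rcls_ract; have <- : Rcls M (0 : U) = 0 by apply: rpi0; rewrite rpred0.
by move/RclsE; rewrite subr0.
Qed.

Lemma projective_all_unit_r :
  (forall n, projective (Rmod_ex U n)) <-> all_unit_r U.
Proof.
rewrite all_unit_rP; split=> h n.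
  move=> M nM; have [g gE] := h n _ _ _ (@Rmod_down_epi _ _ nM) (idm _).
  have [v gv] := Rrepr ((g : bhom _ _) (Rcls n 1)).
  apply: (Rmod_down_unit nM (v := v)) => [|x hx].
    by rewrite -(Rmod_downE nM) -gv -[LHS]/(bcomp (Rmod_down nM) g _) [bcomp _ g]gE.
  rewrite -gv -[LHS](bfunr (g : bhom _ _)) [_ <* x]Rcls_ract mul1r.
  by rewrite [Rcls n x]rpi0 //; apply: additive0 (bfunD (g : bhom _ _)).
move=> X Y e /epi_surj_exr es f; have [x0 x0E] := es ((f : bhom _ _) (Rcls n 1)).
have [m /annrP hm] := svalP X x0.
have [eps [_ epsn heps]] : exists eps : U, runit n.+1%:Z m.+1%:Z eps.
  have [nm|/ltnW mn] := leqP n m; first exact: h.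
  have [eps [h1 h2 h3]] := h n n (leqnn n); exists eps; split=> // x /h3.
  by apply: NR_decr; rewrite lez_nat.
have hx : x0 <* (1 - eps) \in annr_pred (NRi U n.+1) (W := sval X).
  apply/annrP => u hu; rewrite -ractA mulrBl mul1r; apply: hm; exact: heps.
exists (rquot_map (zhu_r U n) hx); apply: bhom_eq => y; have [u ->] := Rrepr y.
have H a b : (Rcls n b : sval (Rmod_ex U n)) <* a = Rcls n (b * a) by exact: Rcls_ract.
rewrite -[LHS]/((e : bhom _ _) (rquot_map (zhu_r U n) hx (Rcls n u))) rquot_mapE.
rewrite !bfunr x0E -!(bfunr (f : bhom _ _)) !H mul1r.
by congr (_ _); apply/RclsE; rewrite mulrBl mul1r addrAC subrr add0r rpredN NR_right.
Qed.

Lemma adj_r_all_unit_r :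
  (forall n, adjoint_equivalence (adj_r (thick_r U n) (base_alg k))) -> all_unit_r U.
Proof.
move=> h; apply/all_unit_rP => n M nM.
have /epi_surj es := adjoint_equivalence_epi (h n) (@Rmod_down_epi _ _ nM).
have [w wE] := es (exist _ (Rcls n 1) (Rcls1_annr (leqnn n))).
have [v vE] := Rrepr (val w : Rmod U M).
apply: (Rmod_down_unit nM (v := v)) => [|x hx].
  by rewrite -(Rmod_downE nM) -vE; move/(congr1 val): wE.
by have /annrP hw := valP (w : annr _ _); rewrite -vE; apply: hw.
Qed.
End RightModules.

Section RightEquivalence.
Variables (k : comPzRingType) (U : acs_alg k).
Hypotheses (Ul : all_unit_l U) (Ur : all_unit_r U).

Lemma psum_conv (R : pzRingType) (P : R -> R -> Prop) v :
  psum (R := R^c) P v -> psum (R := R) (fun x y => P y x) v.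
Proof. by elim=> [|x y u h _ ih]; [apply: psum0 | exact: (@psum_cons R (fun x y => P y x) y x u h ih)]. Qed.

Lemma partition_r (m : nat) : exists v,
  psum (fun y _ : U => forall u, u \in NR_pred U 1 -> y * u \in NR_pred U m.+1%:Z) v /\
  1 - v \in NR_pred U m.+1%:Z.
Proof.
have [v [hv v1]] := partition_l ((op_all_unit_l U).2 Ur) m.
by exists v; split=> //; apply: psum_conv hv.
Qed.

Variables (n : nat) (D : right_sq (NRi U n.+1)).
Hypothesis full : forall s,
  (forall u, u \in NR_pred U n.+1%:Z -> s * u \in NR_pred U n.+1%:Z) ->
  exists2 s', s' \in sq_S D & s - s' \in NR_pred U n.+1%:Z.
Local Notation B := (sqalg D).
Local Notation L := (rquo (NRi U n.+1)).

Let sq_NR s : s \in sq_S D -> s \in sq_I D -> s \in NR_pred U n.+1%:Z.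
Proof. by move=> hs; rewrite rsqI. Qed.

Lemma NR_absorb_seq (s : seq L) : exists m : nat, forall x, x \in s ->
  forall v, v \in NR_pred U m.+1%:Z -> repr x * v \in NR_pred U n.+1%:Z.
Proof.
elim: s => [|x s [m hm]]; first by exists 0%N.
have [m' hm'] := NR_absorb n (repr x); exists (maxn m m') => y.
rewrite inE => /predU1P[->|/hm h] v hv; [apply: hm' | apply: h];
  by apply: NR_decr hv; rewrite lez_nat ltnS ?leq_maxl ?leq_maxr.
Qed.

Let eps_ex m : exists e : U, unit2 n.+1%:Z m e.
Proof. exact: unit2_exists (Ul _ _) (Ur _ _). Qed.
Let eps m := projT1 (cid (eps_ex m)).
Let heps m : unit2 n.+1%:Z m (eps m). Proof. exact: projT2 (cid (eps_ex m)). Qed.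
Let epsN m : eps m \in NR_pred U n.+1%:Z. Proof. by have [_ []] := heps m. Qed.
Let epsr m x : x \in NR_pred U n.+1%:Z -> x - eps m * x \in NR_pred U m.
Proof. by have [_ [_ _ h]] := heps m; apply: h. Qed.

Lemma cut_idealizer_r (m : nat) (x : U) :
  (forall v, v \in NR_pred U m.+1%:Z -> x * v \in NR_pred U n.+1%:Z) ->
  exists2 s, s \in sq_S D & x * (1 - eps m.+1%:Z) - s \in NR_pred U n.+1%:Z.
Proof.
move=> h; apply: full => u hu; rewrite -mulrA; apply: h.
by rewrite mulrBl mul1r; apply: epsr.
Qed.

Let cut_rel (x : L) (b : B) := exists m : nat, forall m' : nat, (m <= m')%N ->
  repr x * (1 - eps m'.+1%:Z) - sqrep b \in NR_pred U n.+1%:Z.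

Let cut_ex x : exists b, cut_rel x b.
Proof.
have [m hm] := NR_absorb n (repr x); have [s hs xs] := cut_idealizer_r hm.
exists (sqcls hs), m => m' mm'.
rewrite -[X in X \in _](subrKA s) rpredD //; last first.
  by rewrite -opprB rpredN sq_NR ?sqcls_rep // rpredB ?sqrep_in.
rewrite -[X in X \in _](subrKA (repr x * (1 - eps m.+1%:Z))) rpredD // -mulrBr; apply: hm.
rewrite opprB addrC subrKA -opprB rpredN NR0; last first.
  by have [[h1 _ _] _] := heps m'.+1%:Z; have [[h2 _ _] _] := heps m.+1%:Z; rewrite rpredB.
by apply: unit2_uniq (heps _) (heps _); lia.
Qed.
Let cut x := projT1 (cid (cut_ex x)).
Let cutP x : cut_rel x (cut x). Proof. exact: projT2 (cid (cut_ex x)). Qed.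

Let cut_uniq x b : cut_rel x b -> cut x = b.
Proof.
move=> [m hm]; have [m' hm'] := cutP x; set M := maxn m m'.
have h := hm M (leq_maxl _ _); have h' := hm' M (leq_maxr _ _).
rewrite -(sqrepK (sqrep_in (cut x))) -(sqrepK (sqrep_in b)); apply/sqclsE.
have hs : sqrep (cut x) - sqrep b \in sq_S D by rewrite rpredB ?sqrep_in.
rewrite rsqI //; move: hs => _.
have -> : sqrep (cut x) - sqrep b = (repr x * (1 - eps M.+1%:Z) - sqrep b)
   - (repr x * (1 - eps M.+1%:Z) - sqrep (cut x)).
  by rewrite opprB [RHS]addrC subrKA.
exact: rpredB.
Qed.

Let cutD x y : cut (x + y) = cut x + cut y.
Proof.
apply: cut_uniq; have [m hm] := cutP x; have [m' hm'] := cutP y.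
exists (maxn m m') => M hM; rewrite geq_max in hM; have {hM} /andP[h1 h2] := hM.
have h : (repr (x + y) - (repr x + repr y)) * (1 - eps M.+1%:Z) \in NR_pred U n.+1%:Z.
  by apply: NR_right; apply/(@rpiE _ _ (NRi U n.+1)); rewrite reprK -rpiD !reprK.
have h' : sqrep (cut x + cut y) - (sqrep (cut x) + sqrep (cut y)) \in NR_pred U n.+1%:Z.
  by apply: sq_NR (sqrepD _ _); rewrite rpredB ?rpredD ?sqrep_in.
rewrite -[X in X \in _](subrKA ((repr x + repr y) * (1 - eps M.+1%:Z))) -mulrBl.
apply: rpredD => //.
rewrite -[X in X \in _](subrKA (sqrep (cut x) + sqrep (cut y))); apply: rpredD; last first.
  by rewrite -opprB rpredN.
by rewrite mulrDl opprD addrACA rpredD ?hm ?hm'.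
Qed.

Let cutM x b : cut (rquo_lact b x) = b * cut x.
Proof.
apply: cut_uniq; have [m hm] := cutP x; exists m => M /hm h.
have h1 : repr (rquo_lact b x) - sqrep b * repr x \in NR_pred U n.+1%:Z by apply: rrepr.
have h' : sqrep (b * cut x) - sqrep b * sqrep (cut x) \in NR_pred U n.+1%:Z.
  by apply: sq_NR (sqrepM _ _); rewrite rpredB ?rpredM ?sqrep_in.
rewrite -[X in X \in _](subrKA ((sqrep b * repr x) * (1 - eps M.+1%:Z))) -mulrBl.
apply: rpredD; first exact: NR_right.
rewrite -[X in X \in _](subrKA (sqrep b * sqrep (cut x))); apply: rpredD; last first.
  by rewrite -opprB rpredN.
by rewrite -mulrA -mulrBr; apply: (@rsqN _ _ _ D) => //; apply: sqrep_in.
Qed.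

Let cut1 : cut (\pi_L 1) = 1.
Proof.
apply: cut_uniq; exists 0%N => M _; have h1 := @rrepr _ _ (NRi U n.+1) 1.
have h2 : sqrep (1 : B) - 1 \in NR_pred U n.+1%:Z.
  by apply: sq_NR (sqrep1 _); rewrite rpredB ?rpred1 ?sqrep_in.
rewrite -[X in X \in _](subrKA (1 - eps M.+1%:Z)) rpredD //.
  by rewrite -[X in _ - X]mul1r -mulrBl; apply: NR_right.
have -> : 1 - eps M.+1%:Z - sqrep (1 : B) = - (eps M.+1%:Z + (sqrep (1 : B) - 1)).
  by rewrite [in RHS]opprD opprB [RHS]addrCA addrA.
by rewrite rpredN; apply: rpredD.
Qed.

Section Unit.
Variables (R : kalg k) (M : bimod R B).

Lemma unit_r_inj (x y : M) : @unit_r _ _ _ D _ M x = @unit_r _ _ _ D _ M y -> x = y.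
Proof.
have bal : balanced (fun (x : M) (z : rquot D) => x <* cut z).
  split=> [m m' z|m z z'|m b z]; first exact: ractDl.
    by rewrite cutD ractDr.
  by have /= -> := cutM z b; rewrite ractA.
move=> /(congr1 (fun t => tlift (fun (x : M) (z : rquot D) => x <* cut z) (val t))) /=.
by rewrite !(tlift_tmk bal) cut1 !ract1.
Qed.

Lemma unit_r_surj (t : tensor M (rquot D)) : t \in annr_pred (NRi U n.+1) (W := tensor M (rquot D)) ->
  exists x, t = tmk x (\pi_L 1 : rquot D).
Proof.
move=> /annrP ht; have [m hm] := NR_absorb_seq [seq xy.2 | xy <- repr t].
have -> : t = t <* (1 - eps m.+1%:Z) by rewrite ractBr ract1 ht ?subr0.
rewrite (tens_sum t) (additive_sum _ _ (fun x y => ractDl x y _)).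
have : {subset repr t <= repr t} by [].
elim: {-2}(repr t) => [|[y x] s ih] hs.
  by exists 0; rewrite big_nil tmk0l.
have [xy h|z zE] := ih; first by apply: hs; rewrite inE h orbT.
rewrite big_cons zE.
have [b hb xb] := cut_idealizer_r (hm x (map_f _ (hs _ (mem_head _ _)))).
exists (y <* (sqcls hb : B) + z); rewrite tmkDl; congr (_ + _).
rewrite [LHS]tens_ractE tmkbal; congr tmk.
rewrite -[x in LHS]reprK [LHS]rquo_ractE.
rewrite [RHS](@rquo_lactE _ _ _ D 1 _ b hb) ?sqcls_rep //; apply/(@rpiE _ _ (NRi U n.+1)).
by rewrite mulr1.
Qed.

Lemma unit_r_bij : bij_hom (@unit_r _ _ _ D _ M).
Proof.
split; first exact: unit_r_inj.
move=> t; have [x xE] := unit_r_surj (valP t); exists x; exact: val_inj.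
Qed.
End Unit.

Lemma counit_r_bij (R : kalg k) (W : bimod R U) : exhaustive_r W -> bij_hom (counit_r D W).
Proof.
move=> hW; split.
  apply: bhom_inj => t t0; have [m /annrP hm] := phi_r_exhaustive t.
  have [v [hv v1]] := partition_r m.
  have -> : t = t <* v.
    by apply/eqP; rewrite -subr_eq0 -[t in t - _]ract1 -ractBr hm.
  elim: hv => [|y x w hy _ ih]; first exact: ract0r.
  rewrite ractDr ih addr0 ractA.
  have ht : t <* y \in annr_pred (NRi U n.+1) (W := tensor (omega_r D W) (rquot D)).
    apply/annrP => u hu; rewrite -ractA; apply: hm; apply: hy.
    by apply: NR_decr hu; lia.
  have [w' w'E] := unit_r_surj ht.
  have : counit_r D W (t <* y) = 0 by rewrite bfunr t0 ract0l.
  rewrite w'E [LHS]counit_rE ract1 => w0.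
  have -> : w' = 0 by apply: val_inj.
  by rewrite tmk0l ract0l.
move=> w; have [m /annrP hm] := hW w; have [v [hv v1]] := partition_r m.
have -> : w = w <* v by apply/eqP; rewrite -subr_eq0 -[w in w - _]ract1 -ractBr hm.
elim: hv => [|y x v' hy _ [t tE]]; first by exists 0; rewrite ract0r (additive0 (bfunD _)).
have hw : w <* y \in annr_pred (NRi U n.+1) (W := W).
  apply/annrP => u hu; rewrite -ractA; apply: hm; apply: hy.
  by apply: NR_decr hu; lia.
pose w' : omega_r D W := (exist _ (w <* y) hw : annr (NRi U n.+1) W).
exists (tmk w' (\pi_L x : rquot D) + t).
by rewrite bfunD tE [counit_r D W (tmk _ _)]counit_rE ractDr ractA.
Qed.

Lemma adj_r_equivalence (R : kalg k) : adjoint_equivalence (adj_r D R).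
Proof.
split=> [M|W]; first exact/iso_bij/unit_r_bij.
by have /iso_bij := counit_r_bij (svalP W).
Qed.
End RightEquivalence.

Section FirstEquivalences.
Variables (k : comPzRingType) (U : acs_alg k).

Lemma SIC_units : SIC U <-> all_unit_l U /\ all_unit_r U.
Proof. by rewrite SIC_sic_at; apply: sic_units. Qed.

Lemma SIC_expansion : SIC U <-> exists e : nat -> hat U 0, strong_identity_expansion e.
Proof.
rewrite SIC_units; split=> [[hl hr]|[e he]]; last first.
  by split; [apply: lunit_all | apply: runit_all] => n; have [] := units_of_expansion he n.
have ex n : exists eps : int -> U, forall m, unit2 n%:Z m (eps m).
  have [eps heps] := choice (fun m => unit2_exists (hl n m) (hr n m)).
  by exists eps.
by have [eps heps] := choice ex; apply: (expansion_of_units heps).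
Qed.

Lemma SIC_projective : SIC U <-> forall n : nat,
  projective (Lmod_ex U n) /\ projective (Rmod_ex U n).
Proof.
rewrite SIC_units -projective_all_unit_l -projective_all_unit_r.
by split=> [[hl hr] n|h]; split=> // n; have [] := h n.
Qed.

Lemma SIC_thick : SIC U <-> forall n : nat,
  adjoint_equivalence (adj_l (thick_l U n) (base_alg k)) /\
  adjoint_equivalence (adj_r (thick_r U n) (base_alg k)).
Proof.
rewrite SIC_units; split=> [[hl hr] n|h]; last first.
  by split; [apply: adj_l_all_unit_l | apply: adj_r_all_unit_r] => n; have [] := h n.
split; [apply: adj_l_equivalence => // | apply: adj_r_equivalence => //] => s hs;
  exists s; rewrite ?subrr ?rpred0 //.
  exact/idealizer_lP.
exact/idealizer_rP.
Qed.
End FirstEquivalences.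

Lemma sic_at_idealizer (k : comPzRingType) (U : acs_alg k) (s : U) :
  (forall n : nat, sic_at U n%:Z) ->
  (forall u, u \in NL U 1 -> u * s \in NL U 1) -> s - hc 0 s \in NL U 1.
Proof.
move=> sic hs; have {}hs p : p != 0 -> hc p s \in NL U 1.
  move=> p0; have [p1|p1] := ltP p 0.
    by apply: (@NL_neg _ _ 1 (- p)); [rewrite opprK homog_hc | lia].
  have [u [hu hl _]] := sic `|p|%N; have pE : (`|p|%N : int) = p by lia.
  rewrite -(subrK (u * hc p s) (hc p s)) rpredD //.
    by apply: hl; rewrite pE homog_hc.
  move: hu; elim=> [|x y v [_ hy] _ ih]; first by rewrite mul0r rpred0.
  rewrite mulrDl rpredD // -mulrA; apply: NL_left.
  have yN : y \in NL U 1 by apply: NL_neg hy _; lia.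
  by have := NL_hc 0 (hs _ yN); rewrite (hcMl _ _ hy) sub0r opprK pE.
have [t [tu sE]] := hc_dec s; rewrite [X in X - _]sE.
have [t0|t0] := boolP (0 \in t).
  rewrite (bigD1_seq 0) //= addrAC subrr add0r; apply: rpred_sum => p; exact: hs.
have -> : hc 0 s = 0.
  rewrite sE hc_sum big_seq big1 // => p pt; rewrite hc_hc.
  by case: eqP => // p0; rewrite p0 pt in t0.
rewrite subr0 big_seq; apply: rpred_sum => p pt; apply: hs.
by apply: contraNneq t0 => <-.
Qed.

Section LevelZero.
Variables (k : comPzRingType) (U : acs_alg k) (R : kalg k).

Lemma SIC_zhu_l : SIC U -> adjoint_equivalence (adj_l (zhu_l U 0) R).
Proof.
move=> sic; have [hl hr] := (SIC_units U).1 sic.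
apply: adj_l_equivalence => // s hs; exists (hc 0 s); first exact: homog_hc.
by apply: sic_at_idealizer hs; apply/SIC_sic_at.
Qed.

Lemma SIC_zhu_r : SIC U -> adjoint_equivalence (adj_r (zhu_r U 0) R).
Proof.
move=> sic; have [hl hr] := (SIC_units U).1 sic.
apply: adj_r_equivalence => // s hs; exists (hc 0 s); first exact: homog_hc.
have := @sic_at_idealizer k (acs_op U) s; rewrite /= oppr0; apply=> //.
by apply/sic_units; rewrite op_all_unit_l op_all_unit_r.
Qed.
End LevelZero.

(** * Equivalences at level zero *)

Section SicOfUnits.
Variables (k : comPzRingType) (U : acs_alg k).

Lemma op_SIC : (forall n : nat, sic_at (acs_op U) n%:Z) -> SIC U.
Proof.
by move/sic_units; rewrite op_all_unit_l op_all_unit_r SIC_units => -[].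
Qed.

Definition idealizer_deg0 := forall b : U,
  (forall x, x \in NR_pred U 1 -> b * x \in NR_pred U 1) ->
  exists2 s, s \in homog U 0 & b - s \in NR_pred U 1.

Definition left_unit_at p := exists t : U, rank_sum p t /\
  forall a, a \in homog U p -> a - t * a \in NL U 1.

Hypothesis deg0 : idealizer_deg0.

Lemma pairing_nondeg (p : nat) (b : U) : (0 < p)%N -> b \in homog U (- p%:Z) ->
  (forall a, a \in homog U p%:Z -> b * a \in NL U 1) -> b \in NR_pred U 1.
Proof.
elim/ltn_ind: p b => p ih b p0 hb hba.
have pos q x : (1 <= q)%R -> x \in homog U q -> b * x \in NR_pred U 1.
  move=> q1 hx; have hbx : b * x \in homog U (q - p%:Z) by rewrite addrC; apply: homogM.
  have [pq|qp|qp] := ltgtP p%:Z q.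
  - by apply: NR_pos hbx _; lia.
  - have hbx' : b * x \in homog U (- `|p%:Z - q|%N%:Z).
      by rewrite (_ : - _ = q - p%:Z :> int) //; lia.
    apply: ih hbx' _; try lia; move=> a ha; rewrite -mulrA; apply: hba.
    by rewrite (_ : p%:Z = q + `|p%:Z - q|%N%:Z) ?homogM //; lia.
  - rewrite -qp in hx; rewrite NR0; first exact: hba.
    exact: homogNM0 hb hx.
have [s hs bs] : exists2 s, s \in homog U 0 & b - s \in NR_pred U 1.
  apply: deg0 => x hx; have [t [_ ->]] := hc_dec x; rewrite mulr_sumr.
  apply: rpred_sum => q _; have hq := homog_hc q x.
  have [q1|q1] := leP 1 q; first exact: pos q1 hq.
  have hxq : hc q x \in NL U (1 - q) by rewrite -(NR_homog _ hq) NR_hc.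
  have [v [hv xv]] := NL_factor (1 - q + p%:Z) hxq hq.
  rewrite -(subrK v (hc q x)) mulrDr rpredD //.
    have hvq : v \in homog U q.
      by move: hv; apply: psum_closed => y z [j [_ hy hz]]; rewrite -[q](addrK j); apply: homogM.
    have hxv : hc q x - v \in NR_pred U (1 + p%:Z).
      have hh : hc q x - v \in homog U q by rewrite rpredB.
      by rewrite (NR_homog _ hh) addrAC.
    by have := NR_left hxv hb; rewrite addrK.
  elim: hv => [|y z w [j [hj hy _]] _ ihv]; first by rewrite mulr0 rpred0.
  by rewrite mulrDr rpredD // mulrA NR_right //; apply: pos hy; lia.
have := NR_hc (- p%:Z) bs; rewrite hcB (homogP _ _ hb) (hc_homog _ hs).
by case: eqP => [|_]; [lia | rewrite subr0].
Qed.

Lemma sic_of_left_units : (forall p : nat, (0 < p)%N -> left_unit_at p%:Z) ->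
  forall n : nat, sic_at U n%:Z.
Proof.
move=> h [|n].
  exists 1; split=> [|a _|b _]; rewrite ?mul1r ?mulr1 ?subrr ?rpred0 //.
  by rewrite -[1 : U]mulr1; apply: psum_mul; rewrite oppr0 !homog1.
have [t [ht hta]] := h n.+1 isT; exists t; split=> // b hb.
apply: (pairing_nondeg (p := n.+1)) => // [|a ha].
  by rewrite rpredB // homogM0r // (rank_sum_homog ht).
by rewrite mulrBl -mulrA -mulrBr; apply: NL_left; apply: hta.
Qed.
End SicOfUnits.

Section Spread.
Variables (k : comPzRingType) (U : acs_alg k) (R : kalg k).

(* Encodes 1 (x) v = sum_i r_i (x) y_i x_i v in R (x)_k (U / N_L^1 U) for v of
   degree p, through the universal property of the tensor product: unlike an
   equality of tensors, this form is stable under passing to opposite rings. *)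
Definition spreads (p : int) (s : seq (R * (U * U))) :=
  forall (V : zmodType) (f : R -> U -> V),
    (forall r r' u, f (r + r') u = f r u + f r' u) ->
    (forall r u u', f r (u + u') = f r u + f r u') ->
    (forall r a u, f (r * kstr R a) u = f r (kstr U a * u)) ->
    (forall r u, u \in NL U 1 -> f r u = 0) ->
    forall v, v \in homog U p -> f 1 v = \sum_(t <- s) f t.1 (t.2.1 * t.2.2 * v).

Definition spread (p : int) := exists2 s, spreads p s &
  forall t, t \in s -> t.2.1 \in homog U p /\ t.2.2 \in homog U (- p).

Lemma spreads_mod p s (V : zmodType) (Q : zmodClosed V) (g : R -> U -> V) : spreads p s ->
  (forall r r' u, g (r + r') u - (g r u + g r' u) \in Q) ->
  (forall r u u', g r (u + u') - (g r u + g r u') \in Q) ->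
  (forall r a u, g (r * kstr R a) u - g r (kstr U a * u) \in Q) ->
  (forall r u, u \in NL U 1 -> g r u \in Q) ->
  forall v, v \in homog U p ->
    g 1 v - \sum_(t <- s) g t.1 (t.2.1 * t.2.2 * v) \in Q.
Proof.
move=> hs gDl gDr gk g0 v hv; pose W := {ideal_quot Q}.
have piD x y : \pi_W (x + y) = \pi_W x + \pi_W y by rewrite -(raddfD \pi_({ideal_quot Q})).
apply/qpiE; rewrite (additive_sum _ _ piD); apply: (hs W (fun r u => \pi_W (g r u))) => //.
- by move=> r r' u; rewrite -piD; apply/qpiE.
- by move=> r u u'; rewrite -piD; apply/qpiE.
- by move=> r a u; apply/qpiE.
- by move=> r u hu; rewrite -(additive0 piD); apply/qpiE; rewrite subr0 g0.
Qed.
End Spread.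

Section TensorSums.
Variables (k : comPzRingType) (S R T : kalg k) (X : bimod S R) (Y : bimod R T).
Variables (I : Type) (s : seq I) (F : I -> tens X Y).

Lemma tens_lact_sum a : tens_lact a (\sum_(i <- s) F i) = \sum_(i <- s) tens_lact a (F i).
Proof. exact: (additive_sum _ _ (@tens_lactD _ _ _ _ X Y a)). Qed.
Lemma tens_ract_sum a : tens_ract (\sum_(i <- s) F i) a = \sum_(i <- s) tens_ract (F i) a.
Proof. exact: (additive_sum _ _ (@tens_ractD _ _ _ _ X Y a)). Qed.
Lemma tlift_sum (V : zmodType) (f : X -> Y -> V) : balanced f ->
  tlift f (\sum_(i <- s) F i) = \sum_(i <- s) tlift f (F i).
Proof. by move=> fb; apply: additive_sum (tliftD fb). Qed.
End TensorSums.

Section RightExtraction.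
Variables (k : comPzRingType) (U : acs_alg k) (R : kalg k).
Hypothesis equiv : adjoint_equivalence (adj_r (zhu_r U 0) R).

Lemma adj_r_idealizer (phi : kalg_hom R (zhu U 0)) : idealizer_deg0 U.
Proof.
move=> b hb; pose M := res_l phi (regular (zhu U 0)).
have ht : tmk (1 : M) (Rcls 0 b) \in annr_pred (NRi U 1) (W := tensor M (Rmod U 0)).
  apply/annrP => u hu; rewrite [LHS]tens_ractE [_ <* u]Rcls_ract.
  by rewrite [Rcls _ _]rpi0 ?tmk0r //; apply: hb.
pose t : omega_r (zhu_r U 0) (tensor M (Rmod U 0)) :=
  (exist _ (tmk (1 : M) (Rcls 0 b)) ht : annr (NRi U 1) (tensor M (Rmod U 0))).
have /iso_bij[_ /(_ t)[m /(congr1 val) /= mE]] := equiv.1 M.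
have bal : balanced (fun (m : M) (x : Rmod U 0) => (m : zhu U 0) *> x).
  split=> [x x' y|x y y'|x r y]; [exact: lactDl | exact: lactDr | exact: lactA].
move/(congr1 (tlift (fun (m : M) (x : Rmod U 0) => (m : zhu U 0) *> x))): mE.
rewrite !(tlift_tmk bal) lact1; have [s [hs ->]] := zrepr (m : zhu U 0).
rewrite [LHS]Rcls_lact mulr1 => /esym/RclsE bs; by exists s.
Qed.

Section Spread.
Variable p : nat.
Let X : bimod R (base_alg k) := res_r (kstr_hom R) (regular R).
Let Y : bimod (base_alg k) U := res_l (kstr_hom (zhu U p)) (Rmod U p).

Let exW : exhaustive_r (tensor X Y).
Proof.
move=> t; rewrite (tens_sum t); apply: exhaustive_r_sum => -[x y] /=.
have [m /annrP hm] := @rquot_exhaustive _ _ _ (zhu_r U p) y; exists m.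
by apply/annrP => v hv; rewrite [LHS]tens_ractE [_ <* v]hm // tmk0r.
Qed.

Lemma adj_r_spread : spread U R p%:Z.
Proof.
have /iso_bij[_ /(_ (tmk (1 : X) (Rcls p 1 : Y)))[t tE]] :=
  equiv.2 (exist (fun W : BMod R U => exhaustive_r W) (tensor X Y) exW).
have {tE} E : tmk (1 : X) (Rcls p 1 : Y) =
    \sum_(wx <- repr t) val wx.1 <* repr (wx.2 : rquo _) :> tensor X Y.
  by rewrite -tE.
exists (flatten [seq [seq (rx.1, (hc p%:Z (repr (rx.2 : rquo _)),
    hc (- p%:Z) (repr (wx.2 : rquo _)))) | rx <- repr (val wx.1)] | wx <- repr t]);
  last by move=> _ /flatten_mapP[wx _ /mapP[rx _ ->]] /=; rewrite !homog_hc.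
move=> V f fDl fDr fk f0 v hv.
have fN r u u' : u - u' \in NL U 1 -> f r u = f r u'.
  by move=> h; rewrite -(subrK u' u) fDr f0 ?add0r.
have hcr (u u' : U) : u - u' \in NR_pred U p.+1%:Z -> hc p%:Z u - hc p%:Z u' \in NL U 1.
  move=> /(NR_hc p%:Z); rewrite (NR_homog _ (homog_hc _ _)) hcB.
  by rewrite (_ : p.+1%:Z - p%:Z = 1) //; lia.
pose F (r : X) (x : Y) := f r (hc p%:Z (repr (x : rquo _))).
have FE (r : X) u : F r (Rcls p u) = f r (hc p%:Z u) by apply/fN/hcr/(RclsE p); rewrite /Rcls reprK.
have bal : balanced F.
  split=> [r r' x|r x x'|r a x]; first exact: fDl.
    have [u ->] := Rrepr x; have [u' ->] := Rrepr x'.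
    by rewrite [_ + _]RclsD !FE hcD fDr.
  have [u ->] := Rrepr x.
  have -> : a *> (Rcls p u : Y) = Rcls p (u * kstr U a).
    by rewrite [LHS](@lractk k _ _ (Rmod U p)); apply: Rcls_ract.
  by rewrite !FE -kstrC hck -fk.
have Fract (w : tens X Y) z : tlift F (tens_ract w z) =
    \sum_(rx <- repr w) f rx.1 (hc p%:Z (repr (rx.2 : rquo _) * z)).
  rewrite {1}(tens_sum w) tens_ract_sum.
  rewrite (tlift_sum _ _ bal); apply: eq_bigr => -[r x] _ /=.
  by rewrite tens_ractE (tlift_tmk bal) -FE; congr (F r _).
have -> : f 1 v = tlift F (tmk (1 : X) (Rcls p v : Y)).
  by rewrite (tlift_tmk bal) FE (homogP _ _ hv).
have -> : tmk (1 : X) (Rcls p v : Y) = tens_ract (tmk (1 : X) (Rcls p 1 : Y)) v.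
  by rewrite tens_ractE [_ <* v]Rcls_ract mul1r.
rewrite E tens_ract_sum (tlift_sum _ _ bal).
rewrite big_flatten /= big_map; apply: eq_bigr => -[w x] _ /=; rewrite big_map /=.
set u := repr x.
have -> : tens_ract (tens_ract (val w) u) v = tens_ract (val w) (u * v).
  by rewrite -[RHS]/((val w : tensor X Y) <* (u * v)) ractA.
have [s [us uE]] := hc_dec u.
rewrite [in LHS]uE mulr_suml; have /annrP hw := valP (w : annr _ _).
have -> : tens_ract (val w) (\sum_(d <- s) hc d u * v) =
    \sum_(d <- s) tens_ract (val w) (hc d u * v).
  exact: (additive_sum _ _ (fun a b => @ractDr _ _ _ (tensor X Y) (val w) a b)).
rewrite (tlift_sum _ _ bal).
have vanish d : d != - p%:Z -> tlift F (tens_ract (val w) (hc d u * v)) = 0.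
  move=> dp; have hd := homogM (homog_hc d u) hv.
  have [d0|d0] := leP 1 (d + p%:Z).
    have -> : tens_ract (val w) (hc d u * v) = 0 by apply: hw; apply: NR_pos hd d0.
    exact: (additive0 (tliftD bal)).
  rewrite Fract big1 // => rx _; apply: f0; apply: NL_hc.
  by apply: (NL_mul_neg (j := - (d + p%:Z))); [rewrite opprK | lia].
have main : tlift F (tens_ract (val w) (hc (- p%:Z) u * v)) =
    \sum_(rx <- repr (val w)) f rx.1 (hc p%:Z (repr (rx.2 : rquo _)) * hc (- p%:Z) u * v).
  rewrite Fract; apply: eq_bigr => rx _.
  by rewrite (hcMr _ _ (homogNM0 (homog_hc _ _) hv)) subr0 mulrA.
have [ps|ps] := boolP (- p%:Z \in s).
  by rewrite (bigD1_seq (- p%:Z)) //= big1 ?addr0 // => d; apply: vanish.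
rewrite big_seq big1 => [|d ds]; last by apply: vanish; apply: contraNneq ps => <-.
have -> : hc (- p%:Z) u = 0.
  rewrite uE hc_sum big_seq big1 // => d ds; rewrite hc_hc.
  by case: eqP => // dp; rewrite dp ds in ps.
by rewrite big1 // => rx _; rewrite mulr0 mul0r f0 ?rpred0.
Qed.
End Spread.
End RightExtraction.

Lemma kstrCA (k : comPzRingType) (A : kalg k) c (x y : A) :
  kstr A c * (x * y) = x * (kstr A c * y).
Proof. by rewrite mulrA kstrC mulrA. Qed.

(** * Descent along a dual basis *)

Section ScalarThickening.
Variables (k : comPzRingType) (U : acs_alg k).
Implicit Types (B X : set k) (u v a : U).

Definition scaled B (x y : U) := exists2 z, B z & x = kstr U z.

Definition NLk B : {pred U} :=
  fun u => `[< exists2 v, psum (scaled B) v & u - v \in NL U 1 >].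

Lemma NLkP B u :
  reflect (exists2 v, psum (scaled B) v & u - v \in NL U 1) (u \in NLk B).
Proof. exact: asboolP. Qed.

Lemma scaledMl B a v : psum (scaled B) v -> psum (scaled B) (a * v).
Proof.
elim=> [|_ y w [z Bz ->] _ ih]; first by rewrite mulr0; apply: psum0.
by rewrite mulrDr mulrA -kstrC -mulrA; apply: psum_cons => //; exists z.
Qed.

Lemma NLk_closed B : zmod_closed (NLk B).
Proof.
split; first by apply/NLkP; exists 0; rewrite ?subr0 ?rpred0 //; apply: psum0.
move=> u u' /NLkP[v hv uv] /NLkP[v' hv' uv']; apply/NLkP; exists (v - v').
  by apply: psumD => //; rewrite -mulN1r; apply: scaledMl.
by rewrite opprD addrACA -opprD rpredB.
Qed.
HB.instance Definition _ B := GRing.isZmodClosed.Build U (NLk B) (NLk_closed B).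

Lemma NL_NLk B u : u \in NL U 1 -> u \in NLk B.
Proof. by move=> hu; apply/NLkP; exists 0; rewrite ?subr0 //; apply: psum0. Qed.

Lemma NLk_congr B u v : u - v \in NL U 1 -> v \in NLk B -> u \in NLk B.
Proof. by move=> /(NL_NLk B) uv hv; rewrite -(subrK v u) rpredD. Qed.

Lemma kstr_NLk B z a : B z -> kstr U z * a \in NLk B.
Proof.
move=> Bz; apply/NLkP; exists (kstr U z * a); rewrite ?subrr ?rpred0 //.
by apply: psum_mul; exists z.
Qed.

Lemma NLk_left B a u : u \in NLk B -> a * u \in NLk B.
Proof.
move=> /NLkP[v hv uv]; apply/NLkP; exists (a * v); first exact: scaledMl.
by rewrite -mulrBr; apply: NL_left.
Qed.

Lemma NLk_right B u v : v \in homog U 0 -> u \in NLk B -> u * v \in NLk B.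
Proof.
move=> hv /NLkP[w hw uw]; apply/NLkP; exists (w * v); last by rewrite -mulrBl NLM0.
by apply: psumMr hw => x y [z Bz ->]; exists z.
Qed.

Lemma NLk_hc B p u : u \in NLk B -> hc p u \in NLk B.
Proof.
move=> /NLkP[v hv uv]; apply/NLkP; exists (hc p v); last by rewrite -hcB; apply: NL_hc.
elim: hv {uv} => [|_ y w [z Bz ->] _ ih]; first by rewrite (additive0 (hcD p)); apply: psum0.
by rewrite hcD hck; apply: psum_cons => //; exists z.
Qed.

Lemma NLk_adjoin B z u : u \in NLk (B `|` [set z])%classic ->
  exists l, u - kstr U z * l \in NLk B.
Proof.
move=> /NLkP[v hv uv]; suff [l hl] : exists l, v - kstr U z * l \in NLk B.
  by exists l; rewrite -(subrKA v) rpredD // NL_NLk.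
elim: hv {uv} => [|_ y w [c [Bc|->] ->] _ [l hl]].
- by exists 0; rewrite mulr0 subr0 rpred0.
- by exists l; rewrite -addrA rpredD // kstr_NLk.
- by exists (y + l); rewrite mulrDr opprD addrACA subrr add0r.
Qed.

Lemma NLk_sub B X u : (B `<=` X)%classic -> u \in NLk B -> u \in NLk X.
Proof.
move=> BX /NLkP[v hv uv]; apply/NLkP; exists v => //.
by apply: psum_mono hv => x y [z /BX Xz ->]; exists z.
Qed.
End ScalarThickening.
Arguments NLk {k} U B.

Section Chains.
Variables (R : pzRingType) (T : Type) (F : set (set T)) (P : set T -> R -> R -> Prop).
Hypothesis Ftot : total_on F subset.
Hypothesis Pmono : forall X Y x y, (X `<=` Y)%classic -> P X x y -> P Y x y.
Hypothesis Pfin : forall x y, P (\bigcup_(X in F) X)%classic x y ->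
  exists2 X, X = set0 \/ F X & P X x y.

Lemma chain_join X Y : X = set0 \/ F X -> Y = set0 \/ F Y ->
  exists2 Z, Z = set0 \/ F Z & (X `<=` Z)%classic /\ (Y `<=` Z)%classic.
Proof.
move=> [->|FX] FY; first by exists Y => //; split; [apply: sub0set|].
case: FY => [->|FY].
  by exists X; [right | split; [|apply: sub0set]].
have [XY|YX] := Ftot FX FY.
  by exists Y; [right | split; [exact: XY | exact: subset_refl]].
by exists X; [right | split; [exact: subset_refl | exact: YX]].
Qed.

Lemma psum_chain u : psum (P (\bigcup_(X in F) X)%classic) u ->
  exists2 X, X = set0 \/ F X & psum (P X) u.
Proof.
elim=> [|x y v hxy _ [X FX hv]]; first by exists set0; [left | apply: psum0].
have [Y FY hY] := Pfin hxy; have [Z FZ [XZ YZ]] := chain_join FX FY; exists Z => //.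
apply: psum_cons; first exact: Pmono YZ hY.
by apply: psum_mono hv => x' y'; apply: Pmono XZ.
Qed.
End Chains.

Section Descent.
Variables (k : comPzRingType) (U : acs_alg k) (R : kalg k) (p : int).
Variables (lam : R -> U) (n : nat) (w : 'I_n -> U) (f : 'I_n -> U -> R).
Hypothesis lam_homog : forall r, lam r \in homog U 0.
Hypothesis lamD : forall r r', lam (r + r') - (lam r + lam r') \in NL U 1.
Hypothesis lamM : forall r r', lam (r * r') - lam r * lam r' \in NL U 1.
Hypothesis lamk : forall c, lam (kstr R c) - kstr U c \in NL U 1.
Hypothesis w_homog : forall j, w j \in homog U p.
Hypothesis fD : forall j u v, f j (u + v) = f j u + f j v.
Hypothesis f0 : forall j u, u \in NL U 1 -> f j u = 0.
Hypothesis fr : forall j u r, f j (u * lam r) = f j u * r.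
Hypothesis basis : forall a, a \in homog U p -> a - \sum_j w j * lam (f j a) \in NL U 1.
Hypothesis hspread : spread U R p.
Implicit Types (B : set k) (a u v : U).

Definition good B := exists2 t : U, rank_sum p t &
  forall a, a \in homog U p -> a - t * a \in NLk U B.

Lemma NLk_basis B x : (forall j, x * w j \in NLk U B) ->
  forall a, a \in homog U p -> x * a \in NLk U B.
Proof.
move=> h a /basis ha; rewrite -(subrK (\sum_j w j * lam (f j a)) a) mulrDr rpredD //.
  by rewrite NL_NLk // NL_left.
by rewrite mulr_sumr; apply: rpred_sum => j _; rewrite mulrA NLk_right.
Qed.

Lemma good_basis B : (exists2 t : U, rank_sum p t & forall j, w j - t * w j \in NLk U B) -> good B.
Proof.
move=> [t ht h]; exists t => // a ha; rewrite -{1}[a]mul1r -mulrBl.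
by apply: NLk_basis ha => j; rewrite mulrBl mul1r.
Qed.

Lemma good_chain (F : set (set k)) : total_on F subset ->
  good (\bigcup_(X in F) X)%classic -> exists2 X, X = set0 \/ F X & good X.
Proof.
move=> Ftot [t ht h].
have key u : u \in NLk U (\bigcup_(X in F) X)%classic -> exists2 X, X = set0 \/ F X & u \in NLk U X.
  move=> /NLkP[v hv uv].
  have [X Y x y XY [z Xz ->]|x y [z [X FX Xz] ->]|X FX hX] := psum_chain (P := fun B => scaled B) Ftot _ _ hv.
  - by exists z => //; apply: XY.
  - by exists X; [right | exists z].
  - by exists X => //; apply/NLkP; exists v.
suff [X FX hX] : exists2 X, X = set0 \/ F X & forall j, w j - t * w j \in NLk U X.
  by exists X => //; apply: good_basis; exists t.
suff [X FX hX] : exists2 X, X = set0 \/ F X &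
    forall j, j \in enum 'I_n -> w j - t * w j \in NLk U X.
  by exists X => // j; apply: hX; rewrite mem_enum.
elim: (enum _) => [|j s [X FX hX]].
  by exists set0; [left | move=> j /[1!in_nil]].
have [Y FY hY] := key _ (h _ (w_homog j)); have [Z FZ [XZ YZ]] := chain_join Ftot FX FY.
by exists Z => // i /predU1P[->|/hX]; [apply: NLk_sub YZ hY | apply: NLk_sub].
Qed.

Lemma coefB j u v : f j (u - v) = f j u - f j v.
Proof. by rewrite fD (additiveN (fD j)). Qed.

Lemma coefk j c u : f j (kstr U c * u) = f j u * kstr R c.
Proof.
rewrite -fr kstrC; apply/subr0_eq; rewrite -coefB -mulrBr; apply/f0/NL_left.
by rewrite -opprB rpredN.
Qed.

Lemma lift0 : lam 0 \in NL U 1.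
Proof. by have := lamD 0 0; rewrite addr0 opprD addrA subrr add0r rpredN. Qed.

Lemma lift1 : lam 1 - 1 \in NL U 1.
Proof. by have := lamk 1; rewrite !rmorph1. Qed.

Section Maximal.
Variable B : set k.
Hypothesis Bbad : ~ good B.
Hypothesis Bmax : forall z, ~ B z -> good (B `|` [set z])%classic.

Lemma maximal_scalar z : kstr U z \in NLk U B -> B z.
Proof.
move=> hz; apply: contrapT => /Bmax[t ht h]; apply: Bbad; exists t => // a /h /NLk_adjoin[l hl].
by rewrite -(subrK (kstr U z * l) (a - _)) rpredD // kstrC NLk_left.
Qed.

Section Adjoin.
Variables (z : k) (e : U) (l : 'I_n -> U).
Hypothesis e0 : e \in homog U 0.
Hypothesis l_homog : forall j, l j \in homog U p.
Hypothesis el : forall j, e * w j - kstr U z * l j \in NLk U B.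

Let s u := \sum_j l j * lam (f j u).

Lemma shift_homog u : s u \in homog U p.
Proof. by apply: rpred_sum => j _; apply: homogM0r. Qed.

Lemma shiftD u v : s (u + v) - (s u + s v) \in NL U 1.
Proof.
rewrite /s -big_split -sumrB /=; apply: rpred_sum => j _.
by rewrite /= -mulrDr -mulrBr fD NL_left.
Qed.

Lemma shift_NL u : u \in NL U 1 -> s u \in NL U 1.
Proof. by move=> hu; apply: rpred_sum => j _; rewrite f0 // NL_left // lift0. Qed.

Lemma shiftk c u : s (kstr U c * u) - kstr U c * s u \in NL U 1.
Proof.
rewrite /s mulr_sumr -sumrB; apply: rpred_sum => j _.
rewrite coefk [kstr U c * _]kstrC -mulrA -mulrBr NL_left //.
by rewrite -(subrKA (lam (f j u) * lam (kstr R c))) rpredD // -mulrBr NL_left.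
Qed.

Lemma shift_NLk u : u \in NLk U B -> s u \in NLk U B.
Proof.
move=> /NLkP[v hv uv]; have := shiftD v (u - v); rewrite [v + _]addrC subrK => huv.
apply: NLk_congr huv _; rewrite rpredD //; last exact/NL_NLk/shift_NL.
elim: hv {uv} => [|_ y v' [c Bc ->] _ ih]; first by apply/NL_NLk/shift_NL/rpred0.
apply: NLk_congr (shiftD _ _) _; rewrite rpredD //.
by apply: NLk_congr (shiftk _ _) _; apply: kstr_NLk.
Qed.

Lemma scale_shift a : a \in homog U p -> kstr U z * s a - e * a \in NLk U B.
Proof.
move=> /basis ha; rewrite -(subrKA (e * \sum_j w j * lam (f j a))) rpredD //; last first.
  by rewrite -mulrBr NLk_left // -opprB rpredN NL_NLk.
rewrite /s !mulr_sumr -sumrB; apply: rpred_sum => j _.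
by rewrite !mulrA -mulrBl NLk_right // -opprB rpredN.
Qed.

Lemma shift_linear a x : a \in homog U p -> x \in homog U 0 ->
  e * s (a * x) - e * s a * x \in NLk U B.
Proof.
move=> ha hx; rewrite -mulrA -mulrBr; set d := s _ - _.
have hd : d \in homog U p by rewrite rpredB ?homogM0r ?shift_homog.
have zd : kstr U z * d \in NLk U B.
  rewrite /d mulrBr mulrA -(subrKA (e * (a * x))) rpredD ?scale_shift ?homogM0r //.
  by rewrite mulrA -mulrBl NLk_right // -opprB rpredN scale_shift.
rewrite -(subrK (kstr U z * s d) (e * d)) rpredD //.
  by rewrite -opprB rpredN scale_shift.
by apply: NLk_congr (shift_NLk zd); rewrite -opprB rpredN shiftk.
Qed.

(* a |-> x (e s(a)) is U_0-linear modulo NLk U B, so it maps y x' a, for each term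
   y x' of the spreading sum, to x (e s(y)) x' a. *)
Lemma rank_shift x : x \in homog U (- p) -> exists2 x', x' \in homog U (- p) &
  forall a, a \in homog U p -> x * (e * s a) - x' * a \in NLk U B.
Proof.
move=> hx; have [t tE ht] := hspread.
exists (\sum_(i <- t) lam i.1 * (x * (e * s i.2.1)) * i.2.2).
  rewrite big_seq; apply: rpred_sum => i /ht[hy hx'].
  apply: homogM0l hx'; apply: homogM0l => //.
  by apply: homogNM0 hx _; rewrite homogM0l // shift_homog.
move=> a ha.
pose X u := x * (e * s u).
have X0 u : X u \in homog U 0 by apply: homogNM0 hx _; rewrite homogM0l // shift_homog.
have XE u v : s u - v \in NL U 1 -> X u - x * (e * v) \in NL U 1.
  by move=> h; rewrite -!mulrBr !NL_left.
have hX : lam 1 * X a - \sum_(i <- t) lam i.1 * X (i.2.1 * i.2.2 * a) \in NLk U B.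
  apply: (@spreads_mod _ _ _ _ _ _ (NLk U B) (fun r u => lam r * X u)) tE _ _ _ _ _ ha.
  - by move=> r r' u; rewrite -mulrDl -mulrBl NL_NLk // NLM0.
  - move=> r u u'; rewrite -mulrDr -mulrBr NL_NLk // NL_left //.
    by have := XE _ _ (shiftD u u'); rewrite !mulrDr.
  - move=> r c u; rewrite -(subrKA (lam r * kstr U c * X u)) rpredD //.
      rewrite -mulrBl NL_NLk // NLM0 // -(subrKA (lam r * lam (kstr R c))) rpredD //.
      by rewrite -mulrBr NL_left.
    rewrite -mulrA -mulrBr NL_NLk // NL_left // -opprB rpredN.
    by have := XE _ _ (shiftk c u); rewrite -!kstrCA.
  - move=> r u /shift_NL hu; apply/NL_NLk/NL_left.
    by have := XE u 0; rewrite subr0 !mulr0 subr0; apply.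
rewrite -(subrKA (lam 1 * X a)) rpredD //.
  rewrite -[X in X - _]mul1r -mulrBl; apply/NL_NLk/NLM0; last exact: X0.
  by rewrite -opprB rpredN lift1.
rewrite -(subrKA (\sum_(i <- t) lam i.1 * X (i.2.1 * i.2.2 * a))) rpredD //.
rewrite mulr_suml -sumrB big_seq; apply: rpred_sum => i /ht[hy hx'].
rewrite -!mulrA -mulrBr NLk_left // -mulrBr NLk_left // [e * (_ * _)]mulrA.
by apply: shift_linear => //; apply: homogNM0 hx' ha.
Qed.

Lemma rank_sum_shift t : rank_sum p t -> exists2 t', rank_sum p t' &
  forall a, a \in homog U p -> t * (e * s a) - t' * a \in NLk U B.
Proof.
elim=> [|y x v [hy hx] _ [t' ht' tE]].
  by exists 0; [apply: psum0 | move=> a _; rewrite !mul0r subrr rpred0].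
have [x' hx' xE] := rank_shift hx; exists (y * x' + t').
  by apply: psumD => //; apply: psum_mul.
move=> a ha; rewrite !mulrDl opprD addrACA rpredD ?tE // -!mulrA -mulrBr NLk_left //.
exact: xE.
Qed.
End Adjoin.

(* If z is not in B, a rank sum t1 for B + (z) provides s with z s = e modulo B,
   where e = 1 - t1; then e e = z (e s) = t (e s) is again a rank sum t2. *)
Lemma maximal_rank z t : rank_sum p t ->
  (forall a, a \in homog U p -> kstr U z * a - t * a \in NLk U B) -> B z.
Proof.
move=> ht tE; apply: contrapT => /Bmax[t1 ht1 h1]; apply: Bbad.
have t10 := rank_sum_homog ht1.
have /choice[l hl] j : exists l, l \in homog U p /\ (1 - t1) * w j - kstr U z * l \in NLk U B.
  have /NLk_adjoin[l hl] := h1 _ (w_homog j); exists (hc p l); split; first exact: homog_hc.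
  have := NLk_hc p hl; rewrite !hcB hck (homogP _ _ (w_homog j)).
  by rewrite (homogP _ _ (homogM0l t10 (w_homog j))) mulrBl mul1r.
have e0 : 1 - t1 \in homog U 0 by rewrite rpredB // homog1.
have [t2 ht2 t2E] := rank_sum_shift e0 (fun j => (hl j).1) (fun j => (hl j).2) ht.
exists (t1 + t1 - t1 * t1 + t2).
  apply: psumD => //; apply: psumD; first exact: psumD.
  rewrite -mulNr; apply: psumMl ht1 => x y [hx hy]; split=> //.
  by rewrite homogM0l // rpredN.
move=> a ha; set s := fun u => \sum_j l j * lam (f j u).
have ee : (1 - t1) * (1 - t1) * a - t2 * a \in NLk U B.
  have sa : s a \in homog U p by apply: shift_homog => j; have [] := hl j.
  have esa : (1 - t1) * s a \in homog U p by rewrite homogM0l.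
  rewrite -(subrKA (t * ((1 - t1) * s a))) rpredD ?t2E //.
  rewrite -(subrKA (kstr U z * ((1 - t1) * s a))) rpredD ?tE //.
  rewrite [kstr U z * _]kstrC -mulrA -mulrA -mulrBr NLk_left // -opprB rpredN -kstrC.
  by apply: scale_shift ha => j; have [] := hl j.
have -> : a - (t1 + t1 - t1 * t1 + t2) * a = (1 - t1) * (1 - t1) * a - t2 * a => //.
rewrite mulrDl opprD addrA; congr (_ - _); rewrite -{1}[a]mul1r -mulrBl; congr (_ * _).
by rewrite mulrBr mulr1 mulrBl mul1r -addrA opprD addrA.
Qed.

Lemma maximal1 : ~ B 1.
Proof.
move=> B1; apply: Bbad; exists 0; first exact: psum0.
by move=> a _; rewrite mul0r subr0 -[a]mul1r -(rmorph1 (kstr U)) kstr_NLk.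
Qed.

Lemma maximal_prime z z' : B (z * z') -> B z \/ B z'.
Proof.
move=> Bzz; apply: contrapT => /not_orP[/Bmax[t ht h] Bz']; apply: Bz'.
apply: (maximal_rank (t := kstr U z' * t)).
  by apply: psumMl ht => x y [hx hy]; rewrite homogM0l ?homog_kstr.
move=> a /h /NLk_adjoin[l hl]; rewrite -mulrA -mulrBr.
rewrite -(subrK (kstr U z * l) (a - _)) mulrDr rpredD //; first exact: NLk_left.
by rewrite mulrA -rmorphM mulrC kstr_NLk.
Qed.

Lemma maximalB z z' : B z -> B z' -> B (z - z').
Proof.
by move=> Bz Bz'; apply: maximal_scalar; rewrite rmorphB rpredB // -[kstr U _]mulr1 kstr_NLk.
Qed.

Lemma maximalD z z' : B z -> B z' -> B (z + z').
Proof.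
by move=> Bz Bz'; apply: maximal_scalar; rewrite rmorphD rpredD // -[kstr U _]mulr1 kstr_NLk.
Qed.

Lemma maximalM z z' : B z -> B (z' * z).
Proof. by move=> Bz; apply: maximal_scalar; rewrite mulrC rmorphM kstr_NLk. Qed.

Lemma maximal_prod (I : Type) (t : seq I) (z : I -> k) :
  (forall i, ~ B (z i)) -> ~ B (\prod_(i <- t) z i).
Proof.
move=> hz; elim: t => [|i t ih]; first by rewrite big_nil; apply: maximal1.
by rewrite big_cons => /maximal_prime[/hz|].
Qed.

(* psum (adjoined S) is the k-submodule of R generated by B R and S. *)
Definition adjoined (S : set R) (x y : R) := exists2 z, x = kstr R z & B z \/ S y.

Lemma adjoined_lift r : psum (adjoined set0) r -> lam r \in NLk U B.
Proof.
elim=> [|_ y v [z -> [Bz|//]] _ ih]; first exact/NL_NLk/lift0.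
apply: NLk_congr (lamD _ _) _; rewrite rpredD //.
apply: NLk_congr (lamM _ _) _; apply: NLk_right => //.
by apply: NLk_congr (lamk _) _; rewrite -[kstr U _]mulr1 kstr_NLk.
Qed.

Lemma adjoined0 z : psum (adjoined set0) (kstr R z) -> B z.
Proof.
move=> /adjoined_lift h; apply: maximal_scalar; apply: NLk_congr h.
by rewrite -opprB rpredN.
Qed.

Lemma adjoinedMl S c r : psum (adjoined S) r -> psum (adjoined S) (kstr R c * r).
Proof.
apply: psumMl => _ y [z -> h]; exists (c * z); first by rewrite rmorphM.
by case: h => [/maximalM|]; [left | right].
Qed.

Lemma adjoinedB S r r' : psum (adjoined S) r -> psum (adjoined S) r' -> psum (adjoined S) (r - r').
Proof.
move=> h h'; apply: psumD => //; rewrite -mulN1r -(rmorph1 (kstr R)) -rmorphN.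
exact: adjoinedMl.
Qed.

Lemma rank_one : exists S : set R,
  (forall z, psum (adjoined S) (kstr R z) -> B z) /\
  forall r, exists z c, ~ B z /\ psum (adjoined S) (kstr R z * r - kstr R c).
Proof.
have [F FP Ftot|S [SB Smax]] := @Zorn_bigcup R
    (fun S => forall z, psum (adjoined S) (kstr R z) -> B z).
  move=> z hz.
  have [X Y x y XY [c -> h]|x y [c -> [Bc|[X FX Xy]]]|X [->|FX] hX] := psum_chain (P := adjoined) Ftot _ _ hz.
  - by exists c => //; case: h => [Bc|/XY]; [left|right].
  - by exists set0; [left | exists c => //; left].
  - by exists X; [right | exists c => //; right].
  - exact: adjoined0 hX.
  - exact: FP FX _ hX.
exists S; split=> // r; have [Sr|Sr] := pselect (S r).
  exists 1, 0; split; first exact: maximal1.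
  by rewrite raddf0 subr0; apply: psum_mul; exists 1 => //; right.
have [z [hz Bz]] : exists z, psum (adjoined (S `|` [set r])%classic) (kstr R z) /\ ~ B z.
  apply: contrapT => h; apply: (Smax (S `|` [set r])%classic).
    by split=> [x|/(_ r)]; [left | move=> hr; apply/Sr/hr; right].
  by move=> z hz; apply: contrapT => Bz; apply: h; exists z.
have [c hc] : exists c, psum (adjoined S) (kstr R z - kstr R c * r).
  elim: hz => [|_ y v [d -> hd] _ [c hc]].
    by exists 0; rewrite raddf0 mul0r subrr; apply: psum0.
  case: hd => [Bd|[Sy|->]].
  - by exists c; rewrite -addrA; apply: psum_cons => //; exists d => //; left.
  - by exists c; rewrite -addrA; apply: psum_cons => //; exists d => //; right.
  - by exists (d + c); rewrite rmorphD mulrDl opprD addrACA subrr add0r.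
exists c, z; split; last first.
  by rewrite -[_ - _]mul1r -opprB mulrN -mulNr -(rmorph1 (kstr R)) -rmorphN; apply: adjoinedMl.
move=> Bc; apply/Bz/SB; rewrite -(subrK (kstr R c * r) (kstr R z)); apply: psumD => //.
by apply: psum_mul; exists c => //; left.
Qed.

(* The functions k -> U vanishing modulo NLk U B at all multiples of some
   z0 outside B: the quotient by these is a localization at the prime B. *)
Definition germ0 : {pred k -> U} :=
  fun g => `[< exists2 z0, ~ B z0 & forall z, g (z * z0) \in NLk U B >].

Lemma germ0_closed : zmod_closed germ0.
Proof.
split; first by apply/asboolP; exists 1; [exact: maximal1 | move=> z; rewrite rpred0].
move=> g h /asboolP[y By gy] /asboolP[z Bz hz]; apply/asboolP; exists (y * z).
  by move=> /maximal_prime[].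
move=> c; rewrite -[(g - h) _]/(g _ - h _) rpredB //; first by rewrite [y * z]mulrC mulrA.
by rewrite mulrA.
Qed.

Lemma maximal_absurd : False.
Proof.
have [S [SB Sone]] := rank_one.
pose val z r := xget 0 [set c | psum (adjoined S) (kstr R z * r - kstr R c)]%classic.
have valE z r c : psum (adjoined S) (kstr R z * r - kstr R c) -> B (val z r - c).
  move=> hc; apply: SB; rewrite rmorphB.
  have hv : psum (adjoined S) (kstr R z * r - kstr R (val z r)).
    by apply: (@xgetPex _ 0 [set c | psum (adjoined S) (kstr R z * r - kstr R c)]%classic); exists c.
  by rewrite -(subrKA (kstr R z * r)) addrC -[kstr R _ - kstr R z * r]opprB; apply: adjoinedB.
have val_mul z y r c : psum (adjoined S) (kstr R y * r - kstr R c) -> B (val (z * y) r - z * c).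
  by move=> h; apply: valE; rewrite !rmorphM -mulrA -mulrBr; apply: adjoinedMl.
have scale c c' u : B (c - c') -> kstr U c * u - kstr U c' * u \in NLk U B.
  by move=> h; rewrite -mulrBl -rmorphB kstr_NLk.
pose Q : zmodClosed (k -> U) := HB.pack germ0 (GRing.isZmodClosed.Build _ germ0 germ0_closed).
have [t tE ht] := hspread.
have key v : v \in homog U p ->
    (fun z => kstr U (val z 1) * v - \sum_(i <- t) kstr U (val z i.1) * (i.2.1 * i.2.2 * v)) \in Q.
  move=> hv; rewrite [X in X \in _](_ : _ = (fun z => kstr U (val z 1) * v) -
    \sum_(i <- t) (fun z => kstr U (val z i.1) * (i.2.1 * i.2.2 * v))); last first.
    by apply/funext => z; rewrite -[RHS]/(_ - (\sum_(i <- t) _) z) fct_sumE.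
  apply: (@spreads_mod _ _ _ _ _ _ Q (fun r u z => kstr U (val z r) * u)) tE _ _ _ _ _ hv.
  - move=> r r' u; have [y [c [By hc]]] := Sone r; have [y' [c' [By' hc']]] := Sone r'.
    apply/asboolP; exists (y' * y) => [/maximal_prime[]//|z].
    rewrite -[X in X \in _]/(_ * u - (_ * u + _ * u)) -mulrDl -rmorphD; apply: scale.
    have h := val_mul (z * y') _ _ _ hc; have := val_mul (z * y) _ _ _ hc'.
    rewrite -(mulrA z y y') [y * y']mulrC => h'; rewrite -(mulrA z y' y) in h.
    have h2 : B (val (z * (y' * y)) (r + r') - (z * y' * c + z * y * c')).
      apply: valE; rewrite mulrDr !rmorphD opprD addrACA; apply: psumD.
        by rewrite mulrA rmorphM -mulrA [kstr R (_ * c)]rmorphM -mulrBr; apply: adjoinedMl.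
      by rewrite [y' * y]mulrC mulrA rmorphM -mulrA [kstr R (_ * c')]rmorphM -mulrBr; apply: adjoinedMl.
    by have := maximalB h2 (maximalD h h'); rewrite addrACA -opprD opprB addrA subrK.
  - move=> r u u'; apply/asboolP; exists 1; first exact: maximal1.
    by move=> z; rewrite -[X in X \in _]/(_ * (u + u') - (_ * u + _ * u')) mulrDr subrr rpred0.
  - move=> r a u; have [y [c [By hc]]] := Sone r; apply/asboolP; exists y => // z.
    rewrite -[X in X \in _]/(_ * u - _ * (_ * u)) mulrA -rmorphM; apply: scale.
    have h := maximalM a (val_mul z _ _ _ hc).
    have h2 : B (val (z * y) (r * kstr R a) - a * (z * c)).
      apply: valE; rewrite -kstrC kstrCA rmorphM -mulrA.
      rewrite [kstr R (a * _)]rmorphM -mulrBr; apply: adjoinedMl.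
      by rewrite [kstr R (z * c)]rmorphM -mulrBr; apply: adjoinedMl.
    by have := maximalB h2 h; rewrite mulrBr opprB addrA subrK [a * val _ _]mulrC.
  - move=> r u hu; apply/asboolP; exists 1; first exact: maximal1.
    by move=> z; apply/NL_NLk/NL_left.
have /choice[z zE] j : exists z, ~ B z /\ forall y,
    kstr U (y * z) * w j - \sum_(i <- t) kstr U (val (y * z) i.1) * (i.2.1 * i.2.2 * w j) \in NLk U B.
  have /asboolP[z Bz hz] := key _ (w_homog j); exists z; split=> // y.
  rewrite -(subrKA (kstr U (val (y * z) 1) * w j)) rpredD ?hz // scale //.
  rewrite -opprB -[- _]add0r; apply: (@maximalB 0).
    by apply: SB; rewrite raddf0; apply: psum0.
  by apply: valE; rewrite mulr1 subrr; apply: psum0.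
have Bz := @maximal_prod _ (enum 'I_n) z (fun j => (zE j).1).
set z0 := \prod_(i <- _) _ in Bz; apply: Bz.
apply: (maximal_rank (t := \sum_(i <- t) kstr U (val z0 i.1) * (i.2.1 * i.2.2))).
  rewrite big_seq; elim/big_ind: _ => [||i /ht[hy hx]]; first exact: psum0.
    by move=> *; apply: psumD.
  by rewrite mulrA; apply: psum_mul; rewrite homogM0l ?homog_kstr.
move=> a ha; rewrite -mulrBl; apply: NLk_basis ha => j.
have -> : z0 = (\prod_(i <- rem j (enum 'I_n)) z i) * z j.
  by rewrite /z0 (big_rem j) ?mem_enum //= mulrC.
set y := \prod_(i <- _) _; rewrite mulrBl mulr_suml.
under [X in _ - X]eq_bigr => i _ do rewrite -mulrA.
exact: (zE j).2.
Qed.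
End Maximal.

Lemma descent : left_unit_at U p.
Proof.
have [[t ht h]|bad0] := pselect (good set0).
  exists t; split=> // a /h /NLkP[v hv]; suff -> : v = 0 by rewrite subr0.
  by case: hv => // x y v' [z].
have [F FP Ftot|B [Bbad Bmax]] := @Zorn_bigcup k (fun B => ~ good B).
  by move=> /(good_chain Ftot)[X [->//|/FP]].
case: (maximal_absurd Bbad) => z Bz; apply: contrapT; apply: Bmax.
by split=> [x|/(_ z)]; [left | move=> h; apply/Bz/h; right].
Qed.
End Descent.

Section LeftExtraction.
Variables (k : comPzRingType) (U : acs_alg k) (R : kalg k).
Hypothesis equiv : adjoint_equivalence (adj_l (zhu_l U 0) R).

Lemma adj_l_idealizer (phi : kalg_hom R (zhu U 0)) : idealizer_deg0 (acs_op U).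
Proof.
move=> b hb; pose M := res_r phi (regular (zhu U 0)).
have ht : tmk (Lcls 0 (b : U)) (1 : M) \in annl_pred (NLi U 1) (W := tensor (Lmod U 0) M).
  apply/annlP => u hu; rewrite [LHS]tens_lactE [u *> _]Lcls_lact.
  rewrite [Lcls _ _]lpi0 ?tmk0l // -op_NR.
  by apply: (hb u); rewrite op_NR.
pose t : omega_l (zhu_l U 0) (tensor (Lmod U 0) M) :=
  (exist _ (tmk (Lcls 0 (b : U)) (1 : M)) ht : annl (NLi U 1) (tensor (Lmod U 0) M)).
have /iso_bij[_ /(_ t)[m /(congr1 val) /= mE]] := equiv.1 M.
have bal : balanced (fun (x : Lmod U 0) (m : M) => x <* (m : zhu U 0)).
  split=> [x x' y|x y y'|x r y]; [exact: ractDl | exact: ractDr | exact/esym/ractA].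
move/(congr1 (tlift (fun (x : Lmod U 0) (m : M) => x <* (m : zhu U 0)))): mE.
rewrite !(tlift_tmk bal) ract1; have [s [hs ->]] := zrepr (m : zhu U 0).
rewrite [LHS]Lcls_ract mul1r => /esym/LclsE bs; exists s; first by rewrite op_homog oppr0.
by rewrite op_NR.
Qed.

Section Spread.
Variable p : nat.
Let X : bimod U (base_alg k) := res_r (kstr_hom (zhu U p)) (Lmod U p).
Let Y : bimod (base_alg k) R := res_l (kstr_hom R) (regular R).

Let exW : exhaustive_l (tensor X Y).
Proof.
move=> t; rewrite (tens_sum t); apply: exhaustive_l_sum => -[x y] /=.
have [m /annlP hm] := @lquot_exhaustive _ _ _ (zhu_l U p) x; exists m.
by apply/annlP => v hv; rewrite [LHS]tens_lactE [v *> _]hm // tmk0l.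
Qed.

Lemma adj_l_spread : spread (acs_op U) (op_alg R) p%:Z.
Proof.
have /iso_bij[_ /(_ (tmk (Lcls p 1 : X) (1 : Y)))[t tE]] :=
  equiv.2 (exist (fun W : BMod U R => exhaustive_l W) (tensor X Y) exW).
have {tE} E : tmk (Lcls p 1 : X) (1 : Y) =
    \sum_(xw <- repr t) repr (xw.1 : lquo _) *> val xw.2 :> tensor X Y.
  by rewrite -tE.
move: (repr t) E => T E.
pose G (u : U) (w : tens X Y) : seq (op_alg R * (acs_op U * acs_op U)) :=
  [seq (xr.2 : R, (hc (- p%:Z) (repr (xr.1 : lquo (NLi U p.+1))) : U, hc p%:Z u : U)) | xr <- repr w].
exists (flatten [seq G (repr (xw.1 : lquo (NLi U 1))) (val xw.2) |
    xw : lquot (zhu_l U 0) * omega_l (zhu_l U 0) (tensor X Y) <- T]); last first.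
  move=> _ /flatten_mapP[xw _ /mapP[xr _ ->]].
  by split; rewrite op_homog ?opprK homog_hc.
move=> V f fDl fDr fk f0 v0; have [v ->] : exists v : U, v0 = v by exists v0.
rewrite op_homog => hv {v0}.
have fN (r : R) (u u' : U) : u - u' \in NR_pred U 1 -> f r u = f r u'.
  by move=> h; rewrite -[u in LHS](subrK u' u) [LHS]fDr f0 ?add0r.
have hcr (u u' : U) : u - u' \in NL U p.+1%:Z -> hc (- p%:Z) u - hc (- p%:Z) u' \in NR_pred U 1.
  move=> /(NL_hc (- p%:Z)); rewrite -hcB (NR_homog _ (homog_hc _ _)) opprK.
  by rewrite (_ : p.+1%:Z = 1 + p%:Z) //; lia.
pose F (x : X) (r : Y) := f r (hc (- p%:Z) (repr (x : lquo _))).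
have FE (r : Y) u : F (Lcls p u) r = f r (hc (- p%:Z) u) by apply/fN/hcr/(LclsE p); rewrite /Lcls reprK.
have bal : balanced F.
  split=> [x x' r|x r r'|x a r]; last 2 first.
  - exact: (fDl r r').
  - have [u ->] := Lrepr x.
    have -> : (Lcls p u : X) <* a = Lcls p (kstr U a * u).
      by rewrite -[LHS](@lractk k _ _ (Lmod U p)); apply: Lcls_lact.
    rewrite !FE hck kstrC; exact/esym/(fk r a (hc (- p%:Z) u)).
  - have [u ->] := Lrepr x; have [u' ->] := Lrepr x'.
    by rewrite [_ + _]LclsD !FE hcD [LHS]fDr.
have Flact (w : tens X Y) z : tlift F (tens_lact z w) =
    \sum_(xr <- repr w) f xr.2 (hc (- p%:Z) (z * repr (xr.1 : lquo (NLi U p.+1)))).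
  rewrite {1}(tens_sum w) tens_lact_sum.
  rewrite (tlift_sum _ _ bal); apply: eq_bigr => -[x r] _ /=.
  by rewrite tens_lactE (tlift_tmk bal) -FE; congr (F _ r).
have -> : f 1 v = tlift F (tmk (Lcls p v : X) (1 : Y)).
  by rewrite (tlift_tmk bal) FE (homogP _ _ hv).
have -> : tmk (Lcls p v : X) (1 : Y) = tens_lact v (tmk (Lcls p 1 : X) (1 : Y)).
  by rewrite tens_lactE [v *> _]Lcls_lact mulr1.
rewrite E tens_lact_sum (tlift_sum _ _ bal).
rewrite big_flatten /= big_map; apply: eq_bigr => -[x w] _ /=; rewrite big_map /=.
set u := repr x.
have -> : tens_lact v (tens_lact u (val w)) = tens_lact ((v : U) * u) (val w).
  by rewrite -[RHS]/(((v : U) * u) *> (val w : tensor X Y)) lactA.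
have [s [us uE]] := hc_dec u.
rewrite [in LHS]uE mulr_sumr; have /annlP hw := valP (w : annl _ _).
have -> : tens_lact (\sum_(d <- s) (v : U) * hc d u) (val w) =
    \sum_(d <- s) tens_lact ((v : U) * hc d u) (val w).
  exact: (additive_sum _ _ (fun a b => @lactDl _ _ _ (tensor X Y) a b (val w))).
rewrite (tlift_sum _ _ bal).
have vanish d : d != p%:Z -> tlift F (tens_lact ((v : U) * hc d u) (val w)) = 0.
  move=> dp; have hd := homogM hv (homog_hc d u).
  have [d0|d0] := leP 1 (p%:Z - d).
    have -> : tens_lact ((v : U) * hc d u) (val w) = 0.
      by apply: hw; apply: (NL_neg (j := p%:Z - d)) d0; rewrite opprB addrC.
    exact: (additive0 (tliftD bal)).
  rewrite Flact big1 // => xr _; apply: f0; apply: NR_hc; apply: NR_right.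
  by apply: NR_pos hd _; lia.
have main : tlift F (tens_lact ((v : U) * hc p%:Z u) (val w)) =
    \sum_(xr <- repr (val w)) f xr.2 ((v : U) * (hc p%:Z u * hc (- p%:Z) (repr (xr.1 : lquo (NLi U p.+1))))).
  rewrite Flact; apply: eq_bigr => xr _.
  by rewrite (hcMl _ _ (homogNM0 hv (homog_hc _ _))) subr0 mulrA.
have [ps|ps] := boolP (p%:Z \in s).
  by rewrite (bigD1_seq p%:Z) //= big1 ?addr0 // => d; apply: vanish.
rewrite big_seq big1 => [|d ds]; last by apply: vanish; apply: contraNneq ps => <-.
have u0 : hc p%:Z u = 0.
  rewrite uE hc_sum big_seq big1 // => d ds; rewrite hc_hc.
  by case: eqP => // dp; rewrite dp ds in ps.
rewrite big1 // => xr _; apply: f0.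
rewrite u0 -[_ * _]/((v : U) * (0 * hc (- p%:Z) (repr (xr.1 : lquo (NLi U p.+1))))) mul0r mulr0.
exact: rpred0.
Qed.
End Spread.
End LeftExtraction.

(** * Dual bases *)

Section FreeModules.
Variables (k : comPzRingType) (R : kalg k) (n : nat).

Program Definition free_r : bimod (base_alg k) R :=
  @Bimod k (base_alg k) R ('I_n -> R)
    (fun a g j => kstr R a * g j) (fun g r j => g j * r) _ _ _ _ _ _ _ _ _ _.
Next Obligation. by apply/funext => j; rewrite rmorphD mulrDl. Qed.
Next Obligation. by apply/funext => j; rewrite -mulrDr. Qed.
Next Obligation. by apply/funext => j; rewrite rmorphM mulrA. Qed.
Next Obligation. by apply/funext => j; rewrite rmorph1 mul1r. Qed.
Next Obligation. by apply/funext => j; rewrite -mulrDl. Qed.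
Next Obligation. by apply/funext => j; rewrite mulrDr. Qed.
Next Obligation. by apply/funext => j; rewrite mulrA. Qed.
Next Obligation. by apply/funext => j; rewrite mulr1. Qed.
Next Obligation. by apply/funext => j; rewrite mulrA. Qed.
Next Obligation. by apply/funext => j; rewrite kstrC. Qed.

Program Definition free_l : bimod R (base_alg k) :=
  @Bimod k R (base_alg k) ('I_n -> R)
    (fun r g j => r * g j) (fun g a j => g j * kstr R a) _ _ _ _ _ _ _ _ _ _.
Next Obligation. by apply/funext => j; rewrite mulrDl. Qed.
Next Obligation. by apply/funext => j; rewrite -mulrDr. Qed.
Next Obligation. by apply/funext => j; rewrite mulrA. Qed.
Next Obligation. by apply/funext => j; rewrite mul1r. Qed.
Next Obligation. by apply/funext => j; rewrite -mulrDl. Qed.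
Next Obligation. by apply/funext => j; rewrite rmorphD mulrDr. Qed.
Next Obligation. by apply/funext => j; rewrite rmorphM mulrA. Qed.
Next Obligation. by apply/funext => j; rewrite rmorph1 mulr1. Qed.
Next Obligation. by apply/funext => j; rewrite mulrA. Qed.
Next Obligation. by apply/funext => j; rewrite kstrC. Qed.

Program Definition free_r_map (M : bimod (base_alg k) R) (w : 'I_n -> M) :
    bhom free_r M :=
  @BHom _ _ _ free_r M (fun g => \sum_j w j <* g j) _ _ _.
Next Obligation. by rewrite -big_split; apply: eq_bigr => j _; apply: ractDr. Qed.
Next Obligation.
rewrite [RHS](@lractk _ _ _ M s) (additive_sum _ _ (fun x y => @ractDl _ _ _ M x y _)).
by apply: eq_bigr => j _; rewrite kstrC ractA.
Qed.
Next Obligation.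
rewrite (additive_sum _ _ (fun x y => @ractDl _ _ _ M x y r)).
by apply: eq_bigr => j _; apply: ractA.
Qed.

Program Definition free_l_map (M : bimod R (base_alg k)) (w : 'I_n -> M) :
    bhom free_l M :=
  @BHom _ _ _ free_l M (fun g => \sum_j g j *> w j) _ _ _.
Next Obligation. by rewrite -big_split; apply: eq_bigr => j _; apply: lactDl. Qed.
Next Obligation.
by rewrite (additive_sum _ _ (@lactDr _ _ _ M s)); apply: eq_bigr => j _; apply: lactA.
Qed.
Next Obligation.
rewrite -[RHS](@lractk _ _ _ M r) (additive_sum _ _ (@lactDr _ _ _ M _)).
by apply: eq_bigr => j _; rewrite -kstrC lactA.
Qed.
End FreeModules.

Section DualBases.
Variables (k : comPzRingType) (R : kalg k).

Definition dual_basis_r (M : bimod (base_alg k) R) :=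
  exists n (w : 'I_n -> M) (f : 'I_n -> M -> R),
    [/\ forall j x y, f j (x + y) = f j x + f j y,
        forall j x r, f j (x <* r) = f j x * r &
        forall x, x = \sum_j w j <* f j x].

Definition dual_basis_l (M : bimod R (base_alg k)) :=
  exists n (w : 'I_n -> M) (f : 'I_n -> M -> R),
    [/\ forall j x y, f j (x + y) = f j x + f j y,
        forall j r x, f j (r *> x) = r * f j x &
        forall x, x = \sum_j f j x *> w j].

Lemma fg_projective_dual_r (M : bimod (base_alg k) R) : fg_projective_r M -> dual_basis_r M.
Proof.
move=> [[s hs] hM]; pose w (j : 'I_(size s)) := tnth (in_tuple s) j.
have we : @epi (BMod (base_alg k) R) _ _ (free_r_map w).
  apply: (bhom_surj_epi (f := free_r_map w)) => x; have [c ->] := hs x.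
  by exists (c \o w); rewrite [RHS]big_tnth.
have [g gE] := hM _ _ _ we (bid M).
exists (size s), w, (fun j x => (g : bhom _ _) x j); split=> [j x y|j x r|x].
- by rewrite bfunD.
- by rewrite bfunr.
- by rewrite -[RHS]/(bcomp (free_r_map w) g x) [bcomp _ g]gE.
Qed.

Lemma fg_projective_dual_l (M : bimod R (base_alg k)) : fg_projective_l M -> dual_basis_l M.
Proof.
move=> [[s hs] hM]; pose w (j : 'I_(size s)) := tnth (in_tuple s) j.
have we : @epi (BMod R (base_alg k)) _ _ (free_l_map w).
  apply: (bhom_surj_epi (f := free_l_map w)) => x; have [c ->] := hs x.
  by exists (c \o w); rewrite [RHS]big_tnth.
have [g gE] := hM _ _ _ we (bid M).
exists (size s), w, (fun j x => (g : bhom _ _) x j); split=> [j x y|j r x|x].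
- by rewrite bfunD.
- by rewrite bfunl.
- by rewrite -[RHS]/(bcomp (free_l_map w) g x) [bcomp _ g]gE.
Qed.
End DualBases.

Section ZhuLift.
Variables (k : comPzRingType) (U : acs_alg k).

Definition zlift (b : zhu U 0) : U := sqrep (D := zhu_sq U 0) b.

Lemma zlift_homog b : zlift b \in homog U 0.
Proof. exact: (@sqrep_in k U (zhu_sq U 0)). Qed.
Lemma zliftK b : zcls (U := U) 0 (zlift_homog b) = b.
Proof. exact: (@sqrepK k U (zhu_sq U 0)). Qed.
Lemma zliftD b c : zlift (b + c) - (zlift b + zlift c) \in NL U 1.
Proof. exact: (@sqrepD k U (zhu_sq U 0)). Qed.
Lemma zliftM b c : zlift (b * c) - zlift b * zlift c \in NL U 1.
Proof. exact: (@sqrepM k U (zhu_sq U 0)). Qed.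
Lemma zliftk a : zlift (kstr (zhu U 0) a) - kstr U a \in NL U 1.
Proof. exact: (@sqrepk k U (zhu_sq U 0)). Qed.

Lemma Lgr_cls p (u : U) : Lcls 0 (hc p u) \in Lgr (U := U) (n := 0) p.
Proof. by apply/LgrP; exists (hc p u); rewrite ?homog_hc. Qed.
Lemma Rgr_cls p (u : U) : Rcls 0 (hc p u) \in Rgr (U := U) (n := 0) p.
Proof. by apply/RgrP; exists (hc p u); rewrite ?homog_hc. Qed.

Definition L0cls p (u : U) : L0_comp U p := exist _ (Lcls 0 (hc p u)) (Lgr_cls p u).
Definition R0cls p (u : U) : R0_comp U p := exist _ (Rcls 0 (hc p u)) (Rgr_cls p u).

Lemma dual_left_unit (R : kalg k) (phi : kalg_hom R (zhu U 0)) p :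
  dual_basis_r (res_r phi (L0_comp U p)) -> spread U R p -> left_unit_at U p.
Proof.
move=> [n [w [f [fD fr fE]]]].
have /choice[a aE] j : exists a, w j = L0cls p a.
  have /LgrP[a /homogP ha aE] := valP (w j : subb _); exists a; apply: val_inj.
  by rewrite /= ha.
apply: (descent (lam := fun r => zlift (phi r)) (w := fun j => hc p (a j))
  (f := fun j u => f j (L0cls p u))).
- by move=> r; apply: zlift_homog.
- by move=> r r'; rewrite raddfD; apply: zliftD.
- by move=> r r'; rewrite rmorphM; apply: zliftM.
- by move=> c; rewrite kah_kstr; apply: zliftk.
- by move=> j; apply: homog_hc.
- move=> j u v; rewrite -fD; congr (f j _); apply: val_inj.
  by rewrite /= hcD -LclsD.
- move=> j u hu; rewrite -(additive0 (fD j)); congr (f j _); apply: val_inj.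
  by rewrite raddf0; apply: lpi0 (NL_hc p hu).
- move=> j u r; rewrite -fr; congr (f j _); apply: val_inj.
  rewrite /= -{2}(zliftK (phi r)) [RHS]Lcls_ract.
  by rewrite (hcMr _ _ (zlift_homog _)) subr0.
- move=> u hu; apply/(LclsE 0); rewrite -{1}(homogP _ _ hu).
  pose v (x : L0_comp U p) : Lmod U 0 := sval x.
  have vD x y : v (x + y) = v x + v y by [].
  rewrite -[LHS]/(v (L0cls p u)) {1}[L0cls p u]fE.
  rewrite (additive_sum _ _ vD) (additive_sum _ _ (fun x y => esym (LclsD 0 x y))).
  apply: eq_bigr => j _; rewrite aE -[LHS]/(Lcls 0 (hc p (a j)) <* phi (f j (L0cls p u))).
  by rewrite -{1}(zliftK (phi (f j _))); apply: Lcls_ract.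
Qed.

Lemma dual_op_left_unit (R : kalg k) (phi : kalg_hom R (zhu U 0)) p :
  dual_basis_l (res_l phi (R0_comp U (- p))) -> spread (acs_op U) (op_alg R) p ->
  left_unit_at (acs_op U) p.
Proof.
move=> [n [w [f [fD fr fE]]]].
have /choice[a aE] j : exists a, w j = R0cls (- p) a.
  have /RgrP[a /homogP ha aE] := valP (w j : subb _); exists a; apply: val_inj.
  by rewrite /= ha.
have h0 (u : U) : u \in homog U 0 -> u \in NL U 1 -> u \in NR_pred U 1 by move=> /NR0 ->.
have zh := zlift_homog.
apply: (@descent k (acs_op U) (op_alg R) p (fun r => zlift (phi r)) n
  (fun j => hc (- p) (a j)) (fun j u => f j (R0cls (- p) u))).
- by move=> r; rewrite op_homog oppr0.
- move=> r r'; apply: h0; first by rewrite rpredB ?rpredD.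
  by have := zliftD (phi r) (phi r'); rewrite -raddfD.
- move=> r r'; have : zlift (phi ((r' : R) * (r : R))) - zlift (phi r') * zlift (phi r) \in NR_pred U 1.
    by apply: h0; rewrite ?rmorphM ?zliftM // rpredB ?homogM0l.
  by [].
- move=> c; apply: h0; first by rewrite rpredB ?homog_kstr.
  by have := zliftk c; rewrite -(kah_kstr phi).
- by move=> j; rewrite op_homog homog_hc.
- move=> j u v; rewrite -[RHS]fD; congr (f j _); apply: val_inj.
  by rewrite /= hcD -RclsD.
- move=> j u hu; rewrite -[RHS](additive0 (fD j)); congr (f j _); apply: val_inj.
  by rewrite raddf0; apply: rpi0 (NR_hc (- p) hu).
- move=> j u r; rewrite -[RHS]fr; congr (f j _); apply: val_inj.
  rewrite /= -{2}(zliftK (phi r)) [RHS]Rcls_lact.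
  by rewrite -[hc _ _]/(hc (- p) (zlift (phi r) * (u : U))) (hcMl _ _ (zh _)) subr0.
- move=> u hu; apply/(RclsE 0); rewrite op_homog in hu; rewrite -{1}(homogP _ _ hu).
  pose v (x : R0_comp U (- p)) : Rmod U 0 := sval x.
  have vD x y : v (x + y) = v x + v y by [].
  rewrite -[LHS]/(v (R0cls (- p) u)) {1}[R0cls (- p) u]fE.
  rewrite (additive_sum _ _ vD) (additive_sum _ _ (fun x y => esym (RclsD 0 x y))).
  apply: eq_bigr => j _; rewrite aE -[LHS]/(phi (f j (R0cls (- p) u)) *> Rcls 0 (hc (- p) (a j))).
  by rewrite -{1}(zliftK (phi (f j _))); apply: Rcls_lact.
Qed.
End ZhuLift.

Section LevelZero.
Variables (k : comPzRingType) (U : acs_alg k).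

Lemma spread_base_left_unit (V : acs_alg k) p : spread V (base_alg k) p -> left_unit_at V p.
Proof.
move=> [s hs ht]; exists (\sum_(t <- s) kstr V t.1 * (t.2.1 * t.2.2)); split.
  rewrite big_seq; elim/big_ind: _ => [|x y|t /ht[hy hx]]; [exact: psum0 | exact: psumD |].
  by rewrite mulrA; apply: psum_mul; rewrite homogM0l ?homog_kstr.
move=> a ha; pose g (c : base_alg k) (u : V) := kstr V c * u.
have := spreads_mod (Q := NL V 1) (g := g) hs _ _ _ _ ha; rewrite /g.
rewrite rmorph1 mul1r mulr_suml; under eq_bigr do rewrite mulrA; apply.
- by move=> r r' u; rewrite rmorphD mulrDl subrr rpred0.
- by move=> r u u'; rewrite mulrDr subrr rpred0.
- by move=> r c u; rewrite rmorphM mulrA subrr rpred0.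
- by move=> r u hu; apply: NL_k.
Qed.

Lemma spread_op_base (V : acs_alg k) p :
  spread V (op_alg (base_alg k)) p -> spread V (base_alg k) p.
Proof.
move=> [s hs ht]; exists s => // W f fDl fDr fk f0; apply: hs => // r a u.
by rewrite -fk; congr (f _ u); apply: mulrC.
Qed.

Variable R : kalg k.
Variable phi : kalg_hom R (zhu U 0).

Lemma adj_r_SIC : adjoint_equivalence (adj_r (zhu_r U 0) R) ->
  (forall p : nat, spread U R p%:Z -> left_unit_at U p%:Z) -> SIC U.
Proof.
move=> h hp; apply/SIC_sic_at/sic_of_left_units; first exact: adj_r_idealizer h phi.
by move=> p _; apply/hp/adj_r_spread.
Qed.

Lemma adj_l_SIC : adjoint_equivalence (adj_l (zhu_l U 0) R) ->
  (forall p : nat, spread (acs_op U) (op_alg R) p%:Z -> left_unit_at (acs_op U) p%:Z) -> SIC U.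
Proof.
move=> h hp; apply/op_SIC/sic_of_left_units; first exact: adj_l_idealizer h phi.
by move=> p _; apply/hp/adj_l_spread.
Qed.
End LevelZero.

Theorem theoremA (k : comPzRingType) (U : acs_alg k) :
  (SIC U <-> exists e : nat -> hat U 0, strong_identity_expansion e) /\
  (SIC U <-> forall n : nat,
     projective (Lmod_ex U n) /\ projective (Rmod_ex U n)) /\
  (SIC U <-> forall n : nat,
     adjoint_equivalence (adj_l (thick_l U n) (base_alg k)) /\
     adjoint_equivalence (adj_r (thick_r U n) (base_alg k))) /\
  (* (a) *)
  (((forall p : nat, fg_projective_r (L0_comp U p%:Z)) ->
    (SIC U <-> adjoint_equivalence (adj_r (zhu_r U 0) (zhu U 0)))) /\
   ((forall p : nat, fg_projective_l (R0_comp U (- p%:Z))) ->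
    (SIC U <-> adjoint_equivalence (adj_l (zhu_l U 0) (zhu U 0))))) /\
  (* (b) *)
  (forall (R : kalg k) (phi : kalg_hom R (zhu U 0)),
    ((forall p : nat, fg_projective_r (res_r phi (L0_comp U p%:Z))) ->
     @isomorphic (BMod (zhu U 0) R)
       (hom_l (res_l phi (regular (zhu U 0))) (regular R))
       (res_r phi (regular (zhu U 0))) ->
     (SIC U <-> adjoint_equivalence (adj_r (zhu_r U 0) R))) /\
    ((forall p : nat, fg_projective_l (res_l phi (R0_comp U (- p%:Z)))) ->
     @isomorphic (BMod R (zhu U 0))
       (hom_r (res_r phi (regular (zhu U 0))) (regular R))
       (res_l phi (regular (zhu U 0))) ->
     (SIC U <-> adjoint_equivalence (adj_l (zhu_l U 0) R)))) /\
  (* (c) *)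
  (forall eps : kalg_hom (zhu U 0) (base_alg k),
    ((forall p : int,
        fg_projective_l (indl_comp (res_l eps (regular (base_alg k))) p)) ->
     (SIC U <-> adjoint_equivalence (adj_r (zhu_r U 0) (base_alg k)))) /\
    ((forall p : int,
        fg_projective_r (indr_comp (res_r eps (regular (base_alg k))) p)) ->
     (SIC U <-> adjoint_equivalence (adj_l (zhu_l U 0) (base_alg k))))).
Proof.
split; first exact: SIC_expansion.
split; first exact: SIC_projective.
split; first exact: SIC_thick.
split; last split.
- split=> hfg; split=> [sic|h].
  + exact: SIC_zhu_r.
  + apply: (adj_r_SIC (id_hom _) h) => p; apply: (dual_left_unit (phi := id_hom (zhu U 0))).
    exact: (fg_projective_dual_r (hfg p)).
  + exact: SIC_zhu_l.
  + apply: (adj_l_SIC (id_hom _) h) => p; apply: (dual_op_left_unit (phi := id_hom (zhu U 0))).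
    exact: (fg_projective_dual_l (hfg p)).
- move=> R phi; split=> hfg _; split=> [sic|h].
  + exact: SIC_zhu_r.
  + apply: (adj_r_SIC phi h) => p; apply: (dual_left_unit (phi := phi)).
    exact: (fg_projective_dual_r (hfg p)).
  + exact: SIC_zhu_l.
  + apply: (adj_l_SIC phi h) => p; apply: (dual_op_left_unit (phi := phi)).
    exact: (fg_projective_dual_l (hfg p)).
- move=> eps; split=> _; split=> [sic|h].
  + exact: SIC_zhu_r.
  + by apply: (adj_r_SIC (kstr_hom _) h) => p; apply: spread_base_left_unit.
  + exact: SIC_zhu_l.
  + by apply: (adj_l_SIC (kstr_hom _) h) => p /spread_op_base; apply: spread_base_left_unit.
Qed.
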